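(* Let $E$ be a directed graph. Then $C^*(E)$ is an AF-algebra if and only if $E$ has no loops.
   Context: A (directed) graph $E=(E^0,E^1,r,s)$ consists of countable sets $E^0$ of vertices and $E^1$ of edges, and maps $r,s:E^1\to E^0$ (range and source); $E$ is not assumed row-finite. A vertex $v$ is a sink if $|s^{-1}(v)|=0$ and an infinite-emitter if $|s^{-1}(v)|=\infty$; $v$ is singular if it is a sink or an infinite-emitter. A loop is a finite path $\alpha=\alpha_1\cdots\alpha_{|\alpha|}$ (edges with $r(\alpha_i)=s(\alpha_{i+1})$, length at least 1) with $s(\alpha)=r(\alpha)$. A Cuntz-Krieger $E$-family consists of mutually orthogonal projections $\{p_v : v\in E^0\}$ and partial isometries $\{s_e : e\in E^1\}$ with orthogonal ranges satisfying: (1) $s_e^*s_e=p_{r(e)}$ for every $e\in E^1$; (2) $s_es_e^*\le p_{s(e)}$ for every $e\in E^1$; (3) $p_v=\sum_{\{e : s(e)=v\}}s_es_e^*$ for every $v\in E^0$ that is not a singular vertex. The graph algebra $C^*(E)$ is the $C^*$-algebra generated by a universal Cuntz-Krieger $E$-family. *)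

(* Defs.v *)
From HB Require Import structures.
From mathcomp Require Import all_boot all_order all_algebra complex.
From mathcomp Require Import all_classical all_reals all_analysis.

Set Implicit Arguments.
Unset Strict Implicit.
Unset Printing Implicit Defensive.

Import Order.TTheory GRing.Theory Num.Theory.
Import numFieldNormedType.Exports.

Local Open Scope classical_set_scope.
Local Open Scope ring_scope.
Local Open Scope complex_scope.

(* C*-algebras are not required to be unital, nor to be nonzero: the graph
   algebra of a graph with infinitely many vertices has no unit, and that of the
   empty graph is 0.  Hence the product cannot be inherited from MathComp's
   (unital) ring structures. *)
HB.mixin Record CompleteNormedModule_isCStarAlgebra (R : realType) A
    of CompleteNormedModule R[i] A := {
  cmul : A -> A -> A ;
  star : A -> A ;
  cmulA : associative cmul ;
  cmulDl : left_distributive cmul +%R ;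
  cmulDr : right_distributive cmul +%R ;
  cmulZl : forall (k : R[i]) (a b : A), cmul (k *: a) b = k *: cmul a b ;
  cmulZr : forall (k : R[i]) (a b : A), cmul a (k *: b) = k *: cmul a b ;
  starK : involutive star ;
  starD : {morph star : a b / a + b} ;
  starZ : forall (k : R[i]) (a : A), star (k *: a) = k^* *: star a ;
  starM : forall a b : A, star (cmul a b) = cmul (star b) (star a) ;
  normcM : forall a b : A, `|cmul a b| <= `|a| * `|b| ;
  norm_starM : forall a : A, `|cmul (star a) a| = `|a| ^+ 2
}.

#[short(type="cstarAlgType")]
HB.structure Definition CStarAlgebra (R : realType) :=
  {A of CompleteNormedModule R[i] A
      & CompleteNormedModule_isCStarAlgebra R A}.

Declare Scope cstar_scope.
Delimit Scope cstar_scope with cstar.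
Infix "**" := cmul (at level 40, left associativity) : cstar_scope.
Local Open Scope cstar_scope.

Section CStarAlgebras.
Context {R : realType}.

Definition is_projection (A : cstarAlgType R) (a : A) : Prop :=
  star a = a /\ a ** a = a.

Definition is_partial_isometry (A : cstarAlgType R) (a : A) : Prop :=
  a ** star a ** a = a.

Definition orthogonal_projections (A : cstarAlgType R) (a b : A) : Prop :=
  a ** b = 0.

Definition is_positive (A : cstarAlgType R) (a : A) : Prop :=
  exists c : A, a = star c ** c.

Definition cstar_le (A : cstarAlgType R) (a b : A) : Prop :=
  is_positive (b - a).

Record is_star_hom (A B : cstarAlgType R) (f : A -> B) : Prop := {
  star_hom_linear : linear f ;
  star_homM : {morph f : a b / a ** b} ;
  star_hom_star : {morph f : a / star a}
}.

Record is_cstar_subalgebra (A : cstarAlgType R) (S : set A) : Prop := {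
  cstar_subalgebra0 : S 0 ;
  cstar_subalgebraD : forall a b, S a -> S b -> S (a + b) ;
  cstar_subalgebraZ : forall (k : R[i]) a, S a -> S (k *: a) ;
  cstar_subalgebraM : forall a b, S a -> S b -> S (a ** b) ;
  cstar_subalgebra_star : forall a, S a -> S (star a) ;
  cstar_subalgebra_closed : closed S
}.

Definition finite_dimensional (A : cstarAlgType R) (S : set A) : Prop :=
  exists (n : nat) (b : 'I_n -> A),
    S = range (fun c : 'I_n -> R[i] => \sum_(i < n) c i *: b i).

Definition is_AF (A : cstarAlgType R) : Prop :=
  exists S : nat -> set A,
    [/\ forall n, is_cstar_subalgebra (S n),
        forall n, finite_dimensional (S n),
        forall n, S n `<=` S n.+1
      & closure (\bigcup_n S n) = [set: A]].

Definition cstar_generates (A : cstarAlgType R) (X : set A) : Prop :=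
  forall S : set A, is_cstar_subalgebra S -> X `<=` S -> S = [set: A].

End CStarAlgebras.

Record digraph := Digraph {
  vertex : countType ;
  edge : countType ;
  rng : edge -> vertex ;
  src : edge -> vertex
}.

Section Graphs.
Variable E : digraph.

Definition out_edges (v : vertex E) : set (edge E) := [set e | src e = v].

Definition is_sink (v : vertex E) : Prop := out_edges v = set0.

Definition is_infinite_emitter (v : vertex E) : Prop :=
  infinite_set (out_edges v).

Definition is_singular (v : vertex E) : Prop :=
  is_sink v \/ is_infinite_emitter v.

(* [e :: p] is the path with first edge [e]; this builds in length >= 1. *)
Definition is_path (e : edge E) (p : seq (edge E)) : Prop :=
  path (fun f g => rng f == src g) e p.

Definition is_loop (e : edge E) (p : seq (edge E)) : Prop :=
  is_path e p /\ src e = rng (last e p).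

Definition has_no_loops : Prop := forall e p, ~ is_loop e p.

End Graphs.

Section GraphAlgebras.
Context {R : realType}.
Variable E : digraph.

(* The finitely supported sum in [ck_sum] is over the finite set
   [out_edges v], since [v] is not an infinite emitter. *)
Record is_CK_family (A : cstarAlgType R)
    (p : vertex E -> A) (s : edge E -> A) : Prop := {
  ck_projection : forall v, is_projection (p v) ;
  ck_orthogonal : forall v w, v <> w -> orthogonal_projections (p v) (p w) ;
  ck_partial_isometry : forall e, is_partial_isometry (s e) ;
  ck_orthogonal_ranges : forall e f, e <> f ->
    orthogonal_projections (s e ** star (s e)) (s f ** star (s f)) ;
  ck_source : forall e, star (s e) ** s e = p (rng e) ;
  ck_range_le : forall e, cstar_le (s e ** star (s e)) (p (src e)) ;
  ck_sum : forall v, ~ is_singular v ->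
    p v = \sum_(e \in out_edges v) (s e ** star (s e))
}.

(* [A], together with the family [(p, s)], is the graph algebra C*(E): this
   determines it up to a unique isomorphism carrying one generating family to
   the other.  Uniqueness of [f] follows from generation. *)
Record is_graph_algebra (A : cstarAlgType R)
    (p : vertex E -> A) (s : edge E -> A) : Prop := {
  graph_algebra_family : is_CK_family p s ;
  graph_algebra_generated : cstar_generates (range p `|` range s) ;
  graph_algebra_universal : forall (B : cstarAlgType R)
      (q : vertex E -> B) (t : edge E -> B), is_CK_family q t ->
    exists f : A -> B,
      [/\ is_star_hom f, forall v, f (p v) = q v & forall e, f (s e) = t e]
}.

End GraphAlgebras.

(* Main.v *)
Require Import Defs.
From HB Require Import structures.
From mathcomp Require Import finmap all_boot all_order all_algebra complex.
From mathcomp Require Import all_classical all_reals all_analysis.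
From mathcomp Require Import ring lra.

Set Implicit Arguments.
Unset Strict Implicit.
Unset Printing Implicit Defensive.

Import Order.TTheory GRing.Theory Num.Theory.
Import numFieldNormedType.Exports.

Local Open Scope classical_set_scope.
Local Open Scope ring_scope.
Local Open Scope complex_scope.
Local Open Scope cstar_scope.

Local Notation Re := complex.Re.
Local Notation Im := complex.Im.

(* If [E] has no loops, only finitely many paths use edges of a given finite set,
   and the elements [s_a p_v s_b^*], for such paths [a] and [b] and for [v] in a
   finite set of vertices, span a C*-subalgebra; these finite-dimensional
   subalgebras increase to a dense union.

   Conversely, let [C*(E)] be AF and let [c] be a loop based at [v].  Then
   [s_c^* s_c = p_v], and in an AF-algebra such an isometry is unitary:
   [s_c s_c^* = p_v].  The universal property, applied to a representation on
   the square-summable functions on boundary paths, gives [p_v <> 0] for all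
   [v], so that [c] has no exit.  Hence exactly one boundary path [xi] starts at
   [v].  Twisting the representation of one edge of [c] by [e^(it)] and taking
   the matrix coefficient at [xi] gives functionals, multiplicative on
   the corner of [p_v] and continuous in [t], that map [s_c] to [e^(it)].  This
   winding is impossible in an AF-algebra, because a self-adjoint element of the
   corner is nearly a combination of projections, on which these characters are
   constant in [t]. *)

(** Relation (2) is an order relation: [a <= b] means that [b - a] has the form [star c ** c].
    Already [p (src e) ** s e = s e] requires that two such elements with sum 0 both vanish. The
    other fact of this kind is that star homomorphisms are contractive, which bounds the functionals
    and makes them continuous in t. Both are obtained without spectra: square roots come from an
    iteration, positivity of h is the estimate |l - h| <= l, and commuting self-adjoint h and k are
    handled through the norm of h + i k. C*(E) need not have a unit. A unit is borrowed from an
    algebra of multipliers, or hidden in a map such as x |-> s x + x - p x, and functions of an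
    element are polynomials without constant term. The shift by 3 keeps the spectral threshold 3
    away from 0, so that the spectral projection is a bounded multiple of the element it comes
    from. *)

Section RealNorm.
Context {R : realType}.

(* The norms of [R[i]]-modules are [R[i]]-valued; [nrm] is their real value. *)
Definition nrm (V : normedZmodType R[i]) (a : V) : R := Re `|a|.

Section NormedZmod.
Variable V : normedZmodType R[i].
Implicit Types a b : V.

Lemma normE a : `|a| = (nrm a)%:C.
Proof. by rewrite /nrm RRe_real // ger0_real. Qed.

Lemma nrm_ge0 a : 0 <= nrm a.
Proof. by rewrite -ler0c -normE. Qed.

Lemma nrmD a b : nrm (a + b) <= nrm a + nrm b.
Proof. by rewrite -lecR rmorphD /= -!normE ler_normD. Qed.

Lemma nrmN a : nrm (- a) = nrm a.
Proof. by rewrite /nrm normrN. Qed.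

Lemma nrmB a b : nrm (a - b) <= nrm a + nrm b.
Proof. by rewrite -(nrmN b) nrmD. Qed.

Lemma nrmC a b : nrm (a - b) = nrm (b - a).
Proof. by rewrite -nrmN opprB. Qed.

Lemma nrm0 : nrm (0 : V) = 0.
Proof. by rewrite /nrm normr0. Qed.

Lemma nrm_eq0 a : nrm a = 0 -> a = 0.
Proof. by move=> a0; apply/normr0_eq0; rewrite normE a0. Qed.

Lemma nrm_gt0 a : a <> 0 -> 0 < nrm a.
Proof. by move=> a0; rewrite lt_neqAle nrm_ge0 andbT eq_sym; apply/eqP => /nrm_eq0. Qed.

Lemma nrm_le0 a : nrm a <= 0 -> a = 0.
Proof. by move=> a0; apply: nrm_eq0; apply/eqP; rewrite eq_le a0 nrm_ge0. Qed.

Lemma nrm_small a : (forall e : R, 0 < e -> nrm a <= e) -> a = 0.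
Proof.
move=> ae; apply: nrm_le0; apply/ler_addgt0Pl => e e0.
by rewrite addr0; exact: ae.
Qed.

Lemma nrm_dist a b c : nrm (a - c) <= nrm (a - b) + nrm (b - c).
Proof. by rewrite (_ : a - c = (a - b) + (b - c)) ?nrmD // addrA subrK. Qed.

End NormedZmod.

Lemma nrmZ (V : normedModType R[i]) (k : R[i]) (a : V) :
  nrm (k *: a) = nrm k * nrm a.
Proof. by apply: complexI; rewrite rmorphM /= -!normE normrZ. Qed.

Lemma nrmM (k l : R[i]) : nrm (k * l) = nrm k * nrm l.
Proof. by apply: complexI; rewrite rmorphM /= -!normE normrM. Qed.

Lemma nrm_real (x : R) : nrm (x%:C) = `|x|.
Proof. by rewrite /nrm normc_def /= expr0n /= addr0 sqrtr_sqr. Qed.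

Lemma nrm1 : nrm (1 : R[i]) = 1.
Proof. by rewrite (nrm_real 1) normr1. Qed.

Lemma nrm_conj (k : R[i]) : nrm k^* = nrm k.
Proof. by apply: complexI; rewrite -!normE normcJ. Qed.

Lemma nrm_sqr (k : R[i]) : nrm k ^+ 2 = Re k ^+ 2 + Im k ^+ 2.
Proof. by rewrite /nrm normc_def /= sqr_sqrtr // addr_ge0 // sqr_ge0. Qed.

Lemma nrm_Re (k : R[i]) : `|Re k| <= nrm k.
Proof. by rewrite -lecR -normE normc_ge_Re. Qed.

Lemma nrm_Im (k : R[i]) : `|Im k| <= nrm k.
Proof.
rewrite -(ler_sqr (x := `|_|)) ?nnegrE ?nrm_ge0 // nrm_sqr real_normK ?num_real //.
by rewrite lerDr sqr_ge0.
Qed.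

Lemma nrm_ReIm (k : R[i]) : nrm k <= `|Re k| + `|Im k|.
Proof.
rewrite -ler_sqr ?nnegrE ?nrm_ge0 ?addr_ge0 // nrm_sqr sqrrD.
rewrite !real_normK ?num_real // -addrA lerD2l lerDr.
by rewrite mulrn_wge0 // mulr_ge0.
Qed.

End RealNorm.

(** * Sequential limits and completeness *)

Section Sequences.
Context {R : realType}.

Definition tends (V : normedZmodType R[i]) (u : nat -> V) (l : V) :=
  forall e : R, 0 < e -> exists N, forall n, (N <= n)%N -> nrm (u n - l) <= e.

Definition cauchy_seq (V : normedZmodType R[i]) (u : nat -> V) :=
  forall e : R, 0 < e ->
    exists N, forall m n, (N <= m)%N -> (N <= n)%N -> nrm (u m - u n) <= e.

Lemma ball_nrm (V : normedModType R[i]) (x y : V) (e : R) :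
  ball x e%:C y = (nrm (x - y) < e) :> Prop.
Proof. by rewrite -ball_normE /ball_ /= normE ltcR. Qed.

Lemma gt0_real (e : R[i]) : 0 < e -> exists2 d : R, 0 < d & e = d%:C.
Proof.
move=> e0; exists (Re e); last by rewrite RRe_real // gtr0_real.
by move: e0; rewrite ltcE /= => /andP[].
Qed.

Lemma closureP (V : normedModType R[i]) (S : set V) (x : V) :
  closure S x <-> forall e : R, 0 < e -> exists2 y, S y & nrm (x - y) < e.
Proof.
split=> [xS e e0|xS B].
  have /xS [y [Sy]] : nbhs x (ball x e%:C) by apply: nbhsx_ballx; rewrite ltcR.
  by rewrite ball_nrm => xy; exists y.
rewrite -nbhs_ballE => -[e /= /gt0_real[d d0 ->] xB].
have [y Sy xy] := xS d d0; exists y; split=> //.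
by apply: xB; rewrite ball_nrm.
Qed.

Lemma small_inv (e : R) : 0 < e ->
  exists N, forall n, (N <= n)%N -> n.+1%:R^-1 <= e.
Proof.
move=> e0; exists (Num.Def.archi_bound e^-1) => n Nn.
rewrite -(invrK e) lef_pV2 ?posrE ?invr_gt0 //.
have := archi_boundP (ltW (_ : 0 < e^-1)); rewrite invr_gt0 => /(_ e0) /ltW.
by move=> /le_trans; apply; rewrite ler_nat; apply: leq_trans Nn _.
Qed.

(** Completeness is phrased with filters, but the limits below are built along sequences. For each n
    choose a centre whose ball of radius 1/(n+1) belongs to [F]. Two members of a filter meet, so
    the centres form a Cauchy sequence, and [F] converges to its limit. *)
Lemma cauchy_complete_seq (V : normedModType R[i]) :
  (forall u : nat -> V, cauchy_seq u -> exists l, tends u l) ->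
  forall F : set_system V, ProperFilter F -> cauchy F -> cvg F.
Proof.
move=> Vc F FF /cauchyP Fc.
have /choice[c cP] (n : nat) : exists x : V, F (ball x (n.+1%:R^-1%:C)).
  by have [|x Fx] := Fc (n.+1%:R^-1)%:C; [by rewrite ltcR invr_gt0 | exists x].
have cc m n : nrm (c m - c n) <= m.+1%:R^-1 + n.+1%:R^-1.
  have [y []] := filter_ex (filterI (cP m) (cP n)).
  rewrite !ball_nrm => /ltW h1 /ltW h2.
  by rewrite (le_trans (nrm_dist _ y _)) // lerD // nrmC.
have [e e0|l cl] := Vc c.
  have [|N NP] := @small_inv (e / 2); first by rewrite divr_gt0.
  exists N => m n Nm Nn; rewrite (le_trans (cc m n)) // (splitr e) lerD ?NP //.
apply/cvg_ex; exists l => A; rewrite -nbhs_ballE => -[_ /= /gt0_real[d d0 ->] lA].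
have d20 : 0 < d / 4 by rewrite divr_gt0.
have [N1 h1] := cl _ d20; have [N2 h2] := small_inv d20.
pose n := maxn N1 N2; apply: filterS (cP n) => x; rewrite ball_nrm => xc.
apply: lA; rewrite ball_nrm.
have := h1 n (leq_maxl _ _); have := h2 n (leq_maxr _ _).
have := nrm_dist l (c n) x; rewrite (nrmC l (c n)); move: xc; set q := n.+1%:R^-1; move: q => q; lra.
Qed.

Lemma cauchy_seq_tends (V : completeNormedModType R[i]) (u : nat -> V) :
  cauchy_seq u -> exists l, tends u l.
Proof.
move=> uc; have : cauchy (u @ \oo).
  apply/cauchyP => _ /gt0_real[d d0 ->].
  have [|N NP] := uc (d / 2); first by rewrite divr_gt0.
  exists (u N); exists N => // n /= Nn; rewrite ball_nrm.
  by rewrite (le_lt_trans (NP _ _ _ Nn)) // gtr_pMr // invf_lt1 // ltr1n.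
move=> /cauchy_cvg/cvg_ex[l ul]; exists l => e e0.
have /ul[N _ NP] : nbhs l (ball l e%:C) by apply: nbhsx_ballx; rewrite ltcR.
exists N => n Nn; have := NP n Nn; rewrite /= ball_nrm nrmC; exact: ltW.
Qed.

Lemma complex_cauchy_tends (u : nat -> R[i]) :
  cauchy_seq u -> exists l, tends u l.
Proof.
move=> uc.
have rc (v : nat -> R) : (forall e, 0 < e -> exists N, forall m n,
    (N <= m)%N -> (N <= n)%N -> `|v m - v n| <= e) ->
    exists l : R, forall e, 0 < e -> exists N, forall n, (N <= n)%N -> `|v n - l| <= e.
  move=> vc; have : cauchy (v @ \oo).
    apply/cauchyP => d d0.
    have [|N NP] := vc (d / 2); first by rewrite divr_gt0.
    exists (v N); exists N => // n /= Nn; rewrite -ball_normE /ball_ /=.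
    by rewrite (le_lt_trans (NP _ _ _ Nn)) // gtr_pMr // invf_lt1 // ltr1n.
  move=> /cauchy_cvg/cvg_ex[l vl]; exists l => e e0.
  have /vl[N _ NP] : nbhs l (ball l e) by apply: nbhsx_ballx.
  exists N => n Nn; have := NP n Nn; rewrite /= -ball_normE /ball_ /= distrC.
  exact: ltW.
have [e /uc[N NP]|a aP] := rc (fun n => Re (u n)).
  exists N => m n Nm Nn; apply: le_trans (NP m n Nm Nn).
  by rewrite -raddfB nrm_Re.
have [e /uc[N NP]|b bP] := rc (fun n => Im (u n)).
  exists N => m n Nm Nn; apply: le_trans (NP m n Nm Nn).
  by rewrite -raddfB nrm_Im.
exists (a +i* b) => e e0; have e20 : 0 < e / 2 by rewrite divr_gt0.
have [N1 h1] := aP _ e20; have [N2 h2] := bP _ e20.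
exists (maxn N1 N2) => n; rewrite geq_max => /andP[/h1 n1 /h2 n2].
by rewrite (le_trans (nrm_ReIm _)) // !raddfB /= (splitr e) lerD.
Qed.

Lemma tends_unique (V : normedZmodType R[i]) (u : nat -> V) a b :
  tends u a -> tends u b -> a = b.
Proof.
move=> ua ub; apply/subr0_eq/nrm_small => e e0.
have e20 : 0 < e / 2 by rewrite divr_gt0.
have [N1 h1] := ua _ e20; have [N2 h2] := ub _ e20.
pose n := maxn N1 N2; rewrite (le_trans (nrm_dist _ (u n) _)) // (splitr e).
by rewrite lerD //; [rewrite nrmC h1 // leq_maxl | rewrite h2 // leq_maxr].
Qed.

Lemma tends_nrm_le (V : normedZmodType R[i]) (u : nat -> V) a (C : R) N :
  tends u a -> (forall n, (N <= n)%N -> nrm (u n) <= C) -> nrm a <= C.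
Proof.
move=> ua uC; apply/ler_addgt0Pl => e e0; have [M h] := ua _ e0.
pose n := maxn N M; have := nrm_dist a (u n) 0; rewrite !subr0 => /le_trans.
by apply; rewrite lerD ?uC ?leq_maxl // nrmC h // leq_maxr.
Qed.

End Sequences.

(** * Adjointable operators *)

(* [ip] need not be scalar-valued: for a C*-algebra acting on itself by left
   multiplication it is [star a ** b], so that the construction below yields
   both the bounded operators of a Hilbert space and the multiplier algebra. *)
Record ipModule (R : realType) := IPModule {
  ip_sort :> completeNormedModType R[i];
  ip_val : normedZmodType R[i];
  ip : ip_sort -> ip_sort -> ip_val;
  ipDl : forall x y z, ip (x + y) z = ip x z + ip y z;
  ipDr : forall x y z, ip x (y + z) = ip x y + ip x z;
  ipZ : forall (k : R[i]) x y, ip (k *: x) y = ip x (k^* *: y);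
  ip_swap : ip_val -> ip_val;
  ip_swapE : forall x y, ip y x = ip_swap (ip x y);
  ip_le : forall x y, nrm (ip x y) <= nrm x * nrm y;
  ip_xx : forall x, nrm (ip x x) = nrm x ^+ 2
}.

Section Adjointable.
Context {R : realType} (H : ipModule R).
Implicit Types (x y z : H) (T : H -> H).

Definition adjoint T T' := forall x y, ip (T x) y = ip x (T' y).

Definition bounded T :=
  exists2 C : R, 0 <= C & forall x, nrm (T x) <= C * nrm x.

(** Homogeneity is a clause of its own because [ip] may be only the real part of an inner product,
    for which complex conjugation has an adjoint. Additivity does follow from the adjoint. *)
Definition adjointable T :=
  [/\ bounded T, (forall k x, T (k *: x) = k *: T x) & exists T', adjoint T T'].

Lemma ipNl x y : ip (- x) y = - ip x y.
Proof.
apply/eqP; rewrite -addr_eq0 -ipDl addNr; apply/eqP.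
by apply: (addrI (ip 0 y)); rewrite addr0 -ipDl addr0.
Qed.

Lemma ipNr x y : ip x (- y) = - ip x y.
Proof.
apply/eqP; rewrite -addr_eq0 -ipDr addNr; apply/eqP.
by apply: (addrI (ip x 0)); rewrite addr0 -ipDr addr0.
Qed.

Lemma ipBl x y z : ip (x - y) z = ip x z - ip y z.
Proof. by rewrite ipDl ipNl. Qed.

Lemma ipBr x y z : ip x (y - z) = ip x y - ip x z.
Proof. by rewrite ipDr ipNr. Qed.

Lemma ip0l y : ip (0 : H) y = 0.
Proof. by rewrite -(subrr 0) ipBl subrr. Qed.

Lemma ip0r x : ip x (0 : H) = 0.
Proof. by rewrite -(subrr 0) ipBr subrr. Qed.

Lemma ip_eqr x y : (forall z, ip x z = ip y z) -> x = y.
Proof.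
move=> xy; apply/subr0_eq/nrm_eq0/eqP.
by rewrite -(sqrf_eq0 (nrm _)) -ip_xx ipBl xy subrr nrm0.
Qed.

Lemma ip_eql x y : (forall z, ip z x = ip z y) -> x = y.
Proof. by move=> xy; apply: ip_eqr => z; rewrite ip_swapE xy -ip_swapE. Qed.

Lemma adjoint_sym T T' : adjoint T T' -> adjoint T' T.
Proof. by move=> TT' x y; rewrite ip_swapE -TT' -ip_swapE. Qed.

Lemma ip_scaler (k : R[i]) x y : ip x (k *: y) = ip (k^* *: x) y.
Proof. by rewrite ipZ conjCK. Qed.

Lemma adjoint_additive T T' x y : adjoint T T' -> T (x + y) = T x + T y.
Proof. by move=> TT'; apply: ip_eqr => z; rewrite TT' !ipDl !TT'. Qed.

Lemma adjoint_uniq T T' T'' : adjoint T T' -> adjoint T T'' -> T' = T''.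
Proof.
by move=> TT' TT''; apply/funext => y; apply: ip_eql => x; rewrite -TT' -TT''.
Qed.

(** A bound C for [T] also bounds [T']: |T' y|^2 is the norm of [ip y (T (T' y))], hence at most C
    |y| |T' y|. *)
Lemma adjoint_adjointable T T' : adjointable T -> adjoint T T' -> adjointable T'.
Proof.
move=> [[C C0 TC] Tk _] TT'; split; last by exists T; exact: adjoint_sym.
- exists C => // y; have [->|y0] := eqVneq (T' y) 0.
    by rewrite nrm0 mulr_ge0 ?nrm_ge0.
  have Ty0 : 0 < nrm (T' y) by apply: nrm_gt0; exact/eqP.
  rewrite -(ler_pM2l Ty0) -expr2 -ip_xx (adjoint_sym TT').
  rewrite (le_trans (ip_le _ _)) // [leLHS]mulrC mulrCA mulrA ler_wpM2r ?nrm_ge0 //.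
- move=> k y; apply: ip_eql => x.
  by rewrite -TT' ip_scaler -Tk TT' -ip_scaler.
Qed.

Lemma adjointable_id : adjointable (@id H).
Proof. by split=> //; [exists 1 => // x; rewrite mul1r | exists id]. Qed.

Lemma adjointable_comp T S : adjointable T -> adjointable S -> adjointable (T \o S).
Proof.
move=> [[C C0 TC] Tk [T' TT']] [[D D0 SD] Sk [S' SS']]; split.
- exists (C * D) => [|x /=]; first exact: mulr_ge0.
  by rewrite (le_trans (TC _)) // -mulrA ler_wpM2l.
- by move=> k x /=; rewrite Sk Tk.
- by exists (S' \o T') => x y /=; rewrite TT' SS'.
Qed.

Definition adjointable_pred : {pred (H -> H)} := fun T => `[< adjointable T >].

Lemma adjointable_submod_closed : submod_closed adjointable_pred.
Proof.
split=> [|k T S /asboolP[[C C0 TC] Tk [T' TT']] /asboolP[[D D0 SD] Sk [S' SS']]].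
  apply/asboolP; split=> [|k x|].
  - by exists 0 => // x; rewrite nrm0 mul0r.
  - by rewrite scaler0.
  - by exists (fun=> 0) => x y; rewrite ip0l ip0r.
apply/asboolP; split.
- exists (nrm k * C + D) => [|x]; first by rewrite addr_ge0 // mulr_ge0 // nrm_ge0.
  rewrite (le_trans (nrmD _ _)) // mulrDl lerD //.
  by rewrite nrmZ -mulrA ler_wpM2l // nrm_ge0.
- move=> l x; have E y : (k *: T + S) y = k *: T y + S y by [].
  by rewrite !E Tk Sk scalerDr !scalerA mulrC.
- exists (fun y => k^* *: T' y + S' y) => x y.
  by rewrite ipDl ipDr ipZ SS' TT'; congr (_ + _); rewrite -TT' -ipZ -Tk TT' ipZ.
Qed.

End Adjointable.

HB.instance Definition _ (R : realType) (H : ipModule R) :=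
  GRing.isSubmodClosed.Build _ _ (@adjointable_pred R H)
    (@adjointable_submod_closed R H).

Record adjOp (R : realType) (H : ipModule R) := AdjOp {
  adjop_fun :> H -> H;
  adjopP : adjop_fun \in @adjointable_pred R H
}.

HB.instance Definition _ (R : realType) (H : ipModule R) :=
  [isSub for @adjop_fun R H].
HB.instance Definition _ (R : realType) (H : ipModule R) :=
  [Choice of adjOp H by <:].
HB.instance Definition _ (R : realType) (H : ipModule R) :=
  [SubChoice_isSubLmodule of adjOp H by <:].

Section AdjOpNorm.
Context {R : realType} (H : ipModule R).
Implicit Types (x y z : H) (T S : adjOp H).

Lemma adjop_adjointable T : adjointable T.
Proof. exact/asboolP/adjopP. Qed.

Definition mk_adjop (f : H -> H) (fP : adjointable f) : adjOp H :=
  AdjOp (asboolT fP).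

Lemma adjop_eq T S : (forall x, T x = S x) -> T = S.
Proof. by move=> TS; apply/val_inj/funext. Qed.

Lemma adjop_add T S x : (T + S) x = T x + S x. Proof. by []. Qed.

Lemma adjop_opp T x : (- T) x = - T x. Proof. by []. Qed.

Lemma adjop_scale (k : R[i]) T x : (k *: T) x = k *: T x. Proof. by []. Qed.

Lemma adjopZ T (k : R[i]) x : T (k *: x) = k *: T x.
Proof. by have [_ ->] := adjop_adjointable T. Qed.

Lemma adjopD T x y : T (x + y) = T x + T y.
Proof. by have [_ _ [T' /adjoint_additive]] := adjop_adjointable T; apply. Qed.

Lemma adjop0 T : T 0 = 0.
Proof. by have := adjopZ T 0 0; rewrite !scale0r. Qed.

Definition opbounds T : set R :=
  [set C | 0 <= C /\ forall x, nrm (T x) <= C * nrm x].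

Definition opnorm T : R := inf (opbounds T).

Lemma opbounds_has_inf T : has_inf (opbounds T).
Proof.
have [[C C0 TC] _ _] := adjop_adjointable T.
by split; [exists C; split | exists 0 => D []].
Qed.

Lemma opnorm_ge0 T : 0 <= opnorm T.
Proof. by apply: lb_le_inf => [|C []//]; have [] := opbounds_has_inf T. Qed.

Lemma opnorm_min T C : 0 <= C -> (forall x, nrm (T x) <= C * nrm x) -> opnorm T <= C.
Proof.
by move=> C0 TC; apply: ge_inf => //; have [] := opbounds_has_inf T.
Qed.

Lemma opnorm_le T x : nrm (T x) <= opnorm T * nrm x.
Proof.
have [[C C0 TC] _ _] := adjop_adjointable T.
have [x0|x0] := eqVneq x 0; first by rewrite x0 adjop0 !nrm0 mulr0.
have {}x0 : 0 < nrm x by apply/nrm_gt0/eqP.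
rewrite -ler_pdivrMr //; apply: lb_le_inf => [|D [D0 TD]].
  by have [] := opbounds_has_inf T.
by rewrite ler_pdivrMr.
Qed.

Lemma opnormD T S : opnorm (T + S) <= opnorm T + opnorm S.
Proof.
apply: opnorm_min => [|x]; first by rewrite addr_ge0 // opnorm_ge0.
by rewrite adjop_add (le_trans (nrmD _ _)) // mulrDl lerD // opnorm_le.
Qed.

Lemma opnormZ (k : R[i]) T : opnorm (k *: T) = nrm k * opnorm T.
Proof.
have le l S : opnorm (l *: S) <= nrm l * opnorm S.
  apply: opnorm_min => [|x]; first by rewrite mulr_ge0 ?nrm_ge0 ?opnorm_ge0.
  by rewrite adjop_scale nrmZ -mulrA ler_wpM2l ?nrm_ge0 ?opnorm_le.
apply/eqP; rewrite eq_le le /=; have [->|k0] := eqVneq k 0.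
  by rewrite nrm0 mul0r opnorm_ge0.
have := le k^-1 (k *: T); rewrite scalerA mulVf // scale1r => h.
have nk0 : 0 < nrm k by apply/nrm_gt0/eqP.
have kk : nrm k * nrm k^-1 = 1 by rewrite -nrmM mulfV // nrm1.
by rewrite (le_trans (ler_wpM2l (ltW nk0) h)) // mulrA kk mul1r.
Qed.

Lemma opnorm0_eq0 T : opnorm T = 0 -> T = 0.
Proof.
move=> T0; apply: adjop_eq => x; apply: nrm_le0.
by rewrite (le_trans (opnorm_le T x)) // T0 mul0r.
Qed.

End AdjOpNorm.

Section AdjOpNormC.
Context {R : realType} (H : ipModule R).
Implicit Types (T S : adjOp H).

Let cnorm T : R[i] := (opnorm T)%:C.

Let cnormD T S : cnorm (T + S) <= cnorm T + cnorm S.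
Proof. by rewrite /cnorm -rmorphD lecR opnormD. Qed.

Let cnormZ (k : R[i]) T : cnorm (k *: T) = `|k| * cnorm T.
Proof. by rewrite /cnorm opnormZ rmorphM /= -normE. Qed.

Let cnorm0_eq0 T : cnorm T = 0 -> T = 0.
Proof. by move=> /complexI/opnorm0_eq0. Qed.

HB.instance Definition _ :=
  Lmodule_isNormed.Build R[i] (adjOp H) cnormD cnormZ cnorm0_eq0.

End AdjOpNormC.

Section AdjOpCStar.
Context {R : realType} (H : ipModule R).
Implicit Types (x y z : H) (T S : adjOp H).

Lemma nrm_adjop_le T x : nrm (T x) <= nrm T * nrm x.
Proof. exact: opnorm_le. Qed.

Lemma nrm_adjop_min T C : 0 <= C -> (forall x, nrm (T x) <= C * nrm x) -> nrm T <= C.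
Proof. exact: opnorm_min. Qed.

Lemma ex_adjoint T : {T' : H -> H | adjoint T T'}.
Proof. by apply/cid; have [] := adjop_adjointable T. Qed.

Lemma adj_adjointable T : adjointable (projT1 (ex_adjoint T)).
Proof.
exact: (adjoint_adjointable (adjop_adjointable T) (projT2 (ex_adjoint T))).
Qed.

Definition adj T : adjOp H := mk_adjop (adj_adjointable T).

Lemma adjE T x y : ip (T x) y = ip x (adj T y).
Proof. exact: (projT2 (ex_adjoint T)). Qed.

Lemma adj_eq T T' : adjoint T T' -> adj T = T' :> (H -> H).
Proof. by apply: adjoint_uniq; exact: adjE. Qed.

Definition adjop_mul T S : adjOp H :=
  mk_adjop (adjointable_comp (adjop_adjointable T) (adjop_adjointable S)).

Lemma adjop_mulE T S x : adjop_mul T S x = T (S x). Proof. by []. Qed.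

Definition adjop_one : adjOp H := mk_adjop (@adjointable_id R H).

Lemma adjE2 T x y : ip (adj T x) y = ip x (T y).
Proof. by rewrite ip_swapE -adjE -ip_swapE. Qed.

Lemma adjK : involutive adj.
Proof. by move=> T; apply: adjop_eq => y; apply: ip_eql => x; rewrite -adjE adjE2. Qed.

Lemma adjD : {morph adj : T S / T + S}.
Proof.
move=> T S; apply: adjop_eq => y; apply: ip_eql => x.
by rewrite -adjE !adjop_add ipDl ipDr !adjE.
Qed.

Lemma adjZ (k : R[i]) T : adj (k *: T) = k^* *: adj T.
Proof.
apply: adjop_eq => y; apply: ip_eql => x.
by rewrite -adjE !adjop_scale ip_scaler conjCK -adjE adjopZ.
Qed.

Lemma adjM T S : adj (adjop_mul T S) = adjop_mul (adj S) (adj T).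
Proof.
by apply: adjop_eq => y; apply: ip_eql => x; rewrite -adjE !adjop_mulE !adjE.
Qed.

Lemma nrm_adjop_mul T S : nrm (adjop_mul T S) <= nrm T * nrm S.
Proof.
apply: nrm_adjop_min => [|x]; first by rewrite mulr_ge0 ?nrm_ge0.
rewrite adjop_mulE (le_trans (nrm_adjop_le _ _)) // -mulrA.
by rewrite ler_wpM2l ?nrm_ge0 ?nrm_adjop_le.
Qed.

(** This half of the C*-identity holds because |T x|^2 is the norm of [ip x (adj T (T x))]. Combined
    with submultiplicativity it gives |T| <= |adj T|, and from that the other half. *)
Lemma nrm_adj_sqr T : nrm T ^+ 2 <= nrm (adjop_mul (adj T) T).
Proof.
set N := nrm (adjop_mul _ _); have N0 : 0 <= N by exact: nrm_ge0.
rewrite -(sqr_sqrtr N0) ler_sqr ?nnegrE ?nrm_ge0 ?sqrtr_ge0 //.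
apply: nrm_adjop_min => [|x]; first exact: sqrtr_ge0.
rewrite -ler_sqr ?nnegrE ?nrm_ge0 ?mulr_ge0 ?sqrtr_ge0 ?nrm_ge0 //.
rewrite exprMn sqr_sqrtr // -ip_xx adjE ip_swapE -ip_swapE.
rewrite (le_trans (ip_le _ _)) // expr2 mulrCA ler_wpM2l ?nrm_ge0 //.
exact: (nrm_adjop_le (adjop_mul (adj T) T)).
Qed.

Lemma nrm_adj_le T : nrm T <= nrm (adj T).
Proof.
have := le_trans (nrm_adj_sqr T) (nrm_adjop_mul _ _).
have [/nrm_eq0 ->|T0 h] := eqVneq (nrm T) 0; first by rewrite nrm0 nrm_ge0.
by rewrite -(ler_pM2r (_ : 0 < nrm T)) -?expr2 // lt_def T0 nrm_ge0.
Qed.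

Lemma nrm_adj T : nrm (adj T) = nrm T.
Proof.
apply/le_anti; rewrite nrm_adj_le andbT.
by have := nrm_adj_le (adj T); rewrite adjK.
Qed.

Lemma nrm_adj_mul T : nrm (adjop_mul (adj T) T) = nrm T ^+ 2.
Proof.
apply/eqP; rewrite eq_le nrm_adj_sqr andbT.
by rewrite (le_trans (nrm_adjop_mul _ _)) // nrm_adj expr2.
Qed.

Lemma adjop_cauchy (u : nat -> adjOp H) : cauchy_seq u -> exists l, tends u l.
Proof.
move=> uc.
have pt (v : nat -> adjOp H) : cauchy_seq v -> exists f : H -> H,
    forall x, tends (fun n => v n x) (f x).
  move=> vc; have /choice[f fP] (x : H) : exists l, tends (fun n => v n x) l;
    last by exists f.
  apply: cauchy_seq_tends => e e0.
  have x1 : 0 < nrm x + 1 by rewrite ltr_wpDl ?nrm_ge0.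
  have [|N NP] := vc (e / (nrm x + 1)); first by rewrite divr_gt0.
  exists N => m n Nm Nn; rewrite -adjop_opp -adjop_add.
  rewrite (le_trans (nrm_adjop_le _ _)) //.
  rewrite (le_trans (ler_wpM2r (nrm_ge0 _) (NP _ _ Nm Nn))) //.
  by rewrite mulrAC ler_pdivrMr // ler_wpM2l ?(ltW e0) // lerDl.
(* The adjoints form a Cauchy sequence too, since [adj] is isometric; their pointwise limit [g] will
   be the adjoint of [f]. *)
have uc' : cauchy_seq (adj \o u).
  move=> e /uc[N NP]; exists N => m n Nm Nn /=; apply: le_trans (NP m n Nm Nn).
  by rewrite -nrm_adj adjD -scaleN1r adjZ !adjK rmorphN1 scaleN1r.
have [f uf] := pt _ uc; have [g ug] := pt _ uc'.
(* Letting m tend to infinity in |u_n x - u_m x| <= e |x| turns pointwise convergence into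
   convergence in operator norm. *)
have bound e N : (forall m n, (N <= m)%N -> (N <= n)%N -> nrm (u m - u n) <= e) ->
    forall n x, (N <= n)%N -> nrm (u n x - f x) <= e * nrm x.
  move=> NP n x Nn.
  have h : tends (fun m => u n x - u m x) (u n x - f x).
    move=> d /(uf x)[M MP]; exists M => m /MP; apply: le_trans.
    by rewrite opprB addrC addrA subrK nrmC.
  apply: (tends_nrm_le (N := N) h) => m Nm; rewrite -adjop_opp -adjop_add.
  by rewrite (le_trans (nrm_adjop_le _ _)) // ler_wpM2r ?nrm_ge0 // NP.
have fP : adjointable f.
  split.
  - have [N NP] := uc 1 ltr01; exists (1 + nrm (u N)) => [|x].
      by rewrite addr_ge0 // nrm_ge0.
    rewrite -[f x](subKr (u N x)) (le_trans (nrmB _ _)) // addrC mulrDl lerD //.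
      exact: (bound _ _ NP).
    exact: nrm_adjop_le.
  - move=> k x; apply: (tends_unique (uf (k *: x))) => e e0.
    have k1 : 0 < nrm k + 1 by rewrite ltr_wpDl ?nrm_ge0.
    have [|M MP] := uf x (e / (nrm k + 1)); first by rewrite divr_gt0.
    exists M => n /MP h; rewrite adjopZ -scalerBr nrmZ.
    rewrite (le_trans (ler_wpM2l (nrm_ge0 _) h)) //.
    by rewrite mulrA ler_pdivrMr // mulrC ler_wpM2l ?(ltW e0) // lerDl.
  - exists g => x y; apply/subr0_eq/nrm_small => e e0.
    have x1 : 0 < nrm x + 1 by rewrite ltr_wpDl ?nrm_ge0.
    have y1 : 0 < nrm y + 1 by rewrite ltr_wpDl ?nrm_ge0.
    have [|N NP] := uf x (e / 2 / (nrm y + 1)); first by rewrite !divr_gt0.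
    have [|M MP] := ug y (e / 2 / (nrm x + 1)); first by rewrite !divr_gt0.
    pose n := maxn N M; have {}NP := NP n (leq_maxl _ _).
    have {}MP := MP n (leq_maxr _ _).
    rewrite (le_trans (nrm_dist _ (ip (u n x) y) _)) // (splitr e) lerD //.
      rewrite -ipBl (le_trans (ip_le _ _)) // [nrm (_ - _)]nrmC.
      rewrite (le_trans (ler_wpM2r (nrm_ge0 _) NP)) //.
      by rewrite mulrAC ler_pdivrMr // ler_wpM2l ?(ltW (divr_gt0 e0 _)) // lerDl.
    rewrite adjE -ipBr (le_trans (ip_le _ _)) //.
    rewrite (le_trans (ler_wpM2l (nrm_ge0 _) MP)) //.
    by rewrite mulrA ler_pdivrMr // mulrC ler_wpM2l ?(ltW (divr_gt0 e0 _)) // lerDl.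
exists (mk_adjop fP) => e /[dup] e0 /uc[N NP]; exists N => n Nn.
apply: nrm_adjop_min => [|x]; first exact: ltW.
by rewrite adjop_add adjop_opp; exact: (bound _ _ NP).
Qed.

Lemma adjop_complete (F : set_system (adjOp H)) :
  ProperFilter F -> cauchy F -> cvg F.
Proof. by move: F; apply: cauchy_complete_seq; exact: adjop_cauchy. Qed.

HB.instance Definition _ := Uniform_isComplete.Build (adjOp H) adjop_complete.

Let mulA : associative adjop_mul.
Proof. by move=> S T U; apply: adjop_eq => x. Qed.

Let mulDl : left_distributive adjop_mul +%R.
Proof. by move=> S T U; apply: adjop_eq => x. Qed.

Let mulDr : right_distributive adjop_mul +%R.
Proof. by move=> S T U; apply: adjop_eq => x; rewrite adjop_mulE !adjop_add adjopD. Qed.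

Let mulZl (k : R[i]) S T : adjop_mul (k *: S) T = k *: adjop_mul S T.
Proof. exact: adjop_eq. Qed.

Let mulZr (k : R[i]) S T : adjop_mul S (k *: T) = k *: adjop_mul S T.
Proof. by apply: adjop_eq => x; rewrite adjop_mulE !adjop_scale adjopZ. Qed.

Let norm_mul S T : `|adjop_mul S T| <= `|S| * `|T|.
Proof. by rewrite !normE -rmorphM lecR nrm_adjop_mul. Qed.

Let norm_starmul T : `|adjop_mul (adj T) T| = `|T| ^+ 2.
Proof. by rewrite !normE -rmorphXn /= nrm_adj_mul. Qed.

HB.instance Definition _ := CompleteNormedModule_isCStarAlgebra.Build R (adjOp H)
  mulA mulDl mulDr mulZl mulZr adjK adjD adjZ adjM norm_mul norm_starmul.

Lemma adjop_mul1 T : adjop_one ** T = T.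
Proof. by apply: adjop_eq => x. Qed.

Lemma adjop_1mul T : T ** adjop_one = T.
Proof. by apply: adjop_eq => x. Qed.

Lemma adjop_cmul T S x : (T ** S) x = T (S x). Proof. by []. Qed.

Lemma star_adjoint T S : adjoint T S -> star T = S.
Proof. by move=> TS; apply: adjop_eq => x; rewrite -(adj_eq TS). Qed.

End AdjOpCStar.

(** * Positivity in C*-algebras *)

Section LmodTactic.
Variables (K : nzRingType) (V : lmodType K).

Inductive lexp :=
  | LVar of nat | LZero | LAdd of lexp & lexp | LOpp of lexp | LScale of K & lexp.

Fixpoint leval (env : seq V) e : V :=
  match e with
  | LVar n => nth 0 env n
  | LZero => 0
  | LAdd a b => leval env a + leval env b
  | LOpp a => - leval env a
  | LScale k a => k *: leval env a
  end.

Fixpoint lcoef e (i : nat) : K :=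
  match e with
  | LVar n => if n == i then 1 else 0
  | LZero => 0
  | LAdd a b => lcoef a i + lcoef b i
  | LOpp a => - lcoef a i
  | LScale k a => k * lcoef a i
  end.

(** A conjunction over the atoms, so that it unfolds into one scalar goal per atom, left to [ring]
    or [field]. *)
Fixpoint same_coefs n a b : Prop :=
  if n is m.+1 then lcoef a m = lcoef b m /\ same_coefs m a b else True.

Lemma levalE env e :
  leval env e = \sum_(i < size env) lcoef e i *: nth 0 env i.
Proof.
elim: e => [n||a IHa b IHb|a IHa|k a IHa] /=.
- have [nlt|nge] := ltnP n (size env).
    rewrite (bigD1 (Ordinal nlt)) //= eqxx scale1r big1 ?addr0 // => i.
    by rewrite -val_eqE /= eq_sym => /negPf->; rewrite scale0r.
  rewrite nth_default // big1 // => i _; rewrite gtn_eqF ?scale0r //.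
  exact: leq_trans (ltn_ord i) nge.
- by rewrite big1 // => i _; rewrite scale0r.
- by rewrite IHa IHb -big_split; apply: eq_bigr => i _; rewrite scalerDl.
- by rewrite IHa -sumrN; apply: eq_bigr => i _; rewrite scaleNr.
- by rewrite IHa scaler_sumr; apply: eq_bigr => i _; rewrite scalerA.
Qed.

Lemma leval_eq env a b : same_coefs (size env) a b -> leval env a = leval env b.
Proof.
move=> ab; rewrite !levalE; apply: eq_bigr => i _; congr (_ *: _).
have : forall n, same_coefs n a b -> forall j, (j < n)%N -> lcoef a j = lcoef b j.
  elim=> [|n IHn] //= [abn /IHn{}IHn] j; rewrite ltnS leq_eqVlt => /predU1P[->//|].
  exact: IHn.
by move=> /(_ _ ab); apply.
Qed.

End LmodTactic.

Ltac lmod_mem x env :=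
  lazymatch env with
  | [::] => constr:(false)
  | x :: _ => constr:(true)
  | _ :: ?env' => lmod_mem x env'
  end.

Ltac lmod_index x env :=
  lazymatch env with
  | x :: _ => constr:(0%N)
  | _ :: ?env' => let n := lmod_index x env' in constr:(n.+1)
  end.

Ltac lmod_atoms t env :=
  lazymatch t with
  | GRing.zero => env
  | GRing.add ?a ?b => let env' := lmod_atoms a env in lmod_atoms b env'
  | GRing.opp ?a => lmod_atoms a env
  | GRing.scale _ ?a => lmod_atoms a env
  | _ => lazymatch lmod_mem t env with true => env | false => constr:(t :: env) end
  end.

Ltac lmod_reify K t env :=
  lazymatch t with
  | GRing.zero => constr:(LZero K)
  | GRing.add ?a ?b =>
      let x := lmod_reify K a env in let y := lmod_reify K b env in
      constr:(LAdd x y)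
  | GRing.opp ?a => let x := lmod_reify K a env in constr:(LOpp x)
  | GRing.scale ?k ?a =>
      let x := lmod_reify K a env in constr:(@LScale K k x)
  | _ => let n := lmod_index t env in constr:(LVar K n)
  end.

(* Decides equalities in a module up to equalities of coefficients. *)
Ltac lmod_with K V :=
  lazymatch goal with
  | |- @eq ?T ?a ?b =>
    let env := lmod_atoms a (@nil T) in
    let env := lmod_atoms b env in
    let x := lmod_reify K a env in
    let y := lmod_reify K b env in
    change (@leval K V env x = @leval K V env y);
    apply: leval_eq; rewrite /=; repeat split
  end.

Ltac lmodV V :=
  lazymatch goal with
  | R : realType |- _ => lmod_with (R[i] : nzRingType) (V : lmodType R[i])
  end.

Section CStarBasics.
Context {R : realType} (A : cstarAlgType R).
Implicit Types (a b c x y : A).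

Lemma cmul0l a : 0 ** a = 0.
Proof. by apply: (addrI (0 ** a)); rewrite -cmulDl !addr0. Qed.

Lemma cmul0r a : a ** 0 = 0.
Proof. by apply: (addrI (a ** 0)); rewrite -cmulDr !addr0. Qed.

Lemma cmulNl a b : (- a) ** b = - (a ** b).
Proof. by apply/eqP; rewrite -addr_eq0 -cmulDl addNr cmul0l. Qed.

Lemma cmulNr a b : a ** (- b) = - (a ** b).
Proof. by apply/eqP; rewrite -addr_eq0 -cmulDr addNr cmul0r. Qed.

Lemma cmulBl a b c : (a - b) ** c = a ** c - b ** c.
Proof. by rewrite cmulDl cmulNl. Qed.

Lemma cmulBr a b c : a ** (b - c) = a ** b - a ** c.
Proof. by rewrite cmulDr cmulNr. Qed.

Lemma star0 : star (0 : A) = 0.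
Proof. by apply: (addrI (star 0)); rewrite -starD !addr0. Qed.

Lemma starN a : star (- a) = - star a.
Proof. by apply/eqP; rewrite -addr_eq0 -starD addNr star0. Qed.

Lemma starB a b : star (a - b) = star a - star b.
Proof. by rewrite starD starN. Qed.

Lemma nrm_cmul a b : nrm (a ** b) <= nrm a * nrm b.
Proof. by rewrite -lecR rmorphM /= -!normE normcM. Qed.

Lemma nrm_starM a : nrm (star a ** a) = nrm a ^+ 2.
Proof. by apply: complexI; rewrite rmorphXn /= -!normE norm_starM. Qed.

Lemma nrm_star a : nrm (star a) = nrm a.
Proof.
have le b : nrm b <= nrm (star b).
  have := nrm_cmul (star b) b; rewrite nrm_starM.
  have [->|b0] := eqVneq (nrm b) 0; first by rewrite nrm_ge0.
  by rewrite expr2 ler_pM2r // lt_def b0 nrm_ge0.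
by apply/le_anti; rewrite le andbT -{2}(starK a) le.
Qed.

Lemma nrm_sqr_sa a : star a = a -> nrm (a ** a) = nrm a ^+ 2.
Proof. by move=> aa; rewrite -nrm_starM aa. Qed.

Lemma star_mul_eq0 a : star a ** a = 0 -> a = 0.
Proof.
by move=> a0; apply/nrm_eq0/eqP; rewrite -(sqrf_eq0 (nrm a)) -nrm_starM a0 nrm0.
Qed.

Lemma tends_cst a : tends (fun=> a) a.
Proof. by move=> e /ltW e0; exists 0%N => n _; rewrite subrr nrm0. Qed.

Lemma tends_shift (u : nat -> A) a : tends u a -> tends (fun n => u n.+1) a.
Proof.
by move=> ua e /ua[N NP]; exists N => n Nn; apply: NP; apply: leq_trans Nn _.
Qed.

Lemma tendsD (u v : nat -> A) a b :
  tends u a -> tends v b -> tends (fun n => u n + v n) (a + b).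
Proof.
move=> ua vb e e0; have e20 : 0 < e / 2 by rewrite divr_gt0.
have [N NP] := ua _ e20; have [M MP] := vb _ e20.
exists (maxn N M) => n; rewrite geq_max => /andP[/NP n1 /MP n2].
by rewrite opprD addrACA (le_trans (nrmD _ _)) // (splitr e) lerD.
Qed.

Lemma tends_lip (f : A -> A) (C : R) (u : nat -> A) a : 0 <= C ->
  (forall x y, nrm (f x - f y) <= C * nrm (x - y)) ->
  tends u a -> tends (fun n => f (u n)) (f a).
Proof.
move=> C0 fC ua e e0; have C1 : 0 < C + 1 by rewrite ltr_wpDl.
have [|N NP] := ua (e / (C + 1)); first by rewrite divr_gt0.
exists N => n /NP h; rewrite (le_trans (fC _ _)) //.
rewrite (le_trans (ler_wpM2l C0 h)) // mulrA ler_pdivrMr // mulrC.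
by rewrite ler_wpM2l ?(ltW e0) // lerDl.
Qed.

Lemma tendsZ (k : R[i]) (u : nat -> A) a :
  tends u a -> tends (fun n => k *: u n) (k *: a).
Proof.
apply: (@tends_lip ( *:%R k) (nrm k)) => [|x y]; first exact: nrm_ge0.
by rewrite -scalerBr nrmZ.
Qed.

Lemma tends_star (u : nat -> A) a :
  tends u a -> tends (fun n => star (u n)) (star a).
Proof. by apply: (@tends_lip star 1) => // x y; rewrite -starB nrm_star mul1r. Qed.

Lemma tendsMl b (u : nat -> A) a :
  tends u a -> tends (fun n => b ** u n) (b ** a).
Proof.
apply: (@tends_lip (cmul b) (nrm b)) => [|x y]; first exact: nrm_ge0.
by rewrite -cmulBr nrm_cmul.
Qed.

Lemma tendsMr b (u : nat -> A) a :
  tends u a -> tends (fun n => u n ** b) (a ** b).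
Proof.
apply: (@tends_lip (cmul^~ b) (nrm b)) => [|x y]; first exact: nrm_ge0.
by rewrite -cmulBl (le_trans (nrm_cmul _ _)) // mulrC.
Qed.

End CStarBasics.

Ltac lmod :=
  lazymatch goal with
  | A : cstarAlgType ?R |- _ =>
    lmod_with (R[i] : nzRingType) (CStarAlgebra.sort A : lmodType R[i])
  end.

(** * Square roots by iteration *)

Section SquareRoot.
Context {R : realType}.

(** The scalar case g = 1 of [sqrt_iter]. It increases and stays in [0, 1], and it dominates the
    norms and the increments of [sqrt_iter], which therefore converges. *)
Fixpoint sqrt_scal n : R :=
  if n is m.+1 then 2^-1 * (1 + sqrt_scal m ^+ 2) else 0.

Lemma sqrt_scal_bounds n :
  [/\ 0 <= sqrt_scal n, sqrt_scal n <= 1 & sqrt_scal n <= sqrt_scal n.+1].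
Proof.
by elim: n => [|n [h0 h1 h2]] /=; [split; lra|]; move: h2 => /=; split; nra.
Qed.

Lemma sqrt_scal_mono m n : (m <= n)%N -> sqrt_scal m <= sqrt_scal n.
Proof.
move=> /subnK <-; elim: (n - m)%N => // k IH.
by rewrite addSn (le_trans IH) //; have [] := sqrt_scal_bounds (k + m).
Qed.

Lemma sqrt_scal_cauchy (e : R) : 0 < e -> exists N, forall m n, (N <= m)%N -> (m <= n)%N ->
  sqrt_scal n - sqrt_scal m <= e.
Proof.
move=> e0; pose E := range sqrt_scal.
have Es : has_sup E.
  split; first by exists (sqrt_scal 0), 0%N.
  by exists 1 => _ [n _ <-]; have [] := sqrt_scal_bounds n.
have [_ [N _ <-] NP] := sup_adherent e0 Es.
exists N => m n /sqrt_scal_mono Nm _.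
have : sqrt_scal n <= sup E by apply: sup_upper_bound => //; exists n.
by move: NP; lra.
Qed.

Variable A : cstarAlgType R.
Implicit Types (a b c g x y : A).

(** A fixed point y satisfies 2 y = g + y^2, which is (1 - y)^2 = 1 - g once a unit is available. *)
Fixpoint sqrt_iter g n : A :=
  if n is m.+1 then (2^-1 : R[i]) *: (g + sqrt_iter g m ** sqrt_iter g m) else 0.

Lemma nrm_half : nrm (2^-1 : R[i]) = 2^-1 :> R.
Proof.
have -> : (2^-1 : R[i]) = (2^-1 : R)%:C by rewrite fmorphV rmorph_nat.
by rewrite nrm_real ger0_norm // invr_ge0.
Qed.

Lemma sqrt_iter_bounds g n : nrm g <= 1 ->
  nrm (sqrt_iter g n) <= sqrt_scal n /\
  nrm (sqrt_iter g n.+1 - sqrt_iter g n) <= sqrt_scal n.+1 - sqrt_scal n.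
Proof.
move=> g1; elim: n => [|n [h1 h2]].
  split; first by rewrite nrm0.
  rewrite [sqrt_iter _ _]/= cmul0l addr0 subr0 nrmZ nrm_half /=; lra.
have h3 : nrm (sqrt_iter g n.+1) <= sqrt_scal n.+1.
  rewrite /= nrmZ nrm_half ler_wpM2l ?invr_ge0 // (le_trans (nrmD _ _)) //.
  rewrite lerD // (le_trans (nrm_cmul _ _)) // -expr2 ler_sqr ?nnegrE ?nrm_ge0 //.
  by have [] := sqrt_scal_bounds n.
split=> //; set y := sqrt_iter g n.+1 in h2 h3 *; set x := sqrt_iter g n in h1 h2 *.
(* The splitting y y - x x = y (y - x) + (y - x) x needs no commutation, and the same splitting for
   scalars bounds it factor by factor. *)
have -> : sqrt_iter g n.+2 - y =
    (2^-1 : R[i]) *: (y ** (y - x) + (y - x) ** x).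
  have yE : y = (2^-1 : R[i]) *: (g + x ** x) by [].
  have -> : sqrt_iter g n.+2 = (2^-1 : R[i]) *: (g + y ** y) by [].
  rewrite [X in _ - X = _]yE.
  by rewrite !(cmulBr, cmulBl); lmod; field.
rewrite nrmZ nrm_half.
have -> : sqrt_scal n.+2 - sqrt_scal n.+1 = 2^-1 * (sqrt_scal n.+1 *
    (sqrt_scal n.+1 - sqrt_scal n) + (sqrt_scal n.+1 - sqrt_scal n) * sqrt_scal n).
  by rewrite /=; field.
rewrite ler_wpM2l ?invr_ge0 // (le_trans (nrmD _ _)) // lerD //.
  by rewrite (le_trans (nrm_cmul _ _)) // ler_pM ?nrm_ge0.
by rewrite (le_trans (nrm_cmul _ _)) // ler_pM ?nrm_ge0.
Qed.

(* [1 - c] is the square root of [1 - g], stated without a unit. *)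
Lemma cstar_sqrt g : nrm g <= 1 -> exists c,
  [/\ nrm c <= 1, c + c = g + c ** c,
      (forall a, a ** g = g ** a -> a ** c = c ** a) &
      (star g = g -> star c = c)].
Proof.
move=> g1; pose y := sqrt_iter g.
have yd k n : nrm (y (k + n)%N - y n) <= sqrt_scal (k + n)%N - sqrt_scal n.
  elim: k => [|k IH]; first by rewrite !add0n !subrr nrm0.
  rewrite addSn (le_trans (nrm_dist _ (y (k + n)%N) _)) //.
  by have [_ h] := sqrt_iter_bounds (k + n) g1; move: h IH; rewrite -/y; lra.
have [e e0|c yc] := @cauchy_seq_tends _ A y.
  have [N NP] := sqrt_scal_cauchy e0.
  have h m n : (N <= m)%N -> (m <= n)%N -> nrm (y n - y m) <= e.
    move=> Nm mn; apply: le_trans (NP m n Nm mn).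
    by have := yd (n - m)%N m; rewrite subnK.
  exists N => m n Nm Nn; have [mn|/ltnW nm] := leqP m n; last exact: h.
  by rewrite nrmC h.
have yyc : tends (fun n => y n ** y n) (c ** c).
  move=> e e0; have e20 : 0 < e / 2 by rewrite divr_gt0.
  have [N NP] := yc _ e20; exists N => n Nn.
  have -> : y n ** y n - c ** c = y n ** (y n - c) + (y n - c) ** c.
    by rewrite !(cmulBl, cmulBr); lmod; ring.
  have yb k : nrm (y k) <= 1.
    have [h _] := sqrt_iter_bounds k g1; apply: le_trans h _.
    by have [] := sqrt_scal_bounds k.
  have cb : nrm c <= 1 by apply: (tends_nrm_le (N := 0) yc) => k _.
  rewrite (le_trans (nrmD _ _)) // (splitr e) lerD // (le_trans (nrm_cmul _ _)) //.
    by rewrite (le_trans (ler_wpM2r (nrm_ge0 _) (yb n))) // mul1r NP.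
  by rewrite (le_trans (ler_wpM2l (nrm_ge0 _) cb)) // mulr1 NP.
exists c; split.
- apply: (tends_nrm_le (N := 0) yc) => k _.
  have [h _] := sqrt_iter_bounds k g1; apply: le_trans h _.
  by have [] := sqrt_scal_bounds k.
- have h : tends (fun n => y n.+1) ((2^-1 : R[i]) *: (g + c ** c)).
    by apply: tendsZ; apply: tendsD => //; exact: tends_cst.
  rewrite {1 2}(tends_unique (tends_shift yc) h).
  by lmod; field.
- move=> a ag; have ay n : a ** y n = y n ** a.
    elim: n => [|n IH]; first by rewrite /y /= cmul0l cmul0r.
    rewrite /y /= -/(y n) cmulZr cmulZl cmulDr cmulDl ag.
    by rewrite cmulA IH -cmulA IH cmulA.
  apply: (tends_unique (tendsMl a yc)).
  by have := tendsMr a yc; congr tends; apply/funext => n; rewrite ay.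
- move=> gg; have yy n : star (y n) = y n.
    elim: n => [|n IH]; first by rewrite /y /= star0.
    rewrite /y /= -/(y n) starZ starD starM IH gg; congr (_ *: _).
    by rewrite fmorphV rmorph_nat.
  apply: (tends_unique (tends_star yc)).
  by move: yc; congr tends; apply/funext => n; rewrite yy.
Qed.

End SquareRoot.

Section CartesianPairs.
Context {R : realType} (A : cstarAlgType R).
Implicit Types (a b c h k l : A).

Lemma conj_i : Num.conj ('i%C : R[i]) = - 'i%C.
Proof. by apply/eqP; rewrite eq_complex /= oppr0 !eqxx. Qed.

Lemma conj_half : Num.conj (2^-1 : R[i]) = 2^-1.
Proof. by rewrite fmorphV rmorph_nat. Qed.

Lemma conj_realC (x : R) : Num.conj (x%:C : R[i]) = x%:C.
Proof. exact: conjc_real. Qed.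

Lemma mulii : 'i%C * 'i%C = -1 :> R[i].
Proof. by rewrite -expr2 sqr_i. Qed.

Lemma star_mul_cartesian h k : star h = h -> star k = k -> h ** k = k ** h ->
  star (h + 'i%C *: k) ** (h + 'i%C *: k) = h ** h + k ** k.
Proof.
move=> hh kk hk; rewrite starD starZ hh kk conj_i.
rewrite !(cmulDl, cmulDr, cmulZl, cmulZr) hk !scalerA mulNr mulii opprK scale1r.
by lmod; ring.
Qed.

(** Replaces the inference from 0 <= h^2 <= h^2 + k^2, without any order: u = h + i k satisfies
    |u|^2 = |h^2 + k^2|, and h is the mean of u and [star u]. *)
Lemma nrm_pair_le1 h k : star h = h -> star k = k -> h ** k = k ** h ->
  nrm (h ** h + k ** k) <= 1 -> nrm h <= 1.
Proof.
move=> hh kk hk hk1; pose u := h + 'i%C *: k.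
have u1 : nrm u <= 1.
  by rewrite -ler_sqr ?nnegrE ?nrm_ge0 // -nrm_starM star_mul_cartesian // expr1n.
have -> : h = (2^-1 : R[i]) *: (u + star u).
  by rewrite /u starD starZ hh kk conj_i; lmod; field.
rewrite nrmZ nrm_half ler_pdivrMl // mulr1 (le_trans (nrmD _ _)) //.
by rewrite nrm_star; lra.
Qed.

End CartesianPairs.

Section UnitalPositivity.
Context {R : realType} (A : cstarAlgType R) (e : A).
Hypotheses (mul1c : forall a : A, e ** a = a) (mulc1 : forall a : A, a ** e = a).
Implicit Types (a b c h k l : A).

Lemma star_one : star e = e.
Proof. by rewrite -[LHS]mulc1 -{2}(starK e) -starM mulc1 starK. Qed.

Lemma nrm_one : nrm e <= 1.
Proof.
have := nrm_starM e; rewrite star_one mul1c => ee.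
have [->|/eqP e0] := eqVneq (nrm e) 0; first exact: ler01.
have /eqP : nrm e * (nrm e - 1) = 0 by rewrite mulrBr mulr1 -expr2 -ee subrr.
by rewrite mulf_eq0 subr_eq0 => /orP[/eqP//|/eqP->].
Qed.

Lemma unit_pair h k : star h = h -> star k = k -> h ** k = k ** h ->
  h ** h + k ** k = e -> nrm h <= 1.
Proof. by move=> hh kk hk hke; apply: (nrm_pair_le1 hh kk hk); rewrite hke nrm_one. Qed.

Lemma null_pair h k : star h = h -> star k = k -> h ** k = k ** h ->
  h ** h + k ** k = 0 -> h = 0.
Proof.
move=> hh kk hk hk0; pose u := h + 'i%C *: k.
have u0 : u = 0 by apply: star_mul_eq0; rewrite star_mul_cartesian.
have -> : h = (2^-1 : R[i]) *: (u + star u).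
  by rewrite /u starD starZ hh kk conj_i; lmod; field.
by rewrite u0 star0 addr0 scaler0.
Qed.

(* For self-adjoint [h] this says that the spectrum of [h] is nonnegative. *)
Definition is_pos h :=
  star h = h /\ exists2 l : R, 0 <= l & nrm (l%:C *: e - h) <= l.

Lemma is_posD h k : is_pos h -> is_pos k -> is_pos (h + k).
Proof.
move=> [hh [l l0 lh]] [kk [m m0 mk]]; split; first by rewrite starD hh kk.
exists (l + m); first exact: addr_ge0.
have -> : (l + m)%:C *: e - (h + k) = (l%:C *: e - h) + (m%:C *: e - k).
  by rewrite rmorphD; lmod; ring.
by rewrite (le_trans (nrmD _ _)) // lerD.
Qed.

Lemma is_posZ (x : R) h : 0 <= x -> is_pos h -> is_pos (x%:C *: h).
Proof.
move=> x0 [hh [l l0 lh]]; split; first by rewrite starZ hh conj_realC.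
exists (x * l); first exact: mulr_ge0.
rewrite rmorphM /= -scalerA -scalerBr nrmZ nrm_real ger0_norm //.
by rewrite ler_wpM2l.
Qed.

(** The element g = 1 - h / l has norm at most 1, so [cstar_sqrt] gives c with (1 - c)^2 = h / l.
    Take k = sqrt(l) (1 - c): its distance to sqrt(l) is sqrt(l) |c| <= sqrt(l), so k is positive as
    well. If l = 0 then h = 0. *)
Lemma is_pos_sqrt h : is_pos h -> exists k,
  [/\ star k = k, k ** k = h, is_pos k & forall a, a ** h = h ** a -> a ** k = k ** a].
Proof.
move=> [hh [l l0 lh]]; have [l00|ln0] := eqVneq l 0.
  exists 0; rewrite star0 cmul0l; split=> //.
  - move: lh; rewrite l00 scale0r sub0r => /nrm_le0/eqP.
    by rewrite oppr_eq0 => /eqP.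
  - by split; [rewrite star0 | exists 0 => //; rewrite scale0r subr0 nrm0].
  - by move=> a _; rewrite cmul0l cmul0r.
have lgt0 : 0 < l by rewrite lt_def ln0.
pose g := e - (l^-1)%:C *: h.
have g1 : nrm g <= 1.
  have -> : g = (l^-1)%:C *: (l%:C *: e - h).
    by rewrite scalerBr scalerA -rmorphM mulVf // scale1r.
  by rewrite nrmZ nrm_real ger0_norm ?invr_ge0 // ler_pdivrMl // mulr1.
have [c [c1 cc cg csa]] := cstar_sqrt g1.
have gg : star g = g by rewrite starB starZ star_one hh conj_realC.
have cs := csa gg.
pose k := (Num.sqrt l)%:C *: (e - c).
have kk : star k = k by rewrite starZ starB star_one cs conj_realC.
exists k; split=> //.
- rewrite cmulZl cmulZr scalerA -rmorphM -expr2 sqr_sqrtr // cmulBl !cmulBr.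
  rewrite !mul1c mulc1.
  have -> : c ** c = c + c - g by rewrite cc addrAC subrr add0r.
  have -> : e - c - (c - (c + c - g)) = e - g by lmod; ring.
  by rewrite /g opprB addrC subrK scalerA -rmorphM divff // scale1r.
- split=> //; exists (Num.sqrt l); first exact: sqrtr_ge0.
  rewrite -scalerBr subKr nrmZ nrm_real ger0_norm ?sqrtr_ge0 //.
  by rewrite ler_piMr // sqrtr_ge0.
- move=> a ah; rewrite cmulZr cmulZl cmulBl cmulBr mul1c mulc1 cg //.
  by rewrite cmulBl cmulBr mul1c mulc1 cmulZl cmulZr ah.
Qed.

(** Normalize to j = h / |h| and let k = 1 - c be a root of 1 - j^2. Since k^2 + j^2 = 1,
    [unit_pair] gives |k| <= 1, that is |1 - j^2| <= 1. *)
Lemma is_pos_sqr h : star h = h -> is_pos (h ** h).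
Proof.
move=> hh; have [->|/eqP h0] := eqVneq h 0.
  rewrite cmul0l; split; first exact: star0.
  by exists 0 => //; rewrite scale0r subr0 nrm0.
have n0 : 0 < nrm h by exact: nrm_gt0.
pose j := (nrm h)^-1%:C *: h.
have jj : star j = j by rewrite starZ hh conj_realC.
have j1 : nrm (j ** j) <= 1.
  rewrite nrm_sqr_sa // nrmZ nrm_real ger0_norm ?invr_ge0 ?nrm_ge0 //.
  by rewrite mulVf ?gt_eqF // expr1n.
have [c [c1 cc cg csa]] := cstar_sqrt j1.
have cs : star c = c by apply: csa; rewrite starM jj.
have cj : j ** c = c ** j by apply: cg; rewrite cmulA.
have kk : star (e - c) = e - c by rewrite starB star_one cs.
have k2 : (e - c) ** (e - c) = e - j ** j.
  rewrite cmulBl !cmulBr !mul1c mulc1.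
  have -> : c ** c = c + c - j ** j by rewrite cc addrAC subrr add0r.
  by lmod; ring.
have n1 : nrm (e - c) <= 1.
  apply: (@unit_pair _ j) => //; last by rewrite k2 subrK.
  by rewrite cmulBl cmulBr mul1c mulc1 cj.
have jpos : is_pos (j ** j).
  split; first by rewrite starM jj.
  exists 1 => //; rewrite scale1r -k2 nrm_sqr_sa //.
  by rewrite expr_le1 ?nrm_ge0.
have -> : h ** h = (nrm h ^+ 2)%:C *: (j ** j).
  rewrite cmulZl cmulZr !scalerA -!rmorphM /= expr2 mulrA mulfK ?gt_eqF //.
  by rewrite divff ?gt_eqF // scale1r.
by apply: is_posZ => //; exact: sqr_ge0.
Qed.

(** The roots k of h and l of - h commute and k^2 + l^2 = 0, so [null_pair] applies. *)
Lemma is_pos_antisym h : is_pos h -> is_pos (- h) -> h = 0.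
Proof.
move=> /is_pos_sqrt[k [kk k2 _ kc]] /is_pos_sqrt[l [ll l2 _ lc]].
suff k0 : k = 0 by rewrite -k2 k0 cmul0l.
apply: (@null_pair _ l) => //; last by rewrite k2 l2 subrr.
apply: lc; rewrite cmulNl cmulNr; congr (- _).
by rewrite -k2 cmulA.
Qed.

Lemma cartesian a : exists h k,
  [/\ star h = h, star k = k, a = h + 'i%C *: k & star a = h - 'i%C *: k].
Proof.
exists ((2^-1 : R[i]) *: (a + star a)), ((2^-1 * - 'i%C : R[i]) *: (a - star a)).
have ii : ('i%C : R[i]) * 'i%C = -1 by exact: mulii.
have E : 'i%C * (2^-1 * - 'i%C) = 2^-1 :> R[i].
  by rewrite mulrCA mulrN ii opprK mulr1.
split; rewrite ?scalerA ?E //.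
- by rewrite starZ starD starK conj_half [star a + a]addrC.
- rewrite starZ starB starK rmorphM rmorphN /= conj_half conj_i.
  by lmod; ring.
- by lmod; field.
- by lmod; field.
Qed.

(** For a = h + i k the cross terms of [a ** star a] and [star a ** a] cancel, so their sum is 2 h^2
    + 2 k^2, a sum of squares of self-adjoint elements. *)
Lemma star_mul_sum a : exists h k, [/\ star h = h, star k = k &
  a ** star a = h ** h + h ** h + (k ** k + k ** k) - star a ** a].
Proof.
have [h [k [hh kk -> ->]]] := cartesian a; exists h, k; split=> //.
rewrite !(cmulDl, cmulDr, cmulNl, cmulNr, cmulZl, cmulZr) !scalerA mulii.
by lmod; ring.
Qed.

Lemma is_pos_star_sum a : is_pos (a ** star a + star a ** a).
Proof.
have [h [k [hh kk ->]]] := star_mul_sum a; rewrite subrK.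
by do !apply: is_posD; exact: is_pos_sqr.
Qed.

(* With [a ** star a = k ** k] and [z = a ** l], both [z ** star z] and
   [star z ** z] are negatives of squares while their sum is positive. *)
Lemma star_mul_neg_sqr a l : star l = l -> star a ** a = - (l ** l) -> a = 0.
Proof.
move=> ll aal; apply: star_mul_eq0.
have [k [kk k2 _ _]] : exists k,
    [/\ star k = k, k ** k = a ** star a, is_pos k
      & forall b, b ** (a ** star a) = (a ** star a) ** b -> b ** k = k ** b].
  apply: is_pos_sqrt; have [h [j [hh jj ->]]] := star_mul_sum a.
  by rewrite aal opprK; do !apply: is_posD; exact: is_pos_sqr.
pose z := a ** l.
have z1 : star z ** z = - (l ** l) ** (l ** l).
  by rewrite /z starM ll cmulA -(cmulA l) aal cmulNr !cmulNl !cmulA.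
have z2 : z ** star z = - (k ** k) ** (k ** k).
  rewrite /z starM ll cmulA -(cmulA a l) k2.
  have -> : l ** l = - (star a ** a) by rewrite aal opprK.
  by rewrite !(cmulNl, cmulNr) !cmulA.
have l4 : is_pos ((l ** l) ** (l ** l)) by apply: is_pos_sqr; rewrite starM ll.
have k4 : is_pos ((k ** k) ** (k ** k)) by apply: is_pos_sqr; rewrite starM kk.
have := is_pos_star_sum z; rewrite z1 z2 !cmulNl -opprD => neg.
have kl0 := is_pos_antisym (is_posD k4 l4) neg.
have l40 : (l ** l) ** (l ** l) = 0.
  apply: is_pos_antisym => //.
  by have /eqP := kl0; rewrite addr_eq0 => /eqP <-.
have : l ** l = 0 by apply: star_mul_eq0; rewrite starM ll.
by rewrite aal => ->; rewrite oppr0.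
Qed.

(** Let k = |b| be the root of b^2 and n = (k - b) / 2 the negative part of b. Then b n = - n^2 and
    k n = n^2, so with w^2 = k one gets [star (c ** n) ** (c ** n)] = - n^3 = - (w n)^2. By
    [star_mul_neg_sqr] c n = 0, hence n^2 = - b n = 0 and b = |b|. *)
Lemma is_pos_starM c : is_pos (star c ** c).
Proof.
pose b := star c ** c.
have bb : star b = b by rewrite starM starK.
have [k [kk k2 kpos kc]] := is_pos_sqrt (is_pos_sqr bb).
have kb : b ** k = k ** b by apply: kc; rewrite cmulA.
have [w [ww w2 _ wc]] := is_pos_sqrt kpos.
pose n := (2^-1 : R[i]) *: (k - b).
have nn : star n = n by rewrite starZ starB kk bb conj_half.
have nk : n ** k = k ** n.
  by rewrite cmulZl cmulZr cmulBl cmulBr kb.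
have bn : b ** n = - (n ** n).
  rewrite !(cmulZl, cmulZr) -scalerN !(cmulBl, cmulBr) -kb k2.
  by lmod; field.
have kn : k ** n = n ** n.
  rewrite !(cmulZl, cmulZr) !(cmulBl, cmulBr) -kb k2.
  by lmod; field.
have wn : n ** w = w ** n by apply: wc.
have lsa : star (w ** n) = w ** n by rewrite starM ww nn wn.
have cn0 : c ** n = 0.
  apply: (star_mul_neg_sqr lsa).
  rewrite starM nn cmulA -(cmulA n) -/b -cmulA bn cmulNr; congr (- _).
  by rewrite -kn -w2 !cmulA wn.
have n20 : n ** n = 0.
  by apply/eqP; rewrite -oppr_eq0 -bn -cmulA cn0 cmul0r.
have n0 : n = 0 by apply: star_mul_eq0; rewrite nn.
have : k - b = 0.
  have := n0; rewrite /n => /(congr1 ( *:%R (2 : R[i]))).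
  by rewrite scalerA divff ?pnatr_eq0 // scale1r scaler0.
by move=> /subr0_eq kbE; rewrite -/b -kbE.
Qed.

Lemma star_mul_add_eq0 a b : star a ** a + star b ** b = 0 -> a = 0.
Proof.
move=> /eqP; rewrite addr_eq0 => /eqP ab; apply: star_mul_eq0.
apply: is_pos_antisym; first exact: is_pos_starM.
by rewrite ab opprK; exact: is_pos_starM.
Qed.

End UnitalPositivity.

(** For |a| <= 1 the element c with 2 c = g + c^2, g = [star a ** a], exists inside [A], which may
    lack a unit. Its image makes 1 - f(g) the square of l = 1 - f(c) in [B]. The root k of f(g)
    commutes with l and k^2 + l^2 = 1, so |f(a)|^2 = |k|^2 <= 1. *)
Lemma star_hom_contractive (R : realType) (A B : cstarAlgType R) (e : B)
    (mul1c : forall b : B, e ** b = b) (mulc1 : forall b : B, b ** e = b)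
    (f : A -> B) : is_star_hom f -> forall a, nrm (f a) <= nrm a.
Proof.
move=> [flin fM fstar].
have fD x y : f (x + y) = f x + f y by have := flin 1 x y; rewrite !scale1r.
have f0 : f 0 = 0 by apply: (addrI (f 0)); rewrite -fD !addr0.
have fZ k x : f (k *: x) = k *: f x by have := flin k x 0; rewrite f0 !addr0.
suff unit_ball a : nrm a <= 1 -> nrm (f a) <= 1.
  move=> a; have [->|/eqP a0] := eqVneq a 0; first by rewrite f0 !nrm0.
  have n0 := nrm_gt0 a0; pose b := (nrm a)^-1%:C *: a.
  have b1 : nrm b <= 1.
    by rewrite nrmZ nrm_real ger0_norm ?invr_ge0 ?nrm_ge0 // mulVf ?gt_eqF.
  have := unit_ball _ b1; rewrite fZ nrmZ nrm_real ger0_norm ?invr_ge0 ?nrm_ge0 //.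
  by rewrite ler_pdivrMl // mulr1.
move=> a1; pose g := star a ** a.
have g1 : nrm g <= 1 by rewrite nrm_starM expr_le1 ?nrm_ge0.
have [c [c1 cc cg csa]] := cstar_sqrt g1.
have cs : star c = c by apply: csa; rewrite starM starK.
pose b := star (f a) ** f a; pose l := e - f c.
have fg : f g = b by rewrite fM fstar.
have ll : star l = l by rewrite starB (star_one mulc1) -fstar cs.
have l2 : l ** l = e - b.
  rewrite cmulBl !cmulBr !mul1c mulc1 -fM.
  have -> : c ** c = c + c - g by rewrite cc addrAC subrr add0r.
  have -> : f (c + c - g) = f c + f c - b.
    by rewrite !fD -scaleN1r fZ scaleN1r fg.
  lmod; ring.
have [k [kk k2 _ kc]] := is_pos_sqrt mul1c mulc1 (is_pos_starM mul1c mulc1 (f a)).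
have kl : k ** l = l ** k.
  apply/esym/kc; rewrite -/b cmulBl cmulBr mul1c mulc1 -fg -!fM.
  by congr (_ - f _); apply/esym/cg.
have k1 : nrm k <= 1.
  by apply: (unit_pair mul1c mulc1 kk ll kl); rewrite k2 -/b l2 addrC subrK.
rewrite -(expr_le1 (n := 2)) ?nrm_ge0 // -nrm_starM -/b /b -k2 nrm_sqr_sa //.
by rewrite expr_le1 ?nrm_ge0.
Qed.

(** * Passage to a unital algebra *)

Section MultiplierAlgebra.
Context {R : realType} (A : cstarAlgType R).
Implicit Types (a b x y : A).

Let ip_star a b : A := star a ** b.

Let ip_starDl x y z : ip_star (x + y) z = ip_star x z + ip_star y z.
Proof. by rewrite /ip_star starD cmulDl. Qed.

Let ip_starDr x y z : ip_star x (y + z) = ip_star x y + ip_star x z.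
Proof. by rewrite /ip_star cmulDr. Qed.

Let ip_starZ (k : R[i]) x y : ip_star (k *: x) y = ip_star x (k^* *: y).
Proof. by rewrite /ip_star starZ cmulZl cmulZr. Qed.

Let ip_starC x y : ip_star y x = star (ip_star x y).
Proof. by rewrite /ip_star starM starK. Qed.

Let ip_star_le x y : nrm (ip_star x y) <= nrm x * nrm y.
Proof. by rewrite (le_trans (nrm_cmul _ _)) // nrm_star. Qed.

Definition self_module : ipModule R :=
  IPModule ip_starDl ip_starDr ip_starZ ip_starC ip_star_le (@nrm_starM R A).

Lemma lmul_adjointable a : adjointable (cmul a : self_module -> self_module).
Proof.
split; last by exists (cmul (star a)) => x y; rewrite /ip /= /ip_star starM -cmulA.
- by exists (nrm a) => [|x]; [exact: nrm_ge0 | exact: nrm_cmul].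
- by move=> k x; rewrite cmulZr.
Qed.

Definition lmul a : adjOp self_module := mk_adjop (lmul_adjointable a).

(** Left multiplication carries the equation into a unital algebra. It loses nothing, since [lmul a]
    applied to [star a] is [a ** star a], which vanishes only if [a] does. *)
Lemma star_mul_add_eq0_nonunital a b : star a ** a + star b ** b = 0 -> a = 0.
Proof.
have sl x : star (lmul x) = lmul (star x).
  by apply: star_adjoint => y z; rewrite /ip /= /ip_star starM -cmulA.
move=> ab; have : star (lmul a) ** lmul a + star (lmul b) ** lmul b = 0.
  rewrite !sl; apply: adjop_eq => x.
  rewrite adjop_add !adjop_mulE /= !cmulA -cmulDl ab cmul0l //.
move=> /(@star_mul_add_eq0 _ _ (adjop_one self_module)).
move=> /(_ (@adjop_mul1 _ _) (@adjop_1mul _ _)).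
move=> la0; have : lmul a (star a) = 0 by rewrite la0.
rewrite /= -{1}(starK a) => /star_mul_eq0/(congr1 star).
by rewrite starK star0.
Qed.

End MultiplierAlgebra.

(** * Finite-dimensional subspaces *)

Section FiniteDimensional.
Context {R : realType}.

Lemma tends_closure (V : normedModType R[i]) (S : set V) (u : nat -> V) l :
  (forall n, S (u n)) -> tends u l -> closure S l.
Proof.
move=> Su ul; apply/closureP => e e0; have [|N NP] := ul (e / 2); first by lra.
exists (u N); first exact: Su.
by rewrite nrmC (le_lt_trans (NP N (leqnn _))) //; lra.
Qed.

Definition is_subspace (V : lmodType R[i]) (M : set V) :=
  [/\ M 0, (forall a b, M a -> M b -> M (a + b)) & forall (k : R[i]) a, M a -> M (k *: a)].

(** If v is outside the closed subspace M, its distance d to M is positive, so that |m + k v| >= |k|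
    d for m in M. Hence along a convergent sequence m_n + k_n v the scalars k_n converge, and then
    so do the m_n. *)
Lemma closed_add_line (V : normedModType R[i]) (M : set V) (v : V) :
  is_subspace M -> closed M ->
  closed [set x | exists m (k : R[i]), M m /\ x = m + k *: v].
Proof.
move=> [M0 MD MZ] cM x.
have [Mv|nMv] := pselect (M v).
  move=> xS; exists x, 0; split; last by rewrite scale0r addr0.
  apply: cM; apply/closureP => e /((closureP _ _).1 xS)[y [m [k [Mm ->]]] h].
  by exists (m + k *: v) => //; apply: MD => //; exact: MZ.
have [d d0 dP] : exists2 d : R, 0 < d & forall m, M m -> d <= nrm (v - m).
  apply: contrapT => h; apply: nMv; apply/cM/closureP => e e0.
  apply: contrapT => h2; apply: h; exists e => // m Mm.
  by rewrite leNgt; apply/negP => vm; apply: h2; exists m.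
move=> /closureP xS.
have /choice[y yP] (n : nat) : exists t : V * R[i],
    M t.1 /\ nrm (x - (t.1 + t.2 *: v)) <= n.+1%:R^-1.
  have [|_ [m [k [Mm ->]]] h] := xS n.+1%:R^-1; first by rewrite invr_gt0.
  by exists (m, k); split=> //; exact: ltW.
pose m n := (y n).1; pose k n := (y n).2.
(* Dividing the difference of two approximants by k_i - k_j leaves v minus an element of M, which
   has norm at least d. *)
have kd i j : nrm (k i - k j) * d <= i.+1%:R^-1 + j.+1%:R^-1.
  have [Mi hi] := yP i; have [Mj hj] := yP j.
  have hij : nrm ((m i + k i *: v) - (m j + k j *: v)) <= i.+1%:R^-1 + j.+1%:R^-1.
    by rewrite (le_trans (nrm_dist _ x _)) // lerD // nrmC.
  apply: le_trans hij; have [->|kij] := eqVneq (k i) (k j).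
    by rewrite subrr nrm0 mul0r nrm_ge0.
  have kij0 : k i - k j != 0 by rewrite subr_eq0.
  have -> : (m i + k i *: v) - (m j + k j *: v) =
      (k i - k j) *: (v - (k i - k j)^-1 *: (m j - m i)).
    rewrite scalerBr scalerA divff // scale1r.
    by lmodV V; ring.
  rewrite nrmZ ler_wpM2l ?nrm_ge0 // dP //; apply: (MZ); apply: MD => //.
  by rewrite -scaleN1r; exact: MZ.
have [|l kl] := @complex_cauchy_tends _ k.
  move=> e e0; have [|N NP] := @small_inv _ (e * d / 2).
    by rewrite divr_gt0 ?mulr_gt0.
  exists N => i j /NP hi /NP hj; rewrite -(ler_pM2r d0).
  by rewrite (le_trans (kd i j)) //; move: hi hj; move: (i.+1%:R^-1) (j.+1%:R^-1) => a b; lra.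
exists (x - l *: v), l; split; last by rewrite subrK.
apply: cM; apply: (@tends_closure _ _ m); first by move=> n; have [] := yP n.
move=> e e0; have e20 : 0 < e / 2 by rewrite divr_gt0.
have v1 : 0 < nrm v + 1 by rewrite ltr_wpDl ?nrm_ge0.
have [N NP] := small_inv e20.
have [|K KP] := kl (e / 2 / (nrm v + 1)); first by rewrite divr_gt0.
exists (maxn N K) => n; rewrite geq_max => /andP[/NP nN /KP nK].
have -> : m n - (x - l *: v) = (m n + k n *: v - x) - (k n - l) *: v.
  by lmodV V; ring.
rewrite (le_trans (nrmB _ _)) // (splitr e) lerD //.
  by rewrite nrmC (le_trans _ nN) //; have [] := yP n.
rewrite nrmZ (le_trans (ler_wpM2r (nrm_ge0 _) nK)) // mulrAC ler_pdivrMr //.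
by rewrite ler_wpM2l ?(ltW e20) // lerDl.
Qed.

Definition lin_range (V : lmodType R[i]) n (b : 'I_n -> V) : set V :=
  range (fun c : 'I_n -> R[i] => \sum_(i < n) c i *: b i).

Lemma lin_range_subspace (V : lmodType R[i]) n (b : 'I_n -> V) :
  is_subspace (lin_range b).
Proof.
split.
- by exists (fun=> 0) => //; rewrite big1 // => i _; rewrite scale0r.
- move=> _ _ [c _ <-] [d _ <-]; exists (fun i => c i + d i) => //.
  by rewrite -big_split; apply: eq_bigr => i _; rewrite scalerDl.
- move=> k _ [c _ <-]; exists (fun i => k * c i) => //.
  by rewrite scaler_sumr; apply: eq_bigr => i _; rewrite scalerA.
Qed.

Lemma lin_range_recr (V : lmodType R[i]) n (b : 'I_n.+1 -> V) :
  lin_range b = [set x | exists m (k : R[i]),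
    lin_range (fun i : 'I_n => b (widen_ord (leqnSn n) i)) m /\ x = m + k *: b ord_max].
Proof.
apply/seteqP; split=> [_ [c _ <-]|x [_ [k [[c _ <-] ->]]]].
  rewrite big_ord_recr /=; eexists; exists (c ord_max); split; last by [].
  by exists (fun i => c (widen_ord (leqnSn n) i)).
exists (fun i => if unlift ord_max i is Some j then c j else k) => //.
rewrite big_ord_recr /= unlift_none; congr (_ + _); apply: eq_bigr => i _.
have -> : widen_ord (leqnSn n) i = lift ord_max i.
  by apply: val_inj; rewrite /= /bump leqNgt ltn_ord add0n.
by rewrite liftK.
Qed.

Lemma lin_range_closed (V : normedModType R[i]) n (b : 'I_n -> V) :
  closed (lin_range b).
Proof.
elim: n b => [|n IH] b.
  move=> x /closureP x0; exists (fun=> 0) => //; rewrite big_ord0.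
  apply/esym/nrm_small => e /x0[_ [c _ <-]]; rewrite big_ord0 subr0; exact: ltW.
by rewrite lin_range_recr; apply: closed_add_line => //; exact: lin_range_subspace.
Qed.

Definition lspan (V : lmodType R[i]) (G : set V) : set V :=
  [set x | exists2 r : seq (R[i] * V), (forall t, t \in r -> G t.2) &
    x = \sum_(t <- r) t.1 *: t.2].

Section LinearSpan.
Variables (V : lmodType R[i]) (G : set V).

Lemma lspan_subset x : G x -> lspan G x.
Proof.
move=> Gx; exists [:: (1, x)]; first by move=> t; rewrite inE => /eqP ->.
by rewrite big_seq1 scale1r.
Qed.

Lemma lspan_subspace : is_subspace (lspan G).
Proof.
split.
- by exists [::] => //; rewrite big_nil.
- move=> _ _ [r rG ->] [q qG ->]; exists (r ++ q); last by rewrite big_cat.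
  by move=> t; rewrite mem_cat => /orP[/rG|/qG].
- move=> k _ [r rG ->]; exists [seq (k * t.1, t.2) | t <- r].
    by move=> _ /mapP[t /rG tG ->].
  by rewrite big_map scaler_sumr; apply: eq_bigr => t _; rewrite scalerA.
Qed.

Lemma lspan_min (M : set V) : is_subspace M -> G `<=` M -> lspan G `<=` M.
Proof.
move=> [M0 MD MZ] GM _ [r rG ->].
elim: r rG => [|t r IH] rG; first by rewrite big_nil.
rewrite big_cons; apply: (MD).
  by apply/(MZ)/GM/rG; rewrite mem_head.
by apply: IH => u ur; apply: rG; rewrite inE ur orbT.
Qed.

(** Zero generators are set apart because the monomials of a stage are indexed by infinitely many
    lists of edges, most of which give 0. *)
Lemma lspan_lin_range (r : seq V) : (forall x, G x -> x = 0 \/ x \in r) ->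
  (forall x, x \in r -> G x) ->
  lspan G = lin_range (fun i : 'I_(size r) => nth 0 r i).
Proof.
move=> Gr rG; apply/seteqP; split.
  apply: lspan_min; first exact: lin_range_subspace.
  move=> x /Gr[->|xr]; first by have [] := lin_range_subspace (fun i : 'I_(size r) => nth 0 r i).
  have ir : (index x r < size r)%N by rewrite index_mem.
  exists (fun i => (i == Ordinal ir)%:R) => //.
  rewrite (bigD1 (Ordinal ir)) //= eqxx scale1r nth_index // big1 ?addr0 //.
  by move=> i /negPf ->; rewrite scale0r.
move=> _ [c _ <-]; have [M0 MD MZ] := lspan_subspace.
elim/big_ind : _ => // i _; apply/(MZ)/lspan_subset/rG.
by rewrite mem_nth.
Qed.

End LinearSpan.

Lemma lspan_mono (V : lmodType R[i]) (G G' : set V) : G `<=` G' -> lspan G `<=` lspan G'.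
Proof.
move=> GG'; apply: lspan_min; first exact: lspan_subspace.
by move=> x /GG'; exact: lspan_subset.
Qed.

Section SpanAlgebra.
Variable A : cstarAlgType R.
Implicit Types (G U : set A).

Lemma lspan_mul G : (forall x y, G x -> G y -> x ** y = 0 \/ G (x ** y)) ->
  forall x y, lspan G x -> lspan G y -> lspan G (x ** y).
Proof.
move=> GM x y Gx Gy; have [M0 MD MZ] := lspan_subspace G.
move: x Gx; apply: (@lspan_min _ _ [set x | lspan G (x ** y)]).
  split=> /= [|a b aG bG|k a aG]; first by rewrite cmul0l.
  - by rewrite cmulDl; exact: MD.
  - by rewrite cmulZl; exact: MZ.
move=> x Gx /=; move: y Gy; apply: (@lspan_min _ _ [set y | lspan G (x ** y)]).
  split=> /= [|a b aG bG|k a aG]; first by rewrite cmul0r.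
  - by rewrite cmulDr; exact: MD.
  - by rewrite cmulZr; exact: MZ.
by move=> y /= /(GM _ _ Gx)[->//|]; exact: lspan_subset.
Qed.

Lemma lspan_star G : (forall x, G x -> G (star x)) ->
  forall x, lspan G x -> lspan G (star x).
Proof.
move=> Gs; have [M0 MD MZ] := lspan_subspace G.
apply: (@lspan_min _ _ [set x | lspan G (star x)]) => [|x /Gs]; last exact: lspan_subset.
split=> /= [|a b aG bG|k a aG]; first by rewrite star0.
- by rewrite starD; exact: MD.
- by rewrite starZ; exact: MZ.
Qed.

Lemma closure_cstar_subalgebra U : is_subspace U ->
  (forall a b, U a -> U b -> U (a ** b)) -> (forall a, U a -> U (star a)) ->
  is_cstar_subalgebra (closure U).
Proof.
move=> [U0 UD UZ] UM Us; split.
- exact: subset_closure.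
- move=> a b /closureP aU /closureP bU; apply/closureP => e e0.
  have e20 : 0 < e / 2 by rewrite divr_gt0.
  have [x Ux ax] := aU _ e20; have [y Uy bxy] := bU _ e20.
  exists (x + y); first exact: UD.
  by rewrite opprD addrACA (le_lt_trans (nrmD _ _)) // (splitr e) ltrD.
- move=> k a /closureP aU; apply/closureP => e e0.
  have k1 : 0 < nrm k + 1 by rewrite ltr_wpDl ?nrm_ge0.
  have [|x Ux ax] := aU (e / (nrm k + 1)); first by rewrite divr_gt0.
  exists (k *: x); first exact: UZ.
  rewrite -scalerBr nrmZ (le_lt_trans (ler_wpM2l (nrm_ge0 _) (ltW ax))) //.
  by rewrite mulrA ltr_pdivrMr // mulrC ltr_pM2l // ltrDl.
- move=> a b /closureP aU /closureP bU; apply/closureP => e e0.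
  have e20 : 0 < e / 2 by rewrite divr_gt0.
  have b1 : 0 < nrm b + 1 by rewrite ltr_wpDl ?nrm_ge0.
  have [|x Ux ax] := aU (e / 2 / (nrm b + 1)); first by rewrite divr_gt0.
  have x1 : 0 < nrm x + 1 by rewrite ltr_wpDl ?nrm_ge0.
  have [|y Uy bxy] := bU (e / 2 / (nrm x + 1)); first by rewrite divr_gt0.
  exists (x ** y); first exact: UM.
  have -> : a ** b - x ** y = (a - x) ** b + x ** (b - y).
    by rewrite cmulBl cmulBr; lmod; ring.
  rewrite (le_lt_trans (nrmD _ _)) // (splitr e) ltrD //.
    rewrite (le_lt_trans (nrm_cmul _ _)) //.
    rewrite (le_lt_trans (ler_wpM2r (nrm_ge0 _) (ltW ax))) //.
    by rewrite mulrAC ltr_pdivrMr // ltr_pM2l // ltrDl.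
  rewrite (le_lt_trans (nrm_cmul _ _)) //.
  rewrite (le_lt_trans (ler_wpM2l (nrm_ge0 _) (ltW bxy))) //.
  by rewrite mulrA ltr_pdivrMr // mulrC ltr_pM2l // ltrDl.
- move=> a /closureP aU; apply/closureP => e /aU[x Ux ax].
  by exists (star x); [exact: Us | rewrite -starB nrm_star].
- exact: closed_closure.
Qed.

End SpanAlgebra.

End FiniteDimensional.

(** With p - r = [star c ** c], the elements (1 - p) r (1 - p) and (1 - p) (p - r) (1 - p) add up to
    (1 - p) p (1 - p) = 0, and they are the squares of r - r p and c - c p. *)
Lemma projection_le (R : realType) (A : cstarAlgType R) (p r : A) :
  is_projection p -> is_projection r -> cstar_le r p -> r ** p = r.
Proof.
move=> [sp pp] [sr rr] [c cE].
have : star (r - r ** p) ** (r - r ** p) + star (c - c ** p) ** (c - c ** p) = 0.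
  have -> : star (c - c ** p) ** (c - c ** p) =
      star c ** c - p ** (star c ** c) - (star c ** c) ** p + p ** (star c ** c) ** p.
    by rewrite starB starM sp !(cmulBl, cmulBr) !cmulA; lmod; ring.
  have rr' x : x ** r ** r = x ** r by rewrite -cmulA rr.
  have pp' x : x ** p ** p = x ** p by rewrite -cmulA pp.
  rewrite -cE starB starM sr sp !(cmulBl, cmulBr) !cmulA !(rr, pp, rr', pp').
  by lmod; ring.
by move=> /star_mul_add_eq0_nonunital/subr0_eq/esym.
Qed.

(** * Graphs without loops *)

Fixpoint seqs_upto (T : Type) k (l : seq T) : seq (seq T) :=
  if k is k'.+1 then [::] :: [seq x :: w | x <- l, w <- seqs_upto k' l]
  else [:: [::]].

Lemma mem_seqs_upto (T : eqType) k (l w : seq T) :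
  {subset w <= l} -> (size w <= k)%N -> w \in seqs_upto k l.
Proof.
elim: k w => [|k IH] [|x w] //= wl kw; rewrite inE //=; apply/allpairsP.
exists (x, w); split=> //=; first by apply: wl; rewrite mem_head.
by apply: IH => // y yw; apply: wl; rewrite inE yw orbT.
Qed.

Lemma seqs_upto_subset (T : eqType) k (l w : seq T) :
  w \in seqs_upto k l -> {subset w <= l}.
Proof.
elim: k w => [|k IH] w /=; first by rewrite inE => /eqP ->.
rewrite inE => /predU1P[->//|/allpairsP[[x u] [/= xl /IH ul ->]]] y.
by rewrite inE => /predU1P[->//|/ul].
Qed.

Definition upto (T : countType) n : seq T := pmap unpickle (iota 0 n).

Section CuntzKrieger.
Context {R : realType} (E : digraph) (A : cstarAlgType R).
Variables (p : vertex E -> A) (s : edge E -> A).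
Hypothesis ck : is_CK_family p s.
Implicit Types (v w : vertex E) (e f : edge E) (al be ga de : seq (edge E)).

Lemma star_p v : star (p v) = p v.
Proof. by have [] := ck_projection ck v. Qed.

Lemma p_idem v : p v ** p v = p v.
Proof. by have [] := ck_projection ck v. Qed.

Lemma s_range e : s e ** p (rng e) = s e.
Proof. by rewrite -(ck_source ck) cmulA (ck_partial_isometry ck). Qed.

Lemma s_source e : p (src e) ** s e = s e.
Proof.
have rr : is_projection (s e ** star (s e)).
  by split; [rewrite starM starK | rewrite cmulA (ck_partial_isometry ck)].
have /(congr1 star) := projection_le (ck_projection ck (src e)) rr (ck_range_le ck e).
rewrite starM star_p starM starK => h.
by rewrite -(ck_partial_isometry ck e) cmulA h.
Qed.

Lemma p_s v e : p v ** s e = if v == src e then s e else 0.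
Proof.
case: eqVneq => [->|/eqP ve]; first exact: s_source.
by rewrite -s_source cmulA (ck_orthogonal ck ve) cmul0l.
Qed.

Lemma p_p v w : p v ** p w = if v == w then p v else 0.
Proof.
by case: eqVneq => [->|/eqP vw]; [exact: p_idem | exact: (ck_orthogonal ck)].
Qed.

Lemma star_s_s e f : star (s e) ** s f = if e == f then p (rng e) else 0.
Proof.
case: eqVneq => [->|/eqP ef]; first exact: (ck_source ck).
rewrite -(ck_partial_isometry ck e) -(ck_partial_isometry ck f) !starM starK.
have := ck_orthogonal_ranges ck ef; rewrite /orthogonal_projections => h.
by rewrite -!cmulA (cmulA (s e)) (cmulA (s f)) (cmulA (_ ** _)) h cmul0l cmul0r.
Qed.

(** The final factor [p v] makes the vertex projections the words of length 0, and makes a word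
    vanish unless its last edge ends at [v]. *)
Definition word al v := foldr (fun e x => s e ** x) (p v) al.

Definition composable e f := rng e == src f.

Lemma p_word v al w :
  p v ** word al w = 0 \/ p v ** word al w = word al w.
Proof.
case: al => [|e al] /=; first by rewrite p_p; case: eqP => [->|_]; [right|left].
by rewrite cmulA p_s; case: eqP => _; [right|left; rewrite cmul0l].
Qed.

Lemma word_sorted al v : word al v <> 0 -> sorted composable al.
Proof.
elim: al => [|e [|f al] IH] //= h; apply/andP; split.
  apply: contra_notT h => /negPf; rewrite /composable => ef.
  by rewrite -s_range -!cmulA (cmulA (p _)) p_s ef cmul0l cmul0r.
by apply: IH => h0; apply: h; move: h0 => /= ->; rewrite cmul0r.
Qed.

(** A repeated edge of a path closes a loop. So words over a finite set of edges vanish once they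
    are longer than that set, which bounds the dimension of a stage. *)
Lemma word_uniq al v : has_no_loops E -> word al v <> 0 -> uniq al.
Proof.
move=> nl /word_sorted; elim: al => [|e al IH] //= pal.
rewrite IH ?(path_sorted pal) // andbT; apply/negP => eal.
case/splitPr: eal pal => a1 a2; rewrite cat_path /= => /and3P[p1 /eqP p2 _].
by apply: (nl e a1); split.
Qed.

(* One of the words is a prefix of the other, or the product is [0]. *)
Lemma star_word_word be v ga w : star (word be v) ** word ga w = 0 \/
  (exists2 ga', {subset ga' <= ga} & star (word be v) ** word ga w = p v ** word ga' w /\
     p v ** word ga' w = word ga' w) \/
  (exists2 be', {subset be' <= be} & star (word be v) ** word ga w = star (word be' v) ** p w
     /\ star (word be' v) ** p w = star (word be' v)).
Proof.
elim: be ga => [|e be IH] ga.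
  rewrite /= star_p; have [->|h] := p_word v ga w; first by left.
  by right; left; exists ga.
case: ga => [|f ga].
  have [h|h] := p_word w (e :: be) v.
    by left; rewrite /= -[p w]star_p -starM h star0.
  right; right; exists (e :: be) => //; split=> //.
  by rewrite -{1}[p w]star_p -starM h.
rewrite /= starM -cmulA (cmulA (star (s e))) star_s_s.
case: eqP => [->|_]; last by left; rewrite cmul0l cmul0r.
have [h|->] := p_word (rng f) ga w; first by left; rewrite h cmul0r.
have [h|[[ga' sg h]|[be' sb h]]] := IH ga; first by left.
- by right; left; exists ga' => // x /sg xg; rewrite inE xg orbT.
- by right; right; exists be' => // x /sb xg; rewrite inE xg orbT.
Qed.

Lemma word_mul al v ga w : p v ** word ga w = word ga w ->
  word al v ** word ga w = word (al ++ ga) w.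
Proof. by move=> h; elim: al => [|e al IH] //=; rewrite -cmulA IH. Qed.

(** Bounding the codes makes the stages increase and exhaust the graph. They are stable under
    products up to 0, because cancelling a common prefix never introduces a new edge or vertex. *)
Definition ck_monomials n : set A := [set x | exists al be v,
  [/\ all (fun e => pickle e < n)%N al, all (fun e => pickle e < n)%N be,
      (pickle v < n)%N & x = word al v ** star (word be v)]].

Lemma ck_monomials_star n x : ck_monomials n x -> ck_monomials n (star x).
Proof.
move=> [al [be [v [aln ben vn ->]]]]; exists be, al, v.
by rewrite starM starK.
Qed.

Lemma word_p al v : word al v ** p v = word al v.
Proof. by elim: al => [|e al IH] /=; [exact: p_idem | rewrite -cmulA IH]. Qed.

Lemma ck_monomials_mul n x y : ck_monomials n x -> ck_monomials n y ->
  x ** y = 0 \/ ck_monomials n (x ** y).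
Proof.
move=> [al [be [v [aln ben vn ->]]]] [ga [de [w [gan den wn ->]]]].
have sub (l l' : seq (edge E)) : {subset l' <= l} ->
    all (fun e => pickle e < n)%N l -> all (fun e => pickle e < n)%N l'.
  by move=> ll /allP h; apply/allP => z /ll/h.
rewrite -cmulA (cmulA (star _)).
have [->|[[ga' sg [-> h]]|[be' sb [-> h]]]] := star_word_word be v ga w.
- by left; rewrite cmul0l cmul0r.
- right; exists (al ++ ga'), de, w; split=> //.
    by rewrite all_cat aln (sub _ _ sg).
  by rewrite h cmulA word_mul.
- right; exists al, (de ++ be'), v; split=> //.
    by rewrite all_cat den (sub _ _ sb).
  have h2 : p w ** word be' v = word be' v.
    by have := congr1 star h; rewrite starM starK star_p.
  by rewrite h -(@word_mul de w be' v h2) starM.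
Qed.

Lemma ck_monomials_fin n : has_no_loops E ->
  finite_dimensional (lspan (ck_monomials n)).
Proof.
move=> nl; pose L := [seq e <- upto (edge E) n | (pickle e < n)%N].
pose W := [seq v <- upto (vertex E) n | (pickle v < n)%N].
have mem_upto (T : countType) (x : T) : (pickle x < n)%N -> x \in upto T n.
  move=> xn; rewrite mem_pmap; apply/mapP; exists (pickle x); last by rewrite pickleK.
  by rewrite mem_iota.
(* Length [size L] suffices: a word that is nonzero has distinct edges, all in [L]. *)
pose r := [seq word t.1 v ** star (word t.2 v)
  | t <- [seq (al, be) | al <- seqs_upto (size L) L, be <- seqs_upto (size L) L],
    v <- W].
exists (size r), (fun i => nth 0 r i); apply: lspan_lin_range.
- move=> _ [al [be [v [aln ben vn ->]]]].
  have [->|/eqP a0] := eqVneq (word al v) 0; first by left; rewrite cmul0l.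
  have [->|/eqP b0] := eqVneq (word be v) 0; first by left; rewrite star0 cmul0r.
  have inL ga : all (fun e => pickle e < n)%N ga -> word ga v <> 0 ->
      ga \in seqs_upto (size L) L.
    move=> /allP gan g0; have gL : {subset ga <= L}.
      by move=> e /gan en; rewrite mem_filter en mem_upto.
    apply: mem_seqs_upto => //; apply: uniq_leq_size => //.
    exact: word_uniq g0.
  right; apply/allpairsP; exists ((al, be), v); split=> //=.
    by apply/allpairsP; exists (al, be); rewrite /= !inL.
  by rewrite mem_filter vn mem_upto.
- move=> _ /allpairsP[[t v] [/= /allpairsP[[al be] [/= aL bL ->]] vW ->]].
  have Ln ga : ga \in seqs_upto (size L) L -> all (fun e => pickle e < n)%N ga.
    move=> /seqs_upto_subset gL; apply/allP => e /gL.
    by rewrite mem_filter => /andP[].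
  exists al, be, v; rewrite !Ln //; split=> //.
  by move: vW; rewrite mem_filter => /andP[].
Qed.

Lemma no_loops_AF : cstar_generates (range p `|` range s) -> has_no_loops E -> is_AF A.
Proof.
move=> gen nl; pose S n := lspan (ck_monomials n).
have Smono m n : (m <= n)%N -> S m `<=` S n.
  move=> mn; apply: lspan_mono => _ [al [be [v [aln ben vn ->]]]].
  have le (T : countType) (l : seq T) : all (fun x => pickle x < m)%N l ->
      all (fun x => pickle x < n)%N l.
    by move=> /allP h; apply/allP => x /h /leq_trans; apply.
  by exists al, be, v; rewrite !le //; split=> //; exact: leq_trans vn mn.
have Ssub n := lspan_subspace (ck_monomials n).
have SM n := lspan_mul (@ck_monomials_mul n).
have Ss n := lspan_star (@ck_monomials_star n).
exists S; split=> [n|n|n|].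
- have [S0 SD SZ] := Ssub n; split=> //; first exact: SM.
    exact: Ss.
  by have [k [b kb]] := ck_monomials_fin n nl; rewrite /S kb; exact: lin_range_closed.
- exact: ck_monomials_fin.
- exact: Smono.
- apply: gen.
    apply: closure_cstar_subalgebra.
    + split.
      * by exists 0%N => //; have [] := Ssub 0%N.
      * move=> a b [m _ Sa] [n _ Sb]; exists (maxn m n) => //.
        have [_ SD _] := Ssub (maxn m n).
        by apply: SD; [move: Sa; apply: Smono; exact: leq_maxl
                      |move: Sb; apply: Smono; exact: leq_maxr].
      * move=> k a [n _ Sa]; exists n => //; have [_ _ SZ] := Ssub n; exact: SZ.
    + move=> a b [m _ Sa] [n _ Sb]; exists (maxn m n) => //; apply: SM.
        by move: Sa; apply: Smono; exact: leq_maxl.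
      by move: Sb; apply: Smono; exact: leq_maxr.
    + by move=> a [n _ Sa]; exists n => //; exact: Ss.
  move=> x [[v _ <-]|[e _ <-]]; apply: subset_closure.
  + exists (pickle v).+1 => //; apply: lspan_subset; exists [::], [::], v.
    by rewrite /= star_p p_idem.
  (* As a monomial, [s e] involves the vertex [rng e] as well as the edge [e]. *)
  + exists (maxn (pickle e).+1 (pickle (rng e)).+1) => //; apply: lspan_subset.
    exists [:: e], [::], (rng e); rewrite /= star_p s_range s_range andbT.
    by rewrite !leq_max !leqnn !orbT.
Qed.

End CuntzKrieger.

(** * Finite-dimensional subalgebras *)

Section LinearDependence.
Context {R : realType} (V : lmodType R[i]).

(** The n + 1 coefficient rows have length n, so their matrix has a nonzero left kernel. The
    relation is returned as a polynomial because [x] will list the iterates of an operator. *)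
Lemma lin_range_dependent n (b : 'I_n -> V) (x : nat -> V) :
  (forall i, lin_range b (x i)) ->
  exists2 P : {poly R[i]}, P != 0 & \sum_(i < size P) P`_i *: x i = 0.
Proof.
move=> bx; have /choice[c cP] (i : nat) : exists c : 'I_n -> R[i], x i = \sum_(j < n) c j *: b j.
  by have [c _ <-] := bx i; exists c.
pose M : 'M[R[i]]_(n.+1, n) := \matrix_(i, j) c i j.
have kM : kermx M != 0.
  rewrite kermx_eq0 /row_free neq_ltn.
  by rewrite (leq_ltn_trans (rank_leq_col _)).
pose u := nz_row (kermx M).
have uM : u *m M = 0 by apply/sub_kermxP; exact: nz_row_sub.
have u0 : u != 0 by rewrite nz_row_eq0.
pose P := \poly_(i < n.+1) u 0 (inord i).
have sumE (Q : {poly R[i]}) m : (size Q <= m)%N ->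
    \sum_(i < size Q) Q`_i *: x i = \sum_(i < m) Q`_i *: x i.
  move=> Qm; rewrite (big_ord_widen m (fun i => Q`_i *: x i)) // big_mkcond.
  apply: eq_bigr => i _; case: ltnP => // Qi.
  by rewrite nth_default // scale0r.
exists P.
  apply: contraNneq u0 => P0; apply/eqP/rowP => i; rewrite mxE.
  have := congr1 (fun Q : {poly R[i]} => Q`_i) P0.
  by rewrite coef_poly ltn_ord inord_val coef0.
rewrite (sumE _ n.+1) ?size_poly //.
rewrite (eq_bigr (fun i : 'I_n.+1 => \sum_(j < n) (u 0 i * M i j) *: b j)); last first.
  move=> i _; rewrite coef_poly ltn_ord inord_val cP scaler_sumr.
  by apply: eq_bigr => j _; rewrite scalerA mxE.
rewrite exchange_big big1 //= => j _; rewrite -scaler_suml.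
have := congr1 (fun N : 'M[R[i]]_(1, n) => N 0 j) uM; rewrite !mxE => ->.
by rewrite scale0r.
Qed.

Variable T : V -> V.
Hypotheses (TD : forall x y, T (x + y) = T x + T y)
  (TZ : forall (k : R[i]) x, T (k *: x) = k *: T x).
Implicit Types (P Q : {poly R[i]}) (x y : V).

Definition pact P x : V := \sum_(i < size P) P`_i *: iter i T x.

Lemma pactE n P x : (size P <= n)%N -> pact P x = \sum_(i < n) P`_i *: iter i T x.
Proof.
move=> Pn; rewrite /pact (big_ord_widen n (fun i => P`_i *: iter i T x)) //.
rewrite big_mkcond; apply: eq_bigr => i _; case: ltnP => // Pi.
by rewrite nth_default // scale0r.
Qed.

Lemma pact0 x : pact 0 x = 0.
Proof. by rewrite /pact size_poly0 big_ord0. Qed.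

Lemma pactC (c : R[i]) x : pact c%:P x = c *: x.
Proof. by rewrite (@pactE 1) ?size_polyC_leq1 // big_ord1 coefC. Qed.

Lemma pactDl P Q x : pact (P + Q) x = pact P x + pact Q x.
Proof.
pose n := maxn (size P) (size Q).
rewrite (@pactE n (P + Q)) ?(leq_trans (size_polyD _ _)) //.
rewrite (@pactE n P) ?leq_maxl // (@pactE n Q) ?leq_maxr // -big_split.
by apply: eq_bigr => i _; rewrite coefD scalerDl.
Qed.

Lemma T0 : T 0 = 0.
Proof. by have := TZ 0 0; rewrite !scale0r. Qed.

Lemma iter_T0 n : iter n T 0 = 0.
Proof. by elim: n => //= n ->; exact: T0. Qed.

Lemma pact0r P : pact P 0 = 0.
Proof. by rewrite /pact big1 // => i _; rewrite iter_T0 scaler0. Qed.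

Lemma pactMX P x : pact (P * 'X) x = T (pact P x).
Proof.
rewrite (@pactE (size P).+1) ?(leq_trans (size_polyMleq _ _)) ?size_polyX ?addn2 //.
rewrite big_ord_recl coefMX eqxx scale0r add0r /pact.
rewrite (big_morph T TD T0); apply: eq_bigr => i _.
by rewrite coefMX /= TZ.
Qed.

Lemma pactM P Q x : pact (P * Q) x = pact P (pact Q x).
Proof.
elim/poly_ind: P => [|P c IH]; first by rewrite mul0r !pact0.
rewrite mulrDl !pactDl pactC mulrAC !pactMX IH; congr (_ + _).
rewrite mul_polyC (@pactE (size Q)) ?size_scale_leq // /pact scaler_sumr.
by apply: eq_bigr => i _; rewrite coefZ scalerA.
Qed.

Lemma pact_in (F : set V) P x : is_subspace F -> (forall x, F x -> F (T x)) ->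
  F x -> F (pact P x).
Proof.
move=> [F0 FD FZ] FT Fx; elim/poly_ind: P => [|P c IH]; first by rewrite pact0.
rewrite pactDl pactMX pactC; apply: FD; [exact: FT|exact: FZ].
Qed.

(** Some nonzero polynomial in T kills y. Injectivity removes factors 'X until the constant term c
    is nonzero; then T (P(T) y) + c y = 0 exhibits y as a value of T. *)
Lemma fd_inj_surj n (b : 'I_n -> V) :
  (forall x, lin_range b x -> lin_range b (T x)) ->
  (forall x, lin_range b x -> T x = 0 -> x = 0) ->
  forall y, lin_range b y -> exists2 x, lin_range b x & T x = y.
Proof.
move=> bT bI y by_; have bs := lin_range_subspace b.
have [i|P P0 PE] := @lin_range_dependent _ b (fun i => iter i T y).
  by elim: i => //= i; exact: bT.
have {PE} : pact P y = 0 by [].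
elim/poly_ind: P P0 => [|P c IH]; first by rewrite eqxx.
have bP : lin_range b (pact P y) by exact: pact_in.
have [-> P0|c0 _] := eqVneq c 0.
  rewrite addr0 pactMX => /(bI _ bP); apply: IH.
  by apply: contraNneq P0 => ->; rewrite mul0r addr0.
rewrite pactDl pactMX pactC => /eqP; rewrite addr_eq0 => /eqP h.
exists (- c^-1 *: pact P y); first by have [_ _] := bs; apply.
by rewrite TZ h scaleNr scalerN opprK scalerA mulVf // scale1r.
Qed.

End LinearDependence.

Section AF.
Context {R : realType} (A : cstarAlgType R).
Implicit Types (F : set A) (a b x y : A).

Lemma cstar_subalgebra_subspace F : is_cstar_subalgebra F -> is_subspace F.
Proof. by case=> F0 FD FZ _ _ _; split. Qed.

Lemma AF_approx (AFA : is_AF A) a b (e : R) : 0 < e ->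
  exists F, [/\ is_cstar_subalgebra F, finite_dimensional F &
    exists x y, [/\ F x, F y, nrm (a - x) < e & nrm (b - y) < e]].
Proof.
case: AFA => S [Ssub Sfd SS1 Sdense] e0.
have SS m n : (m <= n)%N -> S m `<=` S n.
  move=> /subnK <-; elim: (n - m)%N => // k IH x /IH; exact: SS1.
have approx c : exists n x, S n x /\ nrm (c - x) < e.
  have : closure (\bigcup_n S n) c by rewrite Sdense.
  by move=> /closureP /(_ e e0)[x [n _ Sx] cx]; exists n, x.
have [m [x [Sx ax]]] := approx a; have [n [y [Sy bxy]]] := approx b.
exists (S (maxn m n)); split=> //; exists x, y; split=> //.
  by move: Sx; apply: SS; exact: leq_maxl.
by move: Sy; apply: SS; exact: leq_maxr.
Qed.

Lemma nrm_projection (p : A) : is_projection p -> nrm p <= 1.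
Proof.
move=> [sp pp]; have := nrm_starM p; rewrite sp pp.
have [->|/eqP p0] := eqVneq (nrm p) 0; first by rewrite ler01.
have n0 : 0 < nrm p by rewrite lt_def nrm_ge0 andbT; exact/eqP.
by rewrite expr2 -{1}[nrm p]mulr1 => /(mulfI (lt0r_neq0 n0)) <-.
Qed.

(* Perturb the isometry [s + (1 - p)] of the unitization into a
   finite-dimensional subalgebra, where injectivity implies surjectivity. *)
Lemma AF_isometry (AFA : is_AF A) (p s : A) : is_projection p ->
  star s ** s = p -> p ** s = s -> s ** p = s -> s ** star s = p.
Proof.
move=> pP ssp ps sp; have [pstar pp] := pP; have p1 := nrm_projection pP.
have s1 : nrm s <= 1.
  by rewrite -(expr_le1 (n := 2)) ?nrm_ge0 // -nrm_starM ssp.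
have sps : star s ** p = star s by rewrite -[in RHS]ps starM pstar.
(* Left multiplication by s + 1 - p is bounded below by 1/3. An error 2/30 still leaves the bound
   1/4, and the final error 1/30 + 5/15 stays below 1/2. *)
have e0 : (0 : R) < 30^-1 by rewrite invr_gt0.
have [F [Fsub [n [b FE]] [t [y [Ft Fy st py]]]]] := AF_approx AFA s p e0.
pose U x := s ** x + x - p ** x; pose W x := t ** x + x - y ** x.
have FW x : F x -> F (W x).
  case: Fsub => F0 FD FZ FM _ _ Fx; rewrite /W -scaleN1r.
  by apply: (FD); [apply: (FD) => //; exact: FM | apply: (FZ); exact: FM].
have UW x : nrm (U x - W x) <= 15^-1 * nrm x.
  have -> : U x - W x = (s - t) ** x - (p - y) ** x.
    by rewrite /U /W !cmulBl; lmod; ring.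
  rewrite (le_trans (nrmB _ _)) // (_ : 15^-1 = 30^-1 + 30^-1 :> R); last by field.
  rewrite mulrDl lerD // (le_trans (nrm_cmul _ _)) // ler_wpM2r ?nrm_ge0 //.
    exact: ltW.
  exact: ltW.
have Ux x : nrm x <= 3 * nrm (U x).
  (* [star s] + 1 - p is a left inverse of s + 1 - p. *)
  have {1}-> : x = star s ** U x + U x - p ** U x.
    rewrite /U !(cmulBr, cmulDr) !cmulA ssp sps ps pp; lmod; ring.
  set z := U x.
  have h1 : nrm (star s ** z) <= nrm z.
    rewrite (le_trans (nrm_cmul _ _)) // nrm_star.
    by rewrite -[leRHS]mul1r ler_wpM2r ?nrm_ge0.
  have h2 : nrm (p ** z) <= nrm z.
    by rewrite (le_trans (nrm_cmul _ _)) // -[leRHS]mul1r ler_wpM2r ?nrm_ge0.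
  have := nrmB (star s ** z + z) (p ** z); have := nrmD (star s ** z) z; lra.
have Wx x : nrm x <= 4 * nrm (W x).
  have := Ux x; have := UW x; have := nrm_dist (U x) (W x) 0; rewrite !subr0.
  have := nrm_ge0 (W x); lra.
have [|||||w Fw Wy] := @fd_inj_surj _ A W _ _ n b _ _ y.
- by move=> c d; rewrite /W !cmulDr; lmod; ring.
- by move=> k c; rewrite /W !cmulZr; lmod; ring.
- by move=> c; rewrite /lin_range -FE; exact: FW.
- move=> c _ c0; apply: nrm_le0.
  by rewrite (le_trans (Wx c)) // c0 nrm0 mulr0.
- by rewrite /lin_range -FE.
(* The defect q annihilates the range of U, which comes within 1/2 of p at U w. Hence q = q (p - U
   w) has norm at most |q| / 2. *)
pose q := p - s ** star s.
have qU : q ** U w = 0.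
  rewrite /q /U !(cmulBr, cmulDr, cmulBl) !cmulA ps pp -!(cmulA s (star s)).
  by rewrite ssp sps sp !cmulA; lmod; ring.
have qp : q ** p = q by rewrite /q cmulBl pp -cmulA sps.
have w5 : nrm w <= 5.
  have := Wx w; rewrite Wy; have := nrm_dist y p 0; rewrite !subr0 (nrmC y p).
  by move: py p1; lra.
have pU : nrm (p - U w) <= 2^-1.
  have := nrm_dist p y (U w); rewrite -{2}Wy (nrmC (W w)).
  by have := UW w; move: py w5; lra.
have : nrm q <= nrm q * 2^-1.
  have {1}-> : q = q ** (p - U w) by rewrite cmulBr qU subr0 qp.
  by rewrite (le_trans (nrm_cmul _ _)) // ler_wpM2l ?nrm_ge0.
have := nrm_ge0 q => q0 h; have : nrm q <= 0 by lra.
by move=> /nrm_le0/subr0_eq ->.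
Qed.

End AF.

(** * Functional calculus in a finite-dimensional subalgebra *)

Section FiniteCalculus.
Context {R : realType} (A : cstarAlgType R) (k : A).
Hypothesis ksa : star k = k.
Implicit Types (P Q : {poly R[i]}) (a b w : A) (r : seq R[i]) (x : R).

Local Notation act := (pact (cmul k)).

Let kD a b : k ** (a + b) = k ** a + k ** b. Proof. exact: cmulDr. Qed.
Let kZ (c : R[i]) a : k ** (c *: a) = c *: (k ** a). Proof. exact: cmulZr. Qed.

Lemma pact_cmulr P a b : act P a ** b = act P (a ** b).
Proof.
elim/poly_ind: P => [|P c IH]; first by rewrite !pact0 cmul0l.
by rewrite !pactDl !(pactMX kD kZ) !pactC cmulDl cmulZl -cmulA IH.
Qed.

Lemma pactX a : act 'X a = k ** a.
Proof. by rewrite -['X]mul1r (pactMX kD kZ) -[1]/1%:P pactC scale1r. Qed.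

Lemma pact_cmul_comm P a : act P (k ** a) = k ** act P a.
Proof. by rewrite -pactX -(pactM kD kZ) (pactMX kD kZ). Qed.

Lemma star_pact P : star (act P k) = act (map_poly Num.conj P) k.
Proof.
elim/poly_ind: P => [|P c IH]; first by rewrite rmorph0 !pact0 star0.
rewrite rmorphD rmorphM /= map_polyX map_polyC /= !pactDl !(pactMX kD kZ) !pactC.
by rewrite starD starM starZ ksa IH pact_cmulr pact_cmul_comm.
Qed.

Lemma pactXsubC z Q a : act (('X - z%:P) * Q) a = k ** act Q a - z *: act Q a.
Proof.
by rewrite (pactM kD kZ) pactDl pactX -polyCN pactC scaleNr.
Qed.

(** Here [act Q k] is Q(k) k, a polynomial without constant term. If k w = z w, then
    [star w ** k ** w] is self-adjoint and equals z [star w ** w], so z is real or w = 0. *)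
Lemma pact_nonreal_root z Q : Num.conj z <> z ->
  act (('X - z%:P) * Q) k = 0 -> act Q k = 0.
Proof.
rewrite pactXsubC => zz /subr0_eq kw; set w := act Q k in kw *.
have w1 : star w ** k ** w = z *: (star w ** w) by rewrite -cmulA kw cmulZr.
have w2 : star w ** k ** w = z^* *: (star w ** w).
  by have := congr1 star w1; rewrite starZ !starM starK ksa cmulA.
have : (z - z^*) *: (star w ** w) = 0 by rewrite scalerBl -w1 -w2 subrr.
move=> /eqP; rewrite scaler_eq0 subr_eq0 => /orP[/eqP zE|/eqP/star_mul_eq0//].
by case: zz.
Qed.

Lemma pact_null_root Q : act (('X - 0%:P) * Q) k = 0 -> act Q k = 0.
Proof.
rewrite pactXsubC scale0r subr0 => kw; apply: star_mul_eq0.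
by rewrite star_pact pact_cmulr kw (pact0r kZ).
Qed.

(** For w = (k - z) Q(k) k and z real, [star w ** w] contains the factor (k - z) w = 0: self-adjoint
    elements have no nilpotent part. *)
Lemma pact_double_root z Q : Num.conj z = z ->
  act (('X - z%:P) * (('X - z%:P) * Q)) k = 0 -> act (('X - z%:P) * Q) k = 0.
Proof.
move=> zz; rewrite pactXsubC => /subr0_eq; set w := act (_ * Q) k => kw.
have wE : w = k ** act Q k - z *: act Q k by rewrite /w pactXsubC.
apply: star_mul_eq0; rewrite {1}wE starB starM starZ ksa zz cmulBl cmulZl.
by rewrite -cmulA kw cmulZr subrr.
Qed.

Lemma pact_simple_roots r : act (\prod_(z <- r) ('X - z%:P)) k = 0 ->
  exists r' : seq R, [/\ uniq r', 0 \notin r' &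
    act (\prod_(x <- r') ('X - (x%:C)%:P)) k = 0].
Proof.
have [n] := ubnP (size r); elim: n r => // n IH r rn r0.
have remE z : z \in r ->
    \prod_(y <- r) ('X - y%:P) = ('X - z%:P) * \prod_(y <- rem z r) ('X - y%:P).
  by move=> zr; rewrite (perm_big _ (perm_to_rem zr)) big_cons.
have remn z : z \in r -> (size (rem z r) < n)%N.
  move=> zr; rewrite size_rem //; move: rn zr; case: (r) => //= *.
have [[z zr zbad]|good] := pselect (exists2 z, z \in r & Num.conj z <> z \/ z = 0).
  apply: (IH (rem z r)); first exact: remn.
  move: r0; rewrite (remE z) //; case: zbad => [zz|->]; last exact: pact_null_root.
  exact: pact_nonreal_root.
have zreal z : z \in r -> Num.conj z = z.
  by move=> zr; apply: contrapT => zz; apply: good; exists z => //; left.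
have [ur|nur] := boolP (uniq r); last first.
  have [z [zr zr2]] : exists z, z \in r /\ z \in rem z r.
    elim: (r) nur => //= y q IHq; rewrite negb_and negbK => /orP[yq|/IHq[z [zq zq2]]].
      by exists y; rewrite mem_head /= eqxx.
    exists z; rewrite inE zq orbT /=; split=> //; case: eqP => // _.
    by rewrite inE zq2 orbT.
  apply: (IH (rem z r)); first exact: remn.
  move: r0; rewrite (remE z) //.
  rewrite (perm_big _ (perm_to_rem zr2)) big_cons.
  exact/pact_double_root/zreal.
have rE : r = [seq x%:C | x <- map (@complex.Re R) r].
  rewrite -map_comp -[LHS]map_id; apply/eq_in_map => z /zreal zz /=.
  rewrite RRe_real //; apply/CrealP; exact: zz.
exists (map (@complex.Re R) r); split.
- by move: ur; rewrite {1}rE map_inj_uniq //; exact: complexI.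
- apply/negP => h; apply: good; exists 0; last by right.
  by rewrite rE; exact: (map_f (real_complex R) h).
- by move: r0; move: (map _ r) rE => s ->; rewrite big_map.
Qed.

Lemma interpolation (r : seq R) (f : R -> R) : uniq r ->
  exists P : {poly R[i]}, forall x, x \in r -> P.[x%:C] = (f x)%:C.
Proof.
elim: r => [|x r IH] /=; first by exists 0.
move=> /andP[xr /IH[P PE]]; pose N := \prod_(y <- r) ('X - (y%:C)%:P).
have Nr y : y \in r -> N.[y%:C] = 0.
  by move=> yr; rewrite /N (perm_big _ (perm_to_rem yr)) big_cons !hornerE subrr mul0r.
have Nx : N.[x%:C] != 0.
  rewrite /N horner_prod prodf_seq_neq0; apply/allP => y yr /=.
  rewrite !hornerE subr_eq0; apply: contraNneq xr => xy.
  by rewrite (complexI xy).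
exists (P + ((f x)%:C - P.[x%:C]) / N.[x%:C] *: N) => y.
rewrite inE hornerD hornerZ => /predU1P[->|yr]; last by rewrite (Nr y) // mulr0 addr0 PE.
by rewrite divfK // addrC subrK.
Qed.

Lemma pact_eq (r : seq R) P Q : uniq r ->
  act (\prod_(x <- r) ('X - (x%:C)%:P)) k = 0 ->
  (forall x, x \in r -> P.[x%:C] = Q.[x%:C]) -> act P k = act Q k.
Proof.
move=> ur r0 PQ; pose r' := [seq x%:C | x <- r].
have [D DE] : exists D, P - Q = D * \prod_(z <- r') ('X - z%:P).
  apply/dvdpP; apply: uniq_roots_dvdp.
    apply/allP => _ /mapP[x xr ->]; rewrite /root !hornerE PQ //.
    by rewrite subrr.
  by rewrite uniq_rootsE map_inj_uniq //; exact: complexI.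
have -> : P = (P - Q) + Q by rewrite subrK.
by rewrite pactDl DE (pactM kD kZ) big_map r0 (pact0r kZ) add0r.
Qed.

End FiniteCalculus.

(** [fc f] is Q(k) k with Q interpolating f(x) / x at the nonzero roots, so it lies in [F] even if
    [F] has no unit. The constant 1 is sent to the support projection of k. Products work since (f /
    x) x (g / x) = f g / x. *)
Lemma finite_calculus (R : realType) (A : cstarAlgType R) (F : set A) (k : A) :
  is_cstar_subalgebra F -> finite_dimensional F -> F k -> star k = k ->
  exists fc : (R -> R) -> A,
  [/\ (forall f, F (fc f)) /\ (forall f, star (fc f) = fc f),
      forall f g, fc f ** fc g = fc (fun x => f x * g x),
      forall f g, fc (fun x => f x + g x) = fc f + fc g,
      forall c f, fc (fun x => c * f x) = c%:C *: fc f
    & fc id = k].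
Proof.
move=> Fsub [n [b FE]] Fk kk; have Fs := cstar_subalgebra_subspace Fsub.
have kD : forall a c, k ** (a + c) = k ** a + k ** c by exact: cmulDr.
have kZ : forall (c : R[i]) a, k ** (c *: a) = c *: (k ** a) by move=> *; exact: cmulZr.
have Fk_ a : F a -> F (k ** a) by case: Fsub => _ _ _ FM _ _; exact: FM.
have [i|P P0 PE] := @lin_range_dependent _ _ n b (fun i => iter i (cmul k) k).
  by rewrite /lin_range -FE; elim: i => //= i IH; exact: Fk_.
have {PE} Pk : pact (cmul k) P k = 0 by [].
have [r rE] := closed_field_poly_normal P.
have [|s [us s0 sE]] := @pact_simple_roots _ _ k kk r.
  move: Pk; rewrite rE -mul_polyC (pactM kD kZ) pactC => /eqP.
  by rewrite scaler_eq0 lead_coef_eq0 (negPf P0) => /eqP.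
have /choice[I IE] (f : R -> R) : exists Q : {poly R[i]},
    forall x, x \in s -> Q.[x%:C] = (f x / x)%:C by exact: interpolation.
have sx x : x \in s -> x != 0 by move=> xs; apply: contraNneq s0 => <-.
have eqI := pact_eq us sE.
exists (fun f => pact (cmul k) (I f) k); split.
- split=> f; first exact: pact_in.
  rewrite star_pact //; apply: eqI => x xs; rewrite IE //.
  rewrite -[x%:C](conjc_real x) -/(Num.conj _) horner_map /= IE //.
  exact: conjc_real.
- move=> f g; rewrite pact_cmulr -(pactX k) -!(pactM kD kZ); apply: eqI => x xs.
  rewrite !hornerE !IE // -!rmorphM /=; congr (_%:C).
  by field; exact: sx.
- move=> f g; rewrite -pactDl; apply: eqI => x xs.
  by rewrite !hornerE !IE // -rmorphD mulrDl.
- move=> c f; rewrite -(pactC (cmul k)) -(pactM kD kZ); apply: eqI => x xs.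
  by rewrite !hornerE !IE // -rmorphM mulrA.
- rewrite -[RHS]scale1r -(pactC (cmul k)); apply: eqI => x xs.
  by rewrite IE // divff ?sx // hornerE.
Qed.

(** * The Hilbert space of square-summable functions *)

Section SumNonneg.
Context {R : realType} (X : choiceType).
Implicit Types (f g : X -> R) (s t : seq X).

Definition sums_le f (C : R) := forall s, uniq s -> \sum_(i <- s) f i <= C.

Definition has_sum f := (forall i, 0 <= f i) /\ exists C, sums_le f C.

(** An unordered sum, taken over finite subsets, because the set of boundary paths may be
    uncountable. *)
Definition ssum f : R := sup [set \sum_(i <- s) f i | s in [set s | uniq s]].

Lemma ssum_has_sup f : has_sum f ->
  has_sup [set \sum_(i <- s) f i | s in [set s | uniq s]].
Proof.
move=> [f0 [C fC]]; split; first by exists 0, [::] => //; rewrite big_nil.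
by exists C => _ [s us <-]; exact: fC.
Qed.

Lemma ssum_ub f s : has_sum f -> uniq s -> \sum_(i <- s) f i <= ssum f.
Proof. by move=> /ssum_has_sup fs us; apply: sup_upper_bound => //; exists s. Qed.

Lemma ssum_le f C : has_sum f -> sums_le f C -> ssum f <= C.
Proof.
move=> /ssum_has_sup[ne _] fC; apply: ge_sup => // _ [s us <-]; exact: fC.
Qed.

Lemma ssum_ge0 f : has_sum f -> 0 <= ssum f.
Proof. by move=> fs; have := @ssum_ub f [::] fs isT; rewrite big_nil. Qed.

Lemma ssum_ge f i : has_sum f -> f i <= ssum f.
Proof. by move=> fs; have := @ssum_ub f [:: i] fs isT; rewrite big_seq1. Qed.

Lemma sum_mono f s t : (forall i, 0 <= f i) -> uniq s -> uniq t ->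
  {subset s <= t} -> \sum_(i <- s) f i <= \sum_(i <- t) f i.
Proof.
move=> f0 us ut st; rewrite [leRHS](bigID (mem s)) /= -[in leRHS]big_filter.
rewrite (perm_big [seq i <- t | i \in s]); last first.
  apply: uniq_perm => // [|i]; first exact: filter_uniq.
  by rewrite mem_filter; case: (boolP (i \in s)) => //= /st ->.
by rewrite lerDl sumr_ge0.
Qed.

Lemma has_sumD f g : has_sum f -> has_sum g -> has_sum (fun i => f i + g i).
Proof.
move=> [f0 [C fC]] [g0 [D gD]]; split=> [i|]; first exact: addr_ge0.
by exists (C + D) => s us; rewrite big_split lerD ?fC ?gD.
Qed.

Lemma has_sumZ (c : R) f : 0 <= c -> has_sum f -> has_sum (fun i => c * f i).
Proof.
move=> c0 [f0 [C fC]]; split=> [i|]; first exact: mulr_ge0.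
by exists (c * C) => s us; rewrite -mulr_sumr ler_wpM2l ?fC.
Qed.

Lemma has_sum_le f g : (forall i, 0 <= f i <= g i) -> has_sum g -> has_sum f.
Proof.
move=> fg [g0 [C gC]]; split=> [i|]; first by have /andP[] := fg i.
exists C => s us; apply: le_trans (gC s us); apply: ler_sum => i _.
by have /andP[] := fg i.
Qed.

Lemma ssumD f g : has_sum f -> has_sum g ->
  ssum (fun i => f i + g i) = ssum f + ssum g.
Proof.
move=> fs gs; have fgs := has_sumD fs gs; have [f0 _] := fs; have [g0 _] := gs.
apply/le_anti/andP; split.
  apply: ssum_le => // s us; rewrite big_split.
  by rewrite lerD // ssum_ub.
rewrite -lerBrDr; apply: ssum_le => // s us.
rewrite lerBrDr addrC -lerBrDr; apply: ssum_le => // t ut.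
(* Finite sums of f over s and of g over t are both dominated by sums over the union of s and t. *)
rewrite lerBrDr addrC; pose r := undup (s ++ t).
have ur : uniq r by exact: undup_uniq.
apply: le_trans (ssum_ub fgs ur); rewrite big_split lerD //.
  by apply: sum_mono => // i; rewrite mem_undup mem_cat => ->.
by apply: sum_mono => // i; rewrite mem_undup mem_cat orbC => ->.
Qed.

Lemma ssumZ (c : R) f : 0 <= c -> has_sum f -> ssum (fun i => c * f i) = c * ssum f.
Proof.
move=> c0 fs; have [->|cn0] := eqVneq c 0.
  rewrite mul0r; apply/le_anti/andP; split.
    apply: ssum_le => [|s us]; first exact: has_sumZ.
    by rewrite big1 // => i _; rewrite mul0r.
  by apply/ssum_ge0/has_sumZ.
have cgt0 : 0 < c by rewrite lt_def cn0.
have cfs := has_sumZ c0 fs; apply/le_anti/andP; split.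
  by apply: ssum_le => // s us; rewrite -mulr_sumr ler_wpM2l // ssum_ub.
rewrite -ler_pdivlMl //; apply: ssum_le => // s us.
by rewrite ler_pdivlMl // mulr_sumr ssum_ub.
Qed.

(** A left inverse makes [psi] injective on [cod], which yields one inequality; the reverse one is
    this lemma with the roles exchanged. *)
Lemma has_sum_reindex (dom cod : pred X) (phi psi : X -> X) f :
  (forall y, cod y -> dom (psi y) /\ phi (psi y) = y) ->
  has_sum f ->
  has_sum (fun y => if cod y then f (psi y) else 0) /\
  ssum (fun y => if cod y then f (psi y) else 0) <= ssum (fun x => if dom x then f x else 0).
Proof.
move=> H fs; have [f0 _] := fs; pose F x := if dom x then f x else 0.
have Fs : has_sum F.
  by apply: has_sum_le (fs) => i; rewrite /F; case: ifP; rewrite ?f0 ?lexx.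
have main s : uniq s ->
    \sum_(y <- s) (if cod y then f (psi y) else 0) <= ssum F.
  move=> us; rewrite -big_mkcond -big_filter.
  have -> : \sum_(y <- [seq y <- s | cod y]) f (psi y) =
      \sum_(x <- [seq psi y | y <- s & cod y]) F x.
    rewrite big_map big_seq [RHS]big_seq; apply: eq_bigr => y.
    by rewrite mem_filter /F => /andP[/H[-> _]].
  apply: ssum_ub => //; rewrite map_inj_in_uniq ?filter_uniq // => y z.
  rewrite !mem_filter => /andP[/H[_ py] _] /andP[/H[_ pz] _] /(congr1 phi).
  by rewrite py pz.
have hs : has_sum (fun y => if cod y then f (psi y) else 0).
  split; last by exists (ssum F).
  by move=> y; case: ifP.
by split=> //; apply: ssum_le.
Qed.

End SumNonneg.

Section SquareSummable.
Context {R : realType} (X : choiceType).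
Implicit Types (x y z : X -> R[i]).

Definition sqr x : X -> R := fun i => nrm (x i) ^+ 2.

Definition l2 x := has_sum (sqr x).

Definition n2 x : R := ssum (sqr x).

(** The real part of the usual inner product, by polarization, so that only sums of nonnegative
    terms have to be defined. *)
Definition dot x y : R := 2^-1 * (n2 (x + y) - n2 x - n2 y).

Lemma sqr_ReIm x i : sqr x i = Re (x i) ^+ 2 + Im (x i) ^+ 2.
Proof. exact: nrm_sqr. Qed.

Lemma cReD (a b : R[i]) : Re (a + b) = Re a + Re b. Proof. by case: a; case: b. Qed.
Lemma cImD (a b : R[i]) : Im (a + b) = Im a + Im b. Proof. by case: a; case: b. Qed.
Lemma cReN (a : R[i]) : Re (- a) = - Re a. Proof. by case: a. Qed.
Lemma cImN (a : R[i]) : Im (- a) = - Im a. Proof. by case: a. Qed.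
Lemma cReM (a b : R[i]) : Re (a * b) = Re a * Re b - Im a * Im b.
Proof. by case: a; case: b. Qed.
Lemma cImM (a b : R[i]) : Im (a * b) = Re a * Im b + Im a * Re b.
Proof. by case: a; case: b. Qed.
Lemma cReC (a : R[i]) : Re (Num.conj a) = Re a. Proof. by case: a. Qed.
Lemma cImC (a : R[i]) : Im (Num.conj a) = - Im a. Proof. by case: a. Qed.

Lemma fct_addE x y i : (x + y) i = x i + y i. Proof. by []. Qed.
Lemma fct_oppE x i : (- x) i = - x i. Proof. by []. Qed.
Lemma fct_scaleE (k : R[i]) x i : (k *: x) i = k * x i. Proof. by []. Qed.

Definition ReImE := (fct_addE, fct_oppE, fct_scaleE, cReD, cImD, cReN, cImN, cReM, cImM, cReC, cImC).

Lemma sqr_fun_ge0 x i : 0 <= sqr x i. Proof. exact: exprn_ge0 (nrm_ge0 _). Qed.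

Lemma sqrZ (k : R[i]) x : sqr (k *: x) = fun i => nrm k ^+ 2 * sqr x i.
Proof. by apply/funext => i; rewrite /sqr -exprMn -nrmM. Qed.

Lemma l2_0 : l2 0.
Proof.
split=> [i|]; first exact: sqr_fun_ge0.
by exists 0 => s _; rewrite big1 // => i _; rewrite /sqr nrm0 expr0n.
Qed.

Lemma l2Z (k : R[i]) x : l2 x -> l2 (k *: x).
Proof. by move=> xl; rewrite /l2 sqrZ; apply: has_sumZ => //; rewrite exprn_ge0 ?nrm_ge0. Qed.

Lemma nrmD_sqr (a b : R[i]) : nrm (a + b) ^+ 2 <= 2 * nrm a ^+ 2 + 2 * nrm b ^+ 2.
Proof.
rewrite !nrm_sqr !ReImE; have := sqr_ge0 (Re a - Re b).
by have := sqr_ge0 (Im a - Im b); lra.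
Qed.

Lemma l2D x y : l2 x -> l2 y -> l2 (x + y).
Proof.
move=> xl yl; apply: (@has_sum_le _ _ _ (fun i => 2 * sqr x i + 2 * sqr y i)).
  by move=> i; rewrite sqr_fun_ge0 nrmD_sqr.
by apply: has_sumD; apply: has_sumZ.
Qed.

Lemma l2N x : l2 x -> l2 (- x).
Proof. by rewrite -scaleN1r; exact: l2Z. Qed.

Lemma n2_ge0 x : l2 x -> 0 <= n2 x.
Proof. exact: ssum_ge0. Qed.

Lemma n2Z (k : R[i]) x : l2 x -> n2 (k *: x) = nrm k ^+ 2 * n2 x.
Proof. by move=> xl; rewrite /n2 sqrZ ssumZ ?exprn_ge0 ?nrm_ge0. Qed.

Lemma n2_ge x i : l2 x -> nrm (x i) ^+ 2 <= n2 x.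
Proof. exact: (@ssum_ge _ _ (sqr x)). Qed.

Lemma dotC x y : dot x y = dot y x.
Proof. by rewrite /dot [y + x]addrC addrAC. Qed.

Lemma dotDl x y z : l2 x -> l2 y -> l2 z -> dot (x + y) z = dot x z + dot y z.
Proof.
move=> xl yl zl; rewrite /dot.
have xyl := l2D xl yl; have yzl := l2D yl zl; have xzl := l2D xl zl.
have xyzl := l2D xyl zl.
(* Free of subtractions, each side merges into a single [ssum], and the identity can be checked
   pointwise. *)
suff : n2 (x + y + z) + (n2 x + (n2 y + n2 z)) = n2 (x + y) + (n2 (y + z) + n2 (x + z)).
  by move=> h; lra.
rewrite /n2 -!ssumD; do ?[by []|apply: has_sumD].
by congr ssum; apply/funext => i; rewrite !sqr_ReIm !ReImE; ring.
Qed.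

Lemma dotZ (k : R[i]) x y : l2 x -> l2 y -> dot (k *: x) y = dot x (Num.conj k *: y).
Proof.
move=> xl yl; rewrite /dot !n2Z // nrm_conj.
have kxl := l2Z k xl; have kyl := l2Z (Num.conj k) yl.
have h1 := l2D kxl yl; have h2 := l2D xl kyl.
have k0 : 0 <= nrm k ^+ 2 by rewrite exprn_ge0 ?nrm_ge0.
suff : n2 (k *: x + y) + (n2 x + nrm k ^+ 2 * n2 y) =
    n2 (x + Num.conj k *: y) + (nrm k ^+ 2 * n2 x + n2 y) by move=> h; lra.
have hx := has_sumZ k0 xl; have hy := has_sumZ k0 yl.
rewrite /n2 -!ssumZ // -!ssumD; do ?[by []|apply: has_sumD].
congr ssum; apply/funext => i; rewrite !sqr_ReIm nrm_sqr.
by rewrite !ReImE; ring.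
Qed.

Lemma dot_xx x : l2 x -> dot x x = n2 x.
Proof.
move=> xl; rewrite /dot (_ : x + x = (2 : R)%:C *: x).
  by rewrite n2Z // nrm_real ger0_norm //; lra.
by rewrite rmorph_nat scaler_nat mulr2n.
Qed.

Lemma n2D x y : n2 (x + y) = n2 x + n2 y + 2 * dot x y.
Proof. by rewrite /dot; lra. Qed.

Lemma dot_lt x y : l2 x -> l2 y -> `|2 * dot x y| <= n2 x + n2 y.
Proof.
move=> xl yl; have h1 := n2_ge0 (l2D xl yl).
have h2 := n2_ge0 (l2D xl (l2N yl)).
have h3 : n2 (x + y) + n2 (x - y) = 2 * n2 x + 2 * n2 y.
  have t0 : (0 : R) <= 2 by [].
  have hx := has_sumZ t0 xl; have hy := has_sumZ t0 yl.
  have h4 := l2D xl yl; have h5 := l2D xl (l2N yl).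
  rewrite /n2 -!ssumZ // -!ssumD //.
  by congr ssum; apply/funext => i; rewrite !sqr_ReIm !ReImE; ring.
by move: h1 h2 h3; rewrite (n2D x y) ler_norml; lra.
Qed.

Lemma n2_eq0 x : l2 x -> n2 x = 0 -> x = 0.
Proof.
move=> xl x0; apply/funext => i; apply: nrm_eq0; apply/eqP.
have := n2_ge i xl; rewrite x0 => h.
by rewrite -(sqrf_eq0 (nrm _)) eq_le h exprn_ge0 ?nrm_ge0.
Qed.

Lemma dot0 x : l2 x -> dot x 0 = 0.
Proof.
move=> xl; have n20 : n2 (0 : X -> R[i]) = 0.
  by rewrite -(scale0r x) n2Z // nrm0 expr0n mul0r.
by rewrite /dot addr0 n20; lra.
Qed.

Lemma cauchy_schwarz x y : l2 x -> l2 y ->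
  `|dot x y| <= Num.sqrt (n2 x) * Num.sqrt (n2 y).
Proof.
move=> xl yl; have [x0|x0] := eqVneq (n2 x) 0.
  rewrite (n2_eq0 xl x0) dotC (dot0 yl) normr0.
  by rewrite mulr_ge0 ?sqrtr_ge0.
have [y0|y0] := eqVneq (n2 y) 0.
  by rewrite (n2_eq0 yl y0) (dot0 xl) normr0 mulr_ge0 ?sqrtr_ge0.
set a := Num.sqrt (n2 x); set b := Num.sqrt (n2 y).
have a0 : 0 < a by rewrite sqrtr_gt0 lt_def x0 n2_ge0.
have b0 : 0 < b by rewrite sqrtr_gt0 lt_def y0 n2_ge0.
(* Rescaling x by c and y by 1/c keeps [dot] and equalizes the two norms, which makes [dot_lt]
   sharp. *)
pose c := Num.sqrt (b / a).
have c0 : 0 < c by rewrite sqrtr_gt0 divr_gt0.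
have -> : dot x y = dot (c%:C *: x) (c^-1%:C *: y).
  rewrite dotZ //; last exact: l2Z.
  rewrite scalerA (_ : _ * _ = 1) ?scale1r //.
  have -> : Num.conj (c%:C : R[i]) = c%:C by exact: conjc_real.
  by rewrite -rmorphM divff ?gt_eqF.
have := dot_lt (l2Z c%:C xl) (l2Z c^-1%:C yl).
have ci0 : 0 <= c^-1 by rewrite invr_ge0 ltW.
rewrite !n2Z // !nrm_real (ger0_norm ci0) (ger0_norm (ltW c0)) exprVn.
have -> : c ^+ 2 = b / a by rewrite sqr_sqrtr // divr_ge0 ?ltW.
have -> : n2 x = a ^+ 2 by rewrite sqr_sqrtr // n2_ge0.
have -> : n2 y = b ^+ 2 by rewrite sqr_sqrtr // n2_ge0.
have -> : b / a * a ^+ 2 + (b / a)^-1 * b ^+ 2 = 2 * (a * b).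
  by field; rewrite !gt_eqF.
by rewrite normrM ger0_norm //; lra.
Qed.

Lemma n2_triangle x y : l2 x -> l2 y ->
  Num.sqrt (n2 (x + y)) <= Num.sqrt (n2 x) + Num.sqrt (n2 y).
Proof.
move=> xl yl; have := cauchy_schwarz xl yl; rewrite ler_norml => /andP[_].
set a := Num.sqrt (n2 x); set b := Num.sqrt (n2 y) => ab.
have a0 : 0 <= a by exact: sqrtr_ge0.
have b0 : 0 <= b by exact: sqrtr_ge0.
rewrite -[leRHS]ger0_norm ?addr_ge0 // -sqrtr_sqr; apply: ler_wsqrtr.
have a2 : a ^+ 2 = n2 x by rewrite sqr_sqrtr // n2_ge0.
have b2 : b ^+ 2 = n2 y by rewrite sqr_sqrtr // n2_ge0.
by rewrite sqrrD a2 b2 n2D; lra.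
Qed.

Definition l2_pred : {pred (X -> R[i])} := fun x => `[< l2 x >].

Lemma l2_submod_closed : submod_closed l2_pred.
Proof.
split; first by apply/asboolP; exact: l2_0.
by move=> k x y /asboolP xl /asboolP yl; apply/asboolP/l2D => //; exact: l2Z.
Qed.

End SquareSummable.

HB.instance Definition _ (R : realType) (X : choiceType) :=
  GRing.isSubmodClosed.Build _ _ (@l2_pred R X) (@l2_submod_closed R X).

Record ell2 (R : realType) (X : choiceType) := Ell2 {
  ell2_fun :> X -> R[i];
  ell2P : ell2_fun \in @l2_pred R X
}.

HB.instance Definition _ (R : realType) (X : choiceType) :=
  [isSub for @ell2_fun R X].
HB.instance Definition _ (R : realType) (X : choiceType) :=
  [Choice of ell2 R X by <:].
HB.instance Definition _ (R : realType) (X : choiceType) :=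
  [SubChoice_isSubLmodule of ell2 R X by <:].

Section Ell2Norm.
Context {R : realType} (X : choiceType).
Implicit Types x y : ell2 R X.

Lemma ell2_l2 x : l2 x. Proof. exact/asboolP/ell2P. Qed.

Lemma ell2_scaleE (k : R[i]) x i : (k *: x) i = k * x i. Proof. by []. Qed.

Let cnorm x : R[i] := (Num.sqrt (n2 x))%:C.

Let cnormD x y : cnorm (x + y) <= cnorm x + cnorm y.
Proof. by rewrite /cnorm -rmorphD lecR n2_triangle //; exact: ell2_l2. Qed.

Let cnormZ (k : R[i]) x : cnorm (k *: x) = `|k| * cnorm x.
Proof.
rewrite /cnorm normE -rmorphM /=; congr (_%:C).
rewrite (_ : n2 _ = nrm k ^+ 2 * n2 x); last by rewrite -n2Z //; exact: ell2_l2.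
by rewrite sqrtrM ?exprn_ge0 ?nrm_ge0 // sqrtr_sqr ger0_norm ?nrm_ge0.
Qed.

Let cnorm0_eq0 x : cnorm x = 0 -> x = 0.
Proof.
move=> /complexI/eqP; rewrite sqrtr_eq0 => h; apply/val_inj/n2_eq0.
  exact: ell2_l2.
by apply/le_anti; rewrite h n2_ge0 //; exact: ell2_l2.
Qed.

HB.instance Definition _ :=
  Lmodule_isNormed.Build R[i] (ell2 R X) cnormD cnormZ cnorm0_eq0.

Lemma nrm_ell2 x : nrm x = Num.sqrt (n2 x). Proof. by []. Qed.

Lemma nrm_ell2_sqr x : nrm x ^+ 2 = n2 x.
Proof. by rewrite nrm_ell2 sqr_sqrtr // n2_ge0 //; exact: ell2_l2. Qed.

Lemma ell2_le (f : X -> R[i]) (C : R) : 0 <= C -> sums_le (sqr f) (C ^+ 2) ->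
  {x : ell2 R X | ell2_fun x = f & nrm x <= C}.
Proof.
move=> C0 fC; have fl : l2 f by split=> [i|]; [exact: sqr_fun_ge0 | exists (C ^+ 2)].
exists (Ell2 (asboolT fl)) => //.
rewrite -ler_sqr ?nnegrE ?nrm_ge0 // nrm_ell2_sqr; exact: ssum_le.
Qed.

Lemma nrm_ell2_ge x i : nrm (x i) <= nrm x.
Proof.
rewrite -ler_sqr ?nnegrE ?nrm_ge0 // nrm_ell2_sqr.
exact: (n2_ge i (ell2_l2 x)).
Qed.

Lemma ell2_cauchy (u : nat -> ell2 R X) : cauchy_seq u -> exists l, tends u l.
Proof.
move=> uc; have /choice[f uf] (i : X) : exists l, tends (fun n => u n i) l.
  apply: complex_cauchy_tends => e /uc[N NP]; exists N => m n Nm Nn.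
  by apply: le_trans (NP m n Nm Nn); exact: (nrm_ell2_ge (u m - u n) i).
have bound e N : 0 < e ->
    (forall m n, (N <= m)%N -> (N <= n)%N -> nrm (u m - u n) <= e) ->
    forall n, (N <= n)%N -> sums_le (sqr (fun i => u n i - f i)) ((2 * e) ^+ 2).
  move=> e0 NP n Nn s us.
  (* Coordinates closer than d contribute at most (size s) d^2 <= e^2 over [s]. The factor 2 in
     [bound] comes from [nrmD_sqr]. *)
  have [d d0 eE] : exists2 d, 0 < d & e = d * (1 + (size s)%:R).
    exists (e / (size s).+1%:R); first by rewrite divr_gt0 // ltr0n.
    by rewrite nat1r divfK // pnatr_eq0.
  have [M MP] : exists M, forall m, (M <= m)%N -> forall i, i \in s -> nrm (u m i - f i) <= d.
    elim: (s) => [|i t [M MP]]; first by exists 0%N.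
    have [K KP] := uf i d d0; exists (maxn K M) => m.
    rewrite geq_max => /andP[/KP Km /MP Mm] j; rewrite inE => /predU1P[->//|].
    exact: Mm.
  pose m := maxn M N.
  have h1 : \sum_(i <- s) sqr (u n - u m) i <= e ^+ 2.
    apply: le_trans (_ : nrm (u n - u m) ^+ 2 <= _).
      by rewrite nrm_ell2_sqr; apply: ssum_ub => //; exact: ell2_l2.
    by rewrite ler_sqr ?nnegrE ?nrm_ge0 ?(ltW e0) // NP ?leq_maxr.
  have h2 : \sum_(i <- s) sqr (fun i => u m i - f i) i <= e ^+ 2.
    apply: le_trans (_ : \sum_(i <- s) d ^+ 2 <= _).
      rewrite big_seq [leRHS]big_seq; apply: ler_sum => i si.
      by rewrite ler_sqr ?nnegrE ?nrm_ge0 ?(ltW d0) // MP ?leq_maxl.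
    rewrite big_const_seq count_predT iter_addr_0 -mulr_natl.
    rewrite eE exprMn [leRHS]mulrC ler_wpM2r ?exprn_ge0 ?(ltW d0) //.
    have : (0 : R) <= (size s)%:R by rewrite ler0n.
    by move: (_%:R) => q q0; rewrite sqrrD; nra.
  apply: le_trans (_ : 2 * (\sum_(i <- s) sqr (u n - u m) i) +
      2 * (\sum_(i <- s) sqr (fun i => u m i - f i) i) <= _); last first.
    by rewrite exprMn; lra.
  rewrite !mulr_sumr -big_split; apply: ler_sum => i _.
  have := nrmD_sqr ((u n - u m) i) (u m i - f i).
  by rewrite [_ + _](_ : _ = u n i - f i) //= addrA subrK.
have [N NP] := uc 1 ltr01.
have two0 : (0 : R) <= 2 * 1 by [].
(* The pointwise limit f is square-summable because u_N - f is; hence the limit is entered as u_N -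
   g. *)
have [g gE _] := ell2_le two0 (bound 1 N ltr01 NP N (leqnn _)).
exists (u N - g).
have gf : ell2_fun (u N - g) = f.
  by apply/funext => i; rewrite [LHS]/= gE subKr.
move=> e e0; have e20 : 0 < e / 2 by rewrite divr_gt0.
have [M MP] := uc _ e20; exists M => n Mn.
have [h hE hl] := ell2_le (ltW (mulr_gt0 (ltr0n _ 2) e20)) (bound _ M e20 MP n Mn).
have -> : u n - (u N - g) = h.
  by apply/val_inj; rewrite /= -[RHS]/(ell2_fun h) hE; apply/funext => i; rewrite -gf.
by rewrite (le_trans hl) // mulrC divfK.
Qed.

Lemma ell2_complete (F : set_system (ell2 R X)) :
  ProperFilter F -> cauchy F -> cvg F.
Proof. by move: F; apply: cauchy_complete_seq; exact: ell2_cauchy. Qed.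

HB.instance Definition _ := Uniform_isComplete.Build (ell2 R X) ell2_complete.

(** Being real, this form is symmetric, so the identity serves as [ip_swap]. Complex scalars are
    still controlled, because [ipZ] moves them from one argument to the other. *)
Let ip2 x y : R[i] := (dot x y)%:C.

Let ip2Dl x y z : ip2 (x + y) z = ip2 x z + ip2 y z.
Proof. by rewrite /ip2 -rmorphD; congr (_%:C); apply: dotDl; exact: ell2_l2. Qed.

Let ip2C x y : ip2 y x = id (ip2 x y).
Proof. by rewrite /ip2 dotC. Qed.

Let ip2Dr x y z : ip2 x (y + z) = ip2 x y + ip2 x z.
Proof. by rewrite ip2C ip2Dl ip2C; congr (_ + _); exact: ip2C. Qed.

Let ip2Z (k : R[i]) x y : ip2 (k *: x) y = ip2 x (Num.conj k *: y).
Proof. by rewrite /ip2; congr (_%:C); apply: dotZ; exact: ell2_l2. Qed.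

Let ip2_le x y : nrm (ip2 x y) <= nrm x * nrm y.
Proof. by rewrite nrm_real; apply: cauchy_schwarz; exact: ell2_l2. Qed.

Let ip2_xx x : nrm (ip2 x x) = nrm x ^+ 2.
Proof.
rewrite nrm_real nrm_ell2_sqr dot_xx; last exact: ell2_l2.
by rewrite ger0_norm // n2_ge0 //; exact: ell2_l2.
Qed.

Definition ell2_module : ipModule R :=
  IPModule ip2Dl ip2Dr ip2Z ip2C ip2_le ip2_xx.

Lemma ip_ell2 (x y : ell2_module) : ip x y = (dot x y)%:C. Proof. by []. Qed.

End Ell2Norm.

(** * Weighted partial injections *)

Section PartialInjection.
Context {R : realType} (X : choiceType).
Variables (dom cod : pred X) (phi psi : X -> X).

Definition partial_inverse :=
  (forall y, cod y -> dom (psi y) /\ phi (psi y) = y) /\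
  (forall x, dom x -> cod (phi x) /\ psi (phi x) = x).

Hypothesis inv : partial_inverse.

Lemma ssum_reindex (f : X -> R) : has_sum f ->
  ssum (fun y => if cod y then f (psi y) else 0) = ssum (fun x => if dom x then f x else 0).
Proof.
move=> fs; have [H1 H2] := inv; have [hs le1] := has_sum_reindex H1 fs.
apply/le_anti; rewrite le1 /=; have [_ le2] := has_sum_reindex H2 hs.
apply: le_trans (le_trans _ le2) _; rewrite le_eqVlt; apply/predU1l; congr ssum; apply/funext => x.
  by case: ifP => // /H2[-> ->].
by case: (cod x).
Qed.

Variable w : R[i].
Hypothesis w1 : nrm w = 1.

(** The partial isometry that sends the basis vector at a point i of [dom] to w times the one at
    [phi i]. Functions are pulled back, whence [psi]. *)
Definition wshift (x : X -> R[i]) : X -> R[i] :=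
  fun y => if cod y then w * x (psi y) else 0.

Lemma sqr_wshift x : sqr (wshift x) = fun y => if cod y then sqr x (psi y) else 0.
Proof.
apply/funext => y; rewrite /sqr /wshift; case: ifP => _; last by rewrite nrm0 expr0n.
by rewrite nrmM w1 mul1r.
Qed.

Lemma l2_wshift x : l2 x -> l2 (wshift x).
Proof.
move=> xl; rewrite /l2 sqr_wshift; have [H1 _] := inv.
by have [] := has_sum_reindex H1 xl.
Qed.

Lemma n2_wshift x : l2 x -> n2 (wshift x) = ssum (fun i => if dom i then sqr x i else 0).
Proof. by move=> xl; rewrite /n2 sqr_wshift ssum_reindex. Qed.

Lemma n2_wshift_le x : l2 x -> n2 (wshift x) <= n2 x.
Proof.
move=> xl; rewrite n2_wshift //; have [x0 _] := xl.
have hs : has_sum (fun i => if dom i then sqr x i else 0).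
  by apply: has_sum_le (xl) => i; case: ifP; rewrite ?x0 ?lexx.
apply: ssum_le => // s us; apply: le_trans (ssum_ub xl us).
by apply: ler_sum => i _; case: ifP.
Qed.

Definition ell2_wshift (x : ell2 R X) : ell2 R X :=
  Ell2 (asboolT (l2_wshift (ell2_l2 x))).

End PartialInjection.

Lemma partial_inverse_sym (X : choiceType) (dom cod : pred X) (phi psi : X -> X) :
  partial_inverse dom cod phi psi -> partial_inverse cod dom psi phi.
Proof. by case. Qed.

Section WeightedShift.
Context {R : realType} (X : choiceType).
Variables (dom cod : pred X) (phi psi : X -> X) (w : R[i]).
Hypotheses (inv : partial_inverse dom cod phi psi) (w1 : nrm w = 1).

Let inv' := partial_inverse_sym inv.

Lemma conj_w1 : nrm (Num.conj w) = 1. Proof. by rewrite nrm_conj. Qed.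

Lemma conj_mul_w : Num.conj w * w = 1.
Proof.
have := sqr_normc w; rewrite normE w1 expr1n mulrC => {1}->.
by rewrite mulrC.
Qed.

Lemma mul_conj_w : w * Num.conj w = 1.
Proof. by rewrite mulrC conj_mul_w. Qed.

(** By polarization it suffices to compare |T x + y|^2 with |x + T' y|^2. Reindexing, and taking out
    w of modulus 1, reduces both to the sum of [F] over [dom], plus y off [cod] and x off [dom]
    respectively. *)
Lemma dot_wshift (x y : X -> R[i]) : l2 x -> l2 y ->
  dot (wshift cod psi w x) y = dot x (wshift dom phi (Num.conj w) y).
Proof.
move=> xl yl; have [H1 H2] := inv.
have [x0 _] := xl; have [y0 _] := yl.
have Txl := l2_wshift inv w1 xl; have Tyl := l2_wshift inv' conj_w1 yl.
pose F i := if dom i then nrm (w * x i + y (phi i)) ^+ 2 else 0.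
have [ys _] := has_sum_reindex H2 yl.
have Fs : has_sum F.
  apply: (@has_sum_le _ _ _ (fun i => 2 * sqr x i +
      2 * (if dom i then sqr y (phi i) else 0))); last first.
    by apply: has_sumD; apply: has_sumZ.
  move=> i; rewrite /F; case: ifP => _.
    rewrite exprn_ge0 ?nrm_ge0 //=; apply: le_trans (nrmD_sqr _ _) _.
    by rewrite nrmM w1 mul1r.
  by rewrite lexx mulr0 addr0 mulr_ge0 // x0.
have xd : has_sum (fun i => if dom i then sqr x i else 0).
  by apply: has_sum_le (xl) => i; case: ifP; rewrite ?x0 ?lexx.
have yc : has_sum (fun i => if cod i then sqr y i else 0).
  by apply: has_sum_le (yl) => i; case: ifP; rewrite ?y0 ?lexx.
have FE : ssum (fun j => if cod j then F (psi j) else 0) = ssum F.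
  rewrite (ssum_reindex inv Fs); congr ssum; apply/funext => i.
  by rewrite /F; case: (dom i).
have [Fc _] := has_sum_reindex H1 Fs.
have Txyl := l2D Txl yl; have xTyl := l2D xl Tyl.
have e1 : n2 (wshift cod psi w x + y) + ssum (fun i => if cod i then sqr y i else 0) =
    ssum F + n2 y.
  rewrite -FE /n2 -!ssumD //; congr ssum; apply/funext => j.
  rewrite /sqr fct_addE /wshift /F; case: ifP => [/H1[-> ->]|_]; last by rewrite add0r addrC.
  by [].
have e2 : n2 (x + wshift dom phi (Num.conj w) y) + ssum (fun i => if dom i then sqr x i else 0) =
    ssum F + n2 x.
  rewrite /n2 -!ssumD //; congr ssum; apply/funext => i.
  rewrite /sqr fct_addE /wshift /F; case: ifP => _; last by rewrite !addr0 add0r.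
  congr (_ ^+ 2 + _); have -> : w * x i + y (phi i) = w * (x i + Num.conj w * y (phi i)).
    by rewrite mulrDr mulrA mul_conj_w mul1r.
  by rewrite nrmM w1 mul1r.
have e3 := n2_wshift inv w1 xl; have e4 := n2_wshift inv' conj_w1 yl.
rewrite /dot; congr (_ * _); move: e1 e2; rewrite e3 e4; lra.
Qed.

Lemma wshift_adjointable : adjointable (ell2_wshift inv w1 : ell2_module X -> ell2_module X).
Proof.
split.
- exists 1 => // x; rewrite mul1r -ler_sqr ?nnegrE ?nrm_ge0 // !nrm_ell2_sqr.
  exact/(n2_wshift_le inv w1)/ell2_l2.
- move=> k x; apply/val_inj/funext => y.
  rewrite [RHS](_ : _ = k * wshift cod psi w x y) //.
  rewrite [LHS](_ : _ = wshift cod psi w (k *: (x : X -> R[i])) y) //.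
  by rewrite /wshift fct_scaleE; case: ifP => _; [rewrite mulrCA | rewrite mulr0].
- exists (ell2_wshift inv' conj_w1) => x y; rewrite !ip_ell2; congr (_%:C).
  by apply: dot_wshift; exact: ell2_l2.
Qed.

Definition shiftOp : adjOp (ell2_module X) := mk_adjop wshift_adjointable.

Lemma shiftOpE (x : ell2_module X) (y : X) :
  (shiftOp x : ell2 R X) y = if cod y then w * (x : ell2 R X) (psi y) else 0.
Proof. by []. Qed.

End WeightedShift.

Lemma star_shiftOp (R : realType) (X : choiceType) (dom cod : pred X)
    (phi psi : X -> X) (w : R[i]) (inv : partial_inverse dom cod phi psi) (w1 : nrm w = 1) :
  star (shiftOp inv w1) = shiftOp (partial_inverse_sym inv) (conj_w1 w1).
Proof.
apply: star_adjoint => x y; rewrite !ip_ell2; congr (_%:C).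
by apply: (dot_wshift inv w1); exact: ell2_l2.
Qed.

Section CoordinateProjections.
Context {R : realType} (X : choiceType).
Implicit Types (P Q : pred X).

Lemma ell2_op_scaleE (k : R[i]) (T : adjOp (@ell2_module R X)) (x : ell2 R X) i :
  ((k *: T) x : ell2 R X) i = k * (T x : ell2 R X) i.
Proof. by []. Qed.

Lemma ell2_op_subE (S T : adjOp (@ell2_module R X)) (x : ell2 R X) i :
  ((S - T) x : ell2 R X) i = (S x : ell2 R X) i - (T x : ell2 R X) i.
Proof. by []. Qed.

Lemma ell2_op_mulZE (k : R[i]) (T : adjOp (@ell2_module R X)) (x : ell2 R X) i :
  (T (k *: x) : ell2 R X) i = k * (T x : ell2 R X) i.
Proof. by rewrite adjopZ. Qed.

Lemma partial_inverse_id P : partial_inverse P P id id.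
Proof. by []. Qed.

Definition projOp P : adjOp (ell2_module X) :=
  shiftOp (partial_inverse_id P) (@nrm1 R).

Lemma ell2_op_eq (S T : adjOp (@ell2_module R X)) :
  (forall (x : ell2 R X) (i : X), (S x : ell2 R X) i = (T x : ell2 R X) i) -> S = T.
Proof. by move=> ST; apply: adjop_eq => x; apply/val_inj/funext => i; exact: ST. Qed.

Lemma projOpE P (x : ell2 R X) i : (projOp P x : ell2 R X) i = if P i then x i else 0.
Proof. by rewrite shiftOpE; case: ifP => // _; rewrite mul1r. Qed.

Lemma projOpM P Q : projOp P ** projOp Q = projOp (fun i => P i && Q i).
Proof.
apply: ell2_op_eq => x i; rewrite adjop_cmul !projOpE.
by case: (P i); case: (Q i).
Qed.

Lemma star_projOp P : star (projOp P) = projOp P.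
Proof.
rewrite star_shiftOp; apply: ell2_op_eq => x i; rewrite !shiftOpE.
by case: ifP => // _; rewrite conjC1.
Qed.

Lemma projOp_projection P : is_projection (projOp P).
Proof.
split; [exact: star_projOp | rewrite projOpM].
by apply: ell2_op_eq => x i; rewrite !projOpE andbb.
Qed.

Definition delta_fun (a : X) : X -> R[i] := fun i => (i == a)%:R.

Lemma delta_l2 a : l2 (delta_fun a).
Proof.
split=> [i|]; first exact: sqr_fun_ge0.
exists 1 => s us; rewrite /sqr /delta_fun.
have [sa|sa] := boolP (a \in s).
  rewrite (perm_big _ (perm_to_rem sa)) big_cons eqxx nrm1 expr1n big_seq big1.
    by rewrite /= addr0.
  move=> i; rewrite mem_rem_uniq // inE => /andP[/negPf -> _].
  by rewrite nrm0 expr0n.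
rewrite big_seq big1 ?ler01 // => i si.
by case: eqP => [ia|_]; [rewrite -ia si in sa | rewrite nrm0 expr0n].
Qed.

Definition delta a : ell2 R X := Ell2 (asboolT (delta_l2 a)).

Lemma deltaE a i : delta a i = (i == a)%:R. Proof. by []. Qed.

End CoordinateProjections.

(** * The boundary path representation *)

Section BoundaryPaths.
Variable E : digraph.
Implicit Types (v : vertex E) (e f : edge E) (g : nat -> option (edge E)).

Fixpoint vert_at v g n : vertex E :=
  if n is m.+1 then if g m is Some e then rng e else vert_at v g m else v.

(** A path may stop only at a singular vertex. At a regular vertex it has a next edge, which is what
    relation (3) expresses. *)
Definition bpath_valid v g := forall n,
  if g n is Some e then src e = vert_at v g n else is_singular (vert_at v g n).

(* Infinite paths, and finite paths ending in a singular vertex; continuing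
   after a [None] is harmless. *)
Record bpath := BPath {
  bstart : vertex E;
  bedges : nat -> option (edge E);
  bpathP : bpath_valid bstart bedges
}.

HB.instance Definition _ := gen_eqMixin bpath.
HB.instance Definition _ := gen_choiceMixin bpath.

Implicit Types (x y : bpath).

Lemma bpath_eq x y : bstart x = bstart y -> bedges x =1 bedges y -> x = y.
Proof.
case: x y => [v g gP] [v' g' gP'] /= vv /funext gg.
by subst v' g'; congr BPath; exact: Prop_irrelevance.
Qed.

Definition bhead x := bedges x 0%N.

Lemma bhead_src x e : bhead x = Some e -> src e = bstart x.
Proof. by move=> xe; have := bpathP x 0%N; rewrite -/(bhead x) xe. Qed.

Lemma bhead_regular x : ~ is_singular (bstart x) -> exists e, bhead x = Some e.
Proof.
move=> ns; have := bpathP x 0%N; rewrite -/(bhead x).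
by case: (bhead x) => [e _|/ns//]; exists e.
Qed.

Lemma vert_at_shift v g n :
  vert_at (vert_at v g 1) (fun m => g m.+1) n = vert_at v g n.+1.
Proof. by elim: n => //= n ->. Qed.

Lemma btail_valid x :
  bpath_valid (vert_at (bstart x) (bedges x) 1) (fun n => bedges x n.+1).
Proof. by move=> n; rewrite vert_at_shift; exact: (bpathP x n.+1). Qed.

Definition btail x := BPath (btail_valid x).

Definition cons_edges e g n := if n is m.+1 then g m else Some e.

Lemma bcons_valid e x : bstart x = rng e ->
  bpath_valid (src e) (cons_edges e (bedges x)).
Proof.
move=> xe [|n] //; have E1 : vert_at (src e) (cons_edges e (bedges x)) n.+1 =
    vert_at (bstart x) (bedges x) n by rewrite -vert_at_shift /= -xe.
by rewrite E1; exact: bpathP.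
Qed.

(** The default [x] makes the map total; [bpath_inv] only considers paths starting at [rng e]. *)
Definition bcons e x :=
  if pselect (bstart x = rng e) is left xe then BPath (bcons_valid xe) else x.

Lemma bconsP e x : bstart x = rng e ->
  [/\ bhead (bcons e x) = Some e, bstart (bcons e x) = src e & btail (bcons e x) = x].
Proof.
move=> xe; rewrite /bcons; case: pselect => // xe'; split=> //.
by apply: bpath_eq.
Qed.

Lemma btailP e y : bhead y = Some e -> bstart (btail y) = rng e /\ bcons e (btail y) = y.
Proof.
move=> ye; have ty : bstart (btail y) = rng e by rewrite /= -/(bhead y) ye.
split=> //; rewrite /bcons; case: pselect => // ty'; apply: bpath_eq => /=.
  exact: bhead_src.
by case=> [|n] //=; rewrite -ye.
Qed.

Lemma bpath_inv e : partial_inverse (fun x => bstart x == rng e)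
  (fun y => bhead y == Some e) (bcons e) btail.
Proof.
split=> [y /eqP /btailP[-> ->]|x /eqP /bconsP[-> _ ->]]; by rewrite eqxx.
Qed.

(** Follow a chosen outgoing edge at each regular vertex and stay put from the first singular vertex
    on. This is what makes every vertex projection nonzero. *)
Lemma bpath_from v : exists x, bstart x = v.
Proof.
have /choice[nxt nxtP] (u : vertex E) :
    exists o : option (edge E), if o is Some e then src e = u else is_singular u.
  have [us|uns] := pselect (is_singular u); first by exists None.
  have : out_edges u !=set0 by apply/set0P/eqP => u0; apply: uns; left.
  by move=> [e eu]; exists (Some e).
pose V := fix V n := if n is m.+1 then
  if nxt (V m) is Some e then rng e else V m else v.
have VE n : vert_at v (fun m => nxt (V m)) n = V n.
  by elim: n => //= n ->.
have gP : bpath_valid v (fun m => nxt (V m)) by move=> n; rewrite VE; exact: nxtP.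
by exists (BPath gP).
Qed.

End BoundaryPaths.

Section PathRepresentation.
Context {R : realType} (E : digraph).
Variable w : edge E -> R[i].
Hypothesis w1 : forall e, nrm (w e) = 1.
Local Notation B := (adjOp (@ell2_module R (bpath E))).
Implicit Types (v : vertex E) (e f : edge E).

Definition rep_p v : B := projOp (fun x => bstart x == v).

Definition rep_s e : B := shiftOp (bpath_inv e) (w1 e).

Lemma rep_s_range e : rep_s e ** star (rep_s e) = projOp (fun x => bhead x == Some e).
Proof.
rewrite star_shiftOp; apply: ell2_op_eq => x i.
rewrite adjop_cmul shiftOpE projOpE shiftOpE; case: eqP => // /btailP[-> ->].
by rewrite eqxx mulrA mul_conj_w // mul1r.
Qed.

Lemma rep_s_source e : star (rep_s e) ** rep_s e = rep_p (rng e).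
Proof.
rewrite star_shiftOp; apply: ell2_op_eq => x i.
rewrite adjop_cmul shiftOpE projOpE shiftOpE; case: eqP => // /bconsP[-> _ ->].
by rewrite eqxx mulrA conj_mul_w // mul1r.
Qed.

Lemma rep_CK_family : is_CK_family rep_p rep_s.
Proof.
split.
- move=> v; exact: projOp_projection.
- move=> v v' vv; rewrite /orthogonal_projections projOpM; apply: ell2_op_eq => x i.
  by rewrite projOpE; case: eqP => //= ->; case: eqP.
- move=> e; rewrite /is_partial_isometry -cmulA rep_s_source.
  apply: ell2_op_eq => x i; rewrite adjop_cmul !shiftOpE; case: eqP => // /btailP[-> _].
  by rewrite eqxx mul1r.
- move=> e f ef; rewrite /orthogonal_projections !rep_s_range projOpM.
  apply: ell2_op_eq => x i; rewrite projOpE; case: eqP => //= ->.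
  by case: eqP => // -[].
- exact: rep_s_source.
(* The difference is the projection onto the paths from [src e] with another first edge or none; a
   projection is its own witness of positivity. *)
- move=> e; exists (projOp (fun x => (bstart x == src e) && (bhead x != Some e))).
  have [-> ->] := @projOp_projection R _ (fun x => (bstart x == src e) && (bhead x != Some e)).
  rewrite rep_s_range; apply: ell2_op_eq => x i.
  rewrite adjop_add adjop_opp.
  have -> : (rep_p (src e) x - projOp (fun y => bhead y == Some e) x : ell2 R _) i =
      (rep_p (src e) x : ell2 R _) i - (projOp (fun y => bhead y == Some e) x : ell2 R _) i by [].
  rewrite !projOpE; have [/bhead_src ->|_] := eqVneq (bhead i) (Some e).
    by rewrite eqxx subrr.
  by rewrite andbT subr0.
- move=> v ns; have fin : finite_set (out_edges v).
    by apply: contrapT => inf; apply: ns; right.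
  rewrite fsbig_finite //=; apply: ell2_op_eq => x i.
  have sumE (r : seq (edge E)) :
      ((\sum_(e <- r) (rep_s e ** star (rep_s e))) x : ell2 R _) i =
      \sum_(e <- r) if bhead i == Some e then x i else 0.
    elim: r => [|e r IH]; first by rewrite !big_nil.
    rewrite !big_cons -IH; have := projOpE (fun y => bhead y == Some e) x i.
    by rewrite -rep_s_range => <-.
  rewrite sumE projOpE; case: eqP => [iv|iv]; last first.
    rewrite big_seq big1 // => e; rewrite in_fset_set // inE /out_edges /= => ev.
    by case: eqP => // /bhead_src; rewrite ev => /esym.
  (* A path from a regular vertex has exactly one first edge, so exactly one summand survives. *)
  have [|e ie] := @bhead_regular _ i; first by rewrite iv.
  have ev : e \in fset_set (out_edges v).
    by rewrite in_fset_set // inE /out_edges /= -iv; exact: bhead_src.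
  rewrite (bigD1_seq e) ?fset_uniq //= ie eqxx big1 ?addr0 // => f fe.
  by case: eqP => // -[ef]; rewrite ef eqxx in fe.
Qed.

Lemma rep_p_delta (x : bpath E) v : rep_p v (delta x) = if bstart x == v then delta x else 0.
Proof.
apply/val_inj/funext => y; rewrite [LHS]projOpE deltaE.
case: (eqVneq y x) => [->|yx].
  by case: (bstart x == v); rewrite // -[RHS]/((x == x)%:R) eqxx.
rewrite if_same; case: (bstart x == v) => //.
by rewrite -[RHS]/((y == x)%:R) (negPf yx).
Qed.

Lemma rep_s_delta (x : bpath E) e : bstart x = rng e ->
  rep_s e (delta x) = w e *: delta (bcons e x).
Proof.
move=> xe; have [h1 h2 h3] := bconsP xe.
apply/val_inj/funext => y; rewrite [LHS]shiftOpE [RHS]fct_scaleE deltaE.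
rewrite -[\val (delta _) y]/((y == bcons e x)%:R).
have [->|yx] := eqVneq y (bcons e x); first by rewrite h1 h3 !eqxx.
case: eqP => [/btailP[_ ye]|_]; last by rewrite mulr0.
case: eqP => [tx|_]; last by rewrite !mulr0.
by move: yx; rewrite -ye tx eqxx.
Qed.

Lemma rep_p_neq0 v : rep_p v <> 0.
Proof.
have [x xv] := bpath_from v => p0.
have := rep_p_delta x v; rewrite p0 xv eqxx => /(congr1 (fun d : ell2 R _ => d x)).
by rewrite deltaE eqxx => /eqP; rewrite eq_sym oner_eq0.
Qed.

End PathRepresentation.

(** * Winding is impossible in an AF-algebra *)

Section Winding.
Context {R : realType}.

(** K, M and q are the values of a character at k, k e and e. The hypotheses give (K - 3) (1 - q) <=
    2/100 with K near 4. In [arith_bottom] they give (3 - K) q <= 2/100 with K near 2. *)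
Let arith_top (K M q : R) : `|K - (3 + 1)| <= 100^-1 -> `|M - K * q| <= 2 / 100 ->
  K <= 3 - 3 * q + M -> q < 2^-1 -> False.
Proof. by rewrite !ler_norml => /andP[h1 _] /andP[_ h2] h3 h4; nra. Qed.

Let arith_bottom (K M q : R) : `|K - (3 - 1)| <= 100^-1 -> `|M - K * q| <= 2 / 100 ->
  3 * q <= M -> 2^-1 < q -> False.
Proof. by rewrite !ler_norml => /andP[_ h1] /andP[_ h2] h3 h4; nra. Qed.

Variable A : cstarAlgType R.
Variables (p s : A) (chi : R -> A -> R[i]).
Hypotheses (pP : is_projection p) (ps : p ** s = s) (sp : s ** p = s).
Hypotheses
  (chiD : forall t a b, chi t (a + b) = chi t a + chi t b)
  (chiZ : forall t (k : R[i]) a, chi t (k *: a) = k * chi t a)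
  (chi_le : forall t a, nrm (chi t a) <= nrm a)
  (chi_mul : forall t a b, chi t (a ** p ** b) = chi t a * chi t b)
  (chi_star : forall t a, chi t (star a) = Num.conj (chi t a))
  (chi_pos : forall t a, 0 <= Re (chi t (star a ** a)))
  (chi_p : forall t, chi t p = 1)
  (chi_cont : forall a, continuous (fun t => Re (chi t a)))
  (chi_s : forall t, chi t s = cos t +i* sin t).

(* A spectral projection [e] of an approximant of [3 p + (s + star s) / 2] in a
   finite-dimensional subalgebra almost commutes with [p], hence [chi t e] is
   nearly [0] or [1]; but it is near [1] at [t = 0] and near [0] at [t = pi]. *)
Lemma AF_no_winding : ~ is_AF A.
Proof.
move=> AFA; have [pstar pp] := pP.
have chiB t a b : chi t (a - b) = chi t a - chi t b.
  by rewrite chiD -scaleN1r chiZ mulN1r.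
(* [chi t x] = 3 + cos t crosses the threshold 3 between t = 0 and t = pi. Above 3 the function 1/u
   is bounded by 1, so e = k g with |g| <= 1, and e inherits from k the near commutation with p. *)
pose x := (3 : R[i]) *: p + (2^-1 : R[i]) *: (s + star s).
have xsa : star x = x.
  rewrite /x starD !starZ starD starK pstar conj_half rmorph_nat.
  by rewrite [star s + s]addrC.
have psp : p ** star s = star s by rewrite -{1}pstar -starM sp.
have sps : star s ** p = star s by rewrite -{1}pstar -starM ps.
have px : p ** x = x by rewrite /x cmulDr !cmulZr cmulDr pp ps psp.
have xp : x ** p = x by rewrite /x cmulDl !cmulZl cmulDl pp sp sps.
pose eps : R := 100^-1; have eps0 : 0 < eps by rewrite invr_gt0.
have [F [Fsub Ffd [y [_ [Fy _ xy _]]]]] := AF_approx AFA x x eps0.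
pose k := (2^-1 : R[i]) *: (y + star y).
have [F0 FD FZ FM Fs _] := Fsub.
have Fk : F k by apply: (FZ); apply: (FD) => //; exact: Fs.
have ksa : star k = k.
  by rewrite /k starZ starD starK conj_half [star y + y]addrC.
have xk : nrm (x - k) <= eps.
  have -> : x - k = (2^-1 : R[i]) *: ((x - y) + star (x - y)).
    by rewrite /k starB xsa; lmod; field.
  rewrite nrmZ nrm_half; have := nrmD (x - y) (star (x - y)).
  by rewrite nrm_star; move: xy; lra.
have p1 := nrm_projection pP.
have pk : nrm (k - p ** k) <= 2 * eps.
  have -> : k - p ** k = p ** (x - k) - (x - k) by rewrite cmulBr px; lmod; ring.
  have := nrmB (p ** (x - k)) (x - k); have := nrm_cmul p (x - k).
  have := ler_wpM2r (nrm_ge0 (x - k)) p1; move: xk; lra.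
have kp : nrm (k - k ** p) <= 2 * eps.
  by rewrite -nrm_star starB starM ksa pstar.
have [fc [[_ fcsa] fcM fcD fcZ fc_id]] := finite_calculus Fsub Ffd Fk ksa.
pose ind (u : R) : R := if 3 < u then 1 else 0.
pose e := fc ind; pose g := fc (fun u => ind u / u).
have fcE f h : (forall u, f u = h u) -> fc f = fc h by move=> /funext ->.
have eP : is_projection e.
  split; first exact: fcsa.
  by rewrite fcM; apply: fcE => u; rewrite /ind; case: ifP; rewrite ?mulr1 ?mulr0.
have e1 := nrm_projection eP.
have eg : e = k ** g.
  rewrite -[in RHS]fc_id fcM; apply: fcE => u; rewrite /ind.
  case: ifP => [u3|_]; last by rewrite mul0r mulr0.
  by rewrite mul1r divff // gt_eqF //; lra.
have g1 : nrm g <= 1.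
  (* Chosen so that g^2 + h^2 = e, which has norm at most 1. *)
  pose h := fc (fun u => Num.sqrt (ind u - (ind u / u) ^+ 2)).
  apply: (@nrm_pair_le1 _ _ g h); rewrite ?fcsa // ?fcM.
    by apply: fcE => u; rewrite mulrC.
  rewrite -fcD; apply: le_trans e1; rewrite le_eqVlt; apply/predU1l.
  congr nrm; apply: fcE => u.
  rewrite -[Num.sqrt _ * _]/(Num.sqrt _ ^+ 2) sqr_sqrtr; first by rewrite expr2; ring.
  rewrite /ind; case: ifP => [u3|_]; last by rewrite mul0r expr0n subrr.
  have u0 : 0 < u by lra.
  by rewrite mul1r subr_ge0 exprVn invf_le1 ?exprn_gt0 // expr_ge1 //; lra.
pose r t := Re (chi t e).
have im0 t a : star a = a -> Im (chi t a) = 0.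
  by move=> aa; have /(congr1 (@complex.Im R)) := chi_star t a; rewrite aa cImC; lra.
have Re_le t a : `|Re (chi t a)| <= nrm a.
  exact: le_trans (nrm_Re _) (chi_le t a).
(* [chi t] is multiplicative only across p, so r - r^2 is its value at e - e p e = e (k - p k) g,
   which is small. *)
have r_mul t : `|r t - r t * r t| <= 2 * eps.
  have h : Re (chi t (e - e ** p ** e)) = r t - r t * r t.
    by rewrite chiB chi_mul cReD cReN cReM im0 ?mulr0 ?subr0 //; exact: fcsa.
  rewrite -h; apply: le_trans (Re_le _ _) _.
  have -> : e - e ** p ** e = e ** ((k - p ** k) ** g).
    have [_ ee] := eP; rewrite -{1}ee cmulBl cmulBr -eg; congr (_ - _).
    by rewrite {2}eg !cmulA.
  rewrite (le_trans (nrm_cmul _ _)) //.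
  have := nrm_cmul (k - p ** k) g.
  have := nrm_ge0 ((k - p ** k) ** g); have := nrm_ge0 e; have := nrm_ge0 g.
  have := nrm_ge0 (k - p ** k); nra.
have chi_ke t : `|Re (chi t (k ** e)) - Re (chi t k) * r t| <= 2 * eps.
  have h : Re (chi t ((k - k ** p) ** e)) = Re (chi t (k ** e)) - Re (chi t k) * r t.
    rewrite cmulBl chiB chi_mul cReD cReN cReM (im0 _ _ ksa) mul0r subr0 //.
  rewrite -h; apply: le_trans (Re_le _ _) _.
  have := nrm_cmul (k - k ** p) e.
  have := nrm_ge0 e; have := nrm_ge0 (k - k ** p); nra.
have chi_x t : Re (chi t x) = 3 + cos t.
  rewrite /x chiD !chiZ chi_p chiD chi_star chi_s.
  have -> : (cos t +i* sin t) + Num.conj (cos t +i* sin t) = (2 * cos t)%:C.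
    by apply/eqP; rewrite eq_complex /= subrr eqxx andbT; apply/eqP; ring.
  have -> : 3 * 1 + 2^-1 * (2 * cos t)%:C = (3 + cos t)%:C :> R[i].
    by rewrite !rmorphD !rmorphM /= !rmorph_nat; field.
  by [].
have chi_k t : `|Re (chi t k) - (3 + cos t)| <= eps.
  rewrite -chi_x distrC -cReN -cReD -chiB; exact: le_trans (Re_le _ _) xk.
(* The functions ind (u - 3) and, for [k_le], (1 - ind) (3 - u) are nonnegative, so their images are
   squares to which [chi_pos] applies. *)
have ke_ge t : 3 * r t <= Re (chi t (k ** e)).
  pose c := fc (fun u => Num.sqrt (ind u * (u - 3))).
  have cc : star c ** c = k ** e + ((-3)%:C : R[i]) *: e.
    rewrite fcsa fcM -[in RHS]fc_id fcM -fcZ -fcD; apply: fcE => u /=.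
    rewrite -[Num.sqrt _ * _]/(Num.sqrt _ ^+ 2) sqr_sqrtr; first by ring.
    by rewrite /ind; case: ifP => [u3|_]; rewrite ?mul0r ?mul1r //; lra.
  have := chi_pos t c; rewrite cc chiD chiZ cReD cReM /= mul0r subr0 -/(r t).
  by lra.
have k_le t : Re (chi t k) <= 3 - 3 * r t + Re (chi t (k ** e)).
  pose c := fc (fun u => Num.sqrt ((1 - ind u) * (3 - u))).
  (* The support projection of k stands in for the unit; its character value is at most 1. *)
  pose s1 := fc (fun=> 1).
  have cc : star c ** c = (3%:C : R[i]) *: s1 + ((-3)%:C : R[i]) *: e +
      ((-1)%:C *: k + k ** e).
    rewrite fcsa fcM -[in RHS]fc_id fcM -!fcZ -!fcD; apply: fcE => u /=.
    rewrite -[Num.sqrt _ * _]/(Num.sqrt _ ^+ 2) sqr_sqrtr; first by ring.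
    rewrite /ind; case: ifP => [u3|/negbT]; first by rewrite subrr mul0r.
    by rewrite -leNgt subr0 mul1r; lra.
  have s1P : is_projection s1.
    by split; [exact: fcsa | rewrite fcM; apply: fcE => u; rewrite mulr1].
  have := le_trans (Re_le t s1) (nrm_projection s1P); rewrite ler_norml => /andP[_].
  have := chi_pos t c; rewrite cc !chiD !chiZ !cReD !cReM /= !mul0r !subr0 -/(r t).
  by lra.
have epsE : eps = 100^-1 by [].
have r0 : 2^-1 <= r 0.
  rewrite leNgt; apply/negP => r2; have kx := chi_k 0; rewrite cos0 in kx.
  exact: (arith_top kx (chi_ke 0) (k_le 0) r2).
have rpi : r pi <= 2^-1.
  rewrite leNgt; apply/negP => r2; have kx := chi_k pi; rewrite cospi in kx.
  exact: (arith_bottom kx (chi_ke pi) (ke_ge pi) r2).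
(* At a point where r = 1/2, r - r^2 is 1/4, against the bound 2/100. *)
have [|||t _ rt] := @IVT R r 0 pi 2^-1.
- exact: pi_ge0.
- exact/continuous_subspaceT/chi_cont.
- by rewrite ge_min le_max r0 rpi orbT.
by have := r_mul t; rewrite rt epsE ler_norml; lra.
Qed.

End Winding.

(** * Loops *)

Section Loops.
Context {E : digraph}.
Implicit Types (e f a : edge E) (c q : seq (edge E)).

Lemma cycle_loop e q : cycle (@composable E) (e :: q) <-> is_loop e q.
Proof.
rewrite /= rcons_path; split=> [/andP[h /eqP lx]|[h lx]]; first by split.
by apply/andP; split=> //; rewrite /composable lx.
Qed.

(** Cutting before the next occurrence of [e] leaves a shorter loop. Once [e] occurs a single time,
    twisting it multiplies the loop by e^(it) exactly. *)
Lemma loop_trim e q : is_loop e q -> exists q', is_loop e q' /\ e \notin q'.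
Proof.
have [n] := ubnP (size q); elim: n q => // n IH q qn loop.
have [eq|] := boolP (e \in q); last by exists q.
case/splitPr: eq loop qn => q1 q2 [pq _] qn.
move: pq; rewrite /is_path cat_path /= => /and3P[p1 /eqP le _].
apply: (IH q1) => //; move: qn; rewrite size_cat /= addnS ltnS.
exact/leq_trans/leq_addr.
Qed.

Definition no_exit c := forall a f, a \in c -> src f = src a -> f = a.

Lemma no_exit_path_edge c x : cycle (@composable E) c -> no_exit c ->
  (exists2 a, a \in c & bstart x = src a) -> forall n,
  exists2 a, a \in c & vert_at (bstart x) (bedges x) n = src a /\ bedges x n = Some a.
Proof.
move=> cc noexit [a0 a0c xa0].
(* The source of [a] emits only [a], so it is neither a sink nor an infinite emitter: the path
   cannot stop there and has no choice. *)
have next a n : a \in c -> vert_at (bstart x) (bedges x) n = src a -> bedges x n = Some a.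
  move=> ac va; have := bpathP x n; rewrite va; case: (bedges x n) => [b /noexit -> //|].
  case=> [/seteqP[/(_ a) h _]|inf]; first by case: h.
  exfalso; apply: inf; apply: (@sub_finite_set _ _ [set a]); last exact: finite_set1.
  by move=> b /= /noexit; apply.
elim=> [|n [a ac [va xa]]]; first by exists a0 => //; split=> //; exact: next.
have vn : vert_at (bstart x) (bedges x) n.+1 = src (path.next c a).
  by rewrite /= xa; apply/eqP; exact: (next_cycle cc ac).
by exists (path.next c a); rewrite ?mem_next //; split=> //; apply: next => //; rewrite mem_next.
Qed.

Lemma no_exit_path_unique c x y : cycle (@composable E) c -> no_exit c ->
  (exists2 a, a \in c & bstart x = src a) -> bstart x = bstart y -> x = y.
Proof.
move=> cc noexit xc xy; have yc := xc; rewrite xy in yc.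
have xP := no_exit_path_edge cc noexit xc; have yP := no_exit_path_edge cc noexit yc.
suff H n : vert_at (bstart x) (bedges x) n = vert_at (bstart y) (bedges y) n /\
    bedges x n = bedges y n.
  by apply: bpath_eq => // n; have [] := H n.
have edge_eq m : vert_at (bstart x) (bedges x) m = vert_at (bstart y) (bedges y) m ->
    bedges x m = bedges y m.
  move=> vv; have [a ac [va ->]] := xP m; have [b bc [vb ->]] := yP m.
  by congr Some; apply: noexit => //; rewrite -va -vb.
elim: n => [|n [IHv IHe]]; first by split=> //; exact: edge_eq.
have vv : vert_at (bstart x) (bedges x) n.+1 = vert_at (bstart y) (bedges y) n.+1.
  by rewrite /= IHe IHv.
by split=> //; exact: edge_eq.
Qed.

End Loops.

Section LoopIsometry.
Context {R : realType} (E : digraph) (A : cstarAlgType R).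
Variables (p : vertex E -> A) (s : edge E -> A).
Hypothesis ck : is_CK_family p s.
Implicit Types (e f : edge E) (q : seq (edge E)).

Lemma p_word_cons e q v : p (src e) ** word p s (e :: q) v = word p s (e :: q) v.
Proof. by rewrite /= cmulA (s_source ck). Qed.

Lemma star_word_isometry e q : is_path e q ->
  star (word p s (e :: q) (rng (last e q))) ** word p s (e :: q) (rng (last e q)) =
  p (rng (last e q)).
Proof.
elim: q e => [|f q IH] e.
  move=> _; rewrite /= starM (star_p ck) -cmulA (cmulA (star (s e))) (star_s_s ck) eqxx.
  by rewrite !(p_idem ck).
rewrite /is_path [path _ _ _]/= => /andP[/eqP ef pq].
have -> : word p s (e :: f :: q) (rng (last e (f :: q))) =
    s e ** word p s (f :: q) (rng (last f q)) by [].
rewrite starM -cmulA (cmulA (star (s e))) (star_s_s ck) eqxx ef p_word_cons.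
exact: IH.
Qed.

(** The loop element S satisfies S [star S] = p_v. An exit f <> e has range orthogonal to that of S,
    so [star (s f)] = [star (s f)] S [star S] = 0, and p at [rng f] would vanish. *)
Lemma AF_loop_no_exit e q f : is_AF A -> (forall v, p v <> 0) ->
  is_loop e q -> src f = src e -> f = e.
Proof.
move=> AFA p0 [pq le] fe; apply: contrapT => nfe; apply: (p0 (rng f)).
set v := rng (last e q) in le; pose S := word p s (e :: q) v.
have SS : S ** star S = p v.
  apply: AF_isometry => //; first exact: (ck_projection ck).
  - exact: star_word_isometry.
  - by rewrite -le p_word_cons.
  - exact: (word_p ck).
have fS : star (s f) ** S = 0.
  by rewrite /S /= cmulA (star_s_s ck); case: eqP => // _; rewrite cmul0l.
have : star (s f) = 0.
  rewrite -[LHS](_ : star (s f) ** p v = _); first by rewrite -SS cmulA fS cmul0l.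
  by rewrite -(star_p ck) -starM -le -fe (s_source ck).
by move=> sf; rewrite -(ck_source ck) sf cmul0l.
Qed.

(** Rotate the loop so that the given edge comes first. *)
Lemma AF_no_exit e q : is_AF A -> (forall v, p v <> 0) -> is_loop e q ->
  no_exit (e :: q).
Proof.
move=> AFA p0 /cycle_loop cc b f /rot_to[i c' ci] fb.
apply: (@AF_loop_no_exit b c') => //; apply/cycle_loop.
by rewrite -ci rot_cycle.
Qed.

End LoopIsometry.

(** * Star homomorphisms and continuous families of them *)

Section StarHom.
Context {R : realType} (A B : cstarAlgType R) (f : A -> B).
Hypothesis fh : is_star_hom f.

Lemma star_homD x y : f (x + y) = f x + f y.
Proof. by have := star_hom_linear fh 1 x y; rewrite !scale1r. Qed.

Lemma star_hom0 : f 0 = 0.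
Proof. by apply: (addrI (f 0)); rewrite -star_homD !addr0. Qed.

Lemma star_homZ (k : R[i]) x : f (k *: x) = k *: f x.
Proof. by have := star_hom_linear fh k x 0; rewrite star_hom0 !addr0. Qed.

Lemma star_homB x y : f (x - y) = f x - f y.
Proof. by rewrite -scaleN1r star_homD star_homZ scaleN1r. Qed.

Lemma star_hom_word (E : digraph) (p : vertex E -> A) (s : edge E -> A)
    (p' : vertex E -> B) (s' : edge E -> B) al v :
  (forall v, f (p v) = p' v) -> (forall e, f (s e) = s' e) ->
  f (word p s al v) = word p' s' al v.
Proof. by move=> fp fs; elim: al => [|e al IH] //=; rewrite (star_homM fh) fs IH. Qed.

End StarHom.

Section ContinuousFamily.
Context {R : realType}.
Variables (A B : cstarAlgType R) (X : set A) (rho : R -> A -> B).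
Hypotheses (genX : cstar_generates X) (rho_hom : forall t, is_star_hom (rho t))
  (rho_le : forall t a, nrm (rho t a) <= nrm a)
  (rhoX : forall a, X a -> forall t0 (eps : R), 0 < eps -> exists2 del, 0 < del &
     forall t, `|t0 - t| < del -> nrm (rho t0 a - rho t a) <= eps).

(** The elements on which the family is continuous form a C*-subalgebra, closed because the maps are
    uniformly contractive, and it contains the generators. *)
Lemma hom_family_continuous a t0 (eps : R) : 0 < eps -> exists2 del, 0 < del &
  forall t, `|t0 - t| < del -> nrm (rho t0 a - rho t a) <= eps.
Proof.
pose C : set A := [set a | forall t0 (eps : R), 0 < eps -> exists2 del, 0 < del &
  forall t, `|t0 - t| < del -> nrm (rho t0 a - rho t a) <= eps].
have CE b : C b -> forall t0 (eps : R), 0 < eps -> exists2 del, 0 < del &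
  forall t, `|t0 - t| < del -> nrm (rho t0 b - rho t b) <= eps by [].
suff CT : C = [set: A].
  have : C a by rewrite CT.
  by move/CE; apply.
move=> {a t0 eps}; apply: genX => //; split.
- move=> t0 eps eps0; exists 1 => // t _.
  by rewrite !(star_hom0 (rho_hom _)) subrr nrm0 ltW.
- move=> a b /CE Ca /CE Cb t0 eps eps0; have eps2 : 0 < eps / 2 by rewrite divr_gt0.
  have [x x0 xP] := Ca t0 _ eps2; have [y y0 yP] := Cb t0 _ eps2.
  exists (Num.min x y); first by rewrite lt_min x0.
  move=> t; rewrite lt_min => /andP[/xP h1 /yP h2].
  rewrite !(star_homD (rho_hom _)) opprD addrACA.
  apply: le_trans (nrmD _ _) _; rewrite (splitr eps); exact: lerD.
- move=> k a /CE Ca t0 eps eps0; have k1 : 0 < nrm k + 1 by rewrite ltr_wpDl ?nrm_ge0.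
  have [x x0 xP] := Ca t0 _ (divr_gt0 eps0 k1); exists x => // t /xP h.
  rewrite !(star_homZ (rho_hom _)) -scalerBr nrmZ.
  rewrite (le_trans (ler_wpM2l (nrm_ge0 _) h)) // mulrA ler_pdivrMr // mulrC.
  by rewrite ler_wpM2l ?(ltW eps0) // lerDl.
- move=> a b /CE Ca /CE Cb t0 eps eps0.
  have a1 : 0 < nrm a + 1 by rewrite ltr_wpDl ?nrm_ge0.
  have b1 : 0 < nrm b + 1 by rewrite ltr_wpDl ?nrm_ge0.
  have eps2 : 0 < eps / 2 by rewrite divr_gt0.
  have [x x0 xP] := Ca t0 _ (divr_gt0 eps2 b1).
  have [y y0 yP] := Cb t0 _ (divr_gt0 eps2 a1).
  exists (Num.min x y); first by rewrite lt_min x0.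
  move=> t; rewrite lt_min => /andP[/xP h1 /yP h2]; rewrite !(star_homM (rho_hom _)).
  have -> : rho t0 a ** rho t0 b - rho t a ** rho t b =
      (rho t0 a - rho t a) ** rho t0 b + rho t a ** (rho t0 b - rho t b).
    by rewrite cmulBl cmulBr addrA subrK.
  apply: le_trans (nrmD _ _) _; rewrite (splitr eps); apply: lerD.
    apply: le_trans (nrm_cmul _ _) _.
    apply: le_trans (ler_pM (nrm_ge0 _) (nrm_ge0 _) h1 (rho_le _ _)) _.
    by rewrite mulrAC ler_pdivrMr // ler_wpM2l ?lerDl // ltW.
  apply: le_trans (nrm_cmul _ _) _.
  apply: le_trans (ler_pM (nrm_ge0 _) (nrm_ge0 _) (rho_le _ _) h2) _.
  by rewrite mulrA ler_pdivrMr // mulrC ler_wpM2l ?lerDl // ltW.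
- move=> a /CE Ca t0 eps /(Ca t0)[x x0 xP]; exists x => // t /xP h.
  by rewrite !(star_hom_star (rho_hom _)) -starB nrm_star.
- move=> a /closureP aC t0 eps eps0; have eps3 : 0 < eps / 3 by rewrite divr_gt0.
  have [b /CE Cb ab] := aC _ eps3; have [x x0 xP] := Cb t0 _ eps3.
  exists x => // t /xP h.
  have h1 : nrm (rho t0 a - rho t0 b) <= eps / 3.
    rewrite -(star_homB (rho_hom _)); exact: le_trans (rho_le _ _) (ltW ab).
  have h2 : nrm (rho t b - rho t a) <= eps / 3.
    rewrite nrmC -(star_homB (rho_hom _)); exact: le_trans (rho_le _ _) (ltW ab).
  have h3 := nrm_dist (rho t0 a) (rho t0 b) (rho t a).
  have h4 := nrm_dist (rho t0 b) (rho t b) (rho t a).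
  apply: le_trans h3 _; apply: le_trans (lerD h1 h4) _.
  by apply: le_trans (lerD (lexx _) (lerD h h2)) _; rewrite le_eqVlt; apply/predU1l; field.
Qed.

End ContinuousFamily.

(** * The character at an isolated boundary path *)

Section UniquePath.
Context {R : realType} (E : digraph) (xi : bpath E).
Hypothesis xi_unique : forall x, bstart x = bstart xi -> x = xi.
Local Notation B := (adjOp (@ell2_module R (bpath E))).
Local Notation P := (@rep_p R E (bstart xi)).
Local Notation d := (@delta R _ xi).
(** The diagonal matrix entry at [xi], read off as a coordinate because [ip] retains only real
    parts. *)
Definition coef (T : B) : R[i] := (T d : ell2 R _) xi.

(** Since [xi] is alone at its start, the vertex projection has rank one. Its corner is therefore
    one-dimensional, and [coef] is multiplicative across [P]. *)
Lemma P_E (x : ell2 R (bpath E)) : P x = x xi *: d.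
Proof.
apply/val_inj/funext => i; rewrite [LHS]projOpE.
rewrite [RHS](_ : _ = x xi * (i == xi)%:R) //.
case: eqP => [/xi_unique->|iv]; first by rewrite eqxx mulr1.
by case: eqP => [ix|_]; [case: iv; rewrite ix | rewrite mulr0].
Qed.

Lemma d_xi : d xi = 1. Proof. by rewrite deltaE eqxx. Qed.

Lemma P_d : P d = d. Proof. by rewrite P_E d_xi scale1r. Qed.

Lemma d_gt0 : 0 < nrm d.
Proof.
apply: nrm_gt0 => d0; have := d_xi; rewrite d0 => /eqP.
by rewrite eq_sym oner_eq0.
Qed.

Lemma P_le1 : nrm P <= 1.
Proof. exact/nrm_projection/projOp_projection. Qed.

Lemma P_sa : star P = P. Proof. exact: star_projOp. Qed.

Lemma coef_le T : nrm (coef T) <= nrm T.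
Proof.
have h : nrm (P (T d)) = nrm (coef T) * nrm d by rewrite P_E; exact: nrmZ.
rewrite -(ler_pM2r d_gt0) -h; apply: le_trans (nrm_adjop_le P (T d)) _.
rewrite -[leRHS]mul1r; apply: ler_pM; [exact: nrm_ge0|exact: nrm_ge0|exact: P_le1|].
exact: nrm_adjop_le.
Qed.

Lemma compress (T : B) : P ** T ** P = coef T *: P.
Proof.
apply: adjop_eq => x; rewrite [RHS](_ : _ = coef T *: P x) //.
rewrite [LHS](_ : _ = P (T (P x))) // [P x]P_E adjopZ adjopZ P_E.
by rewrite scalerA scalerA mulrC.
Qed.

Lemma coefZ (k : R[i]) T : coef (k *: T) = k * coef T.
Proof. exact: ell2_op_scaleE. Qed.

Lemma coefD S T : coef (S + T) = coef S + coef T. Proof. by []. Qed.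

Lemma coefB S T : coef (S - T) = coef S - coef T.
Proof. exact: ell2_op_subE. Qed.

Lemma coefP : coef P = 1. Proof. by rewrite /coef P_d d_xi. Qed.

Lemma coef_star T : coef (star T) = Num.conj (coef T).
Proof.
have := congr1 (fun S : B => coef (star S)) (compress T).
rewrite starZ coefZ P_sa coefP mulr1 => <-.
rewrite !starM P_sa cmulA compress coefZ coefP mulr1 //.
Qed.

(** The positive element [star (T ** P) ** (T ** P)] is z P with z the coefficient in question.
    Applying [coef] to l - z P in the norm criterion gives |l - z| <= l. *)
Lemma coef_pos T : 0 <= Re (coef (star T ** T)).
Proof.
have [_ [l l0]] := is_pos_starM (@adjop_mul1 _ _) (@adjop_1mul _ _) (T ** P).
have -> : star (T ** P) ** (T ** P) = coef (star T ** T) *: P.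
  by rewrite -compress starM P_sa !cmulA.
move=> h; have := le_trans (coef_le _) h.
have one1 : coef (adjop_one _) = 1 by exact: d_xi.
rewrite coefB !coefZ coefP one1 !mulr1 => /(le_trans (nrm_Re _)).
rewrite cReD cReN /= ler_norml => /andP[_].
by lra.
Qed.

Lemma coef_mul S T : coef (S ** P ** T) = coef S * coef T.
Proof.
rewrite {1}/coef [X in ell2_fun X](_ : _ = S (P (T d))) // P_E mulrC.
exact: ell2_op_mulZE.
Qed.

End UniquePath.

(** * Twisting a loop without exit *)

Section GraphAlgebra.
Context {R : realType} (E : digraph) (A : cstarAlgType R).
Variables (p : vertex E -> A) (s : edge E -> A).
Hypothesis hA : is_graph_algebra p s.
Local Notation B := (adjOp (@ell2_module R (bpath E))).

Let ck := graph_algebra_family hA.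

Lemma ex_rep_hom (w : edge E -> R[i]) (w1 : forall e, nrm (w e) = 1) :
  exists f : A -> B, [/\ is_star_hom f, forall v, f (p v) = rep_p v
                     & forall e, f (s e) = rep_s w1 e].
Proof. exact/(graph_algebra_universal hA)/rep_CK_family. Qed.

Lemma graph_p_neq0 v : p v <> 0.
Proof.
have [f [fh fp _]] := ex_rep_hom (fun=> @nrm1 R) => pv.
by apply: (@rep_p_neq0 R E v); rewrite -fp pv (star_hom0 fh).
Qed.

Lemma rep_s_scale (w : edge E -> R[i]) (w1 : forall e, nrm (w e) = 1) e :
  rep_s w1 e = w e *: rep_s (fun=> @nrm1 R) e.
Proof.
apply: ell2_op_eq => x i; rewrite adjop_scale.
rewrite [RHS](_ : _ = w e * (rep_s (fun=> @nrm1 R) e x : ell2 R _) i) //.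
by rewrite !shiftOpE; case: ifP => _; rewrite ?mul1r ?mulr0.
Qed.

Lemma rep_word_delta (w : edge E -> R[i]) (w1 : forall e, nrm (w e) = 1) e q
    (x : bpath E) : is_path e q -> rng (last e q) = bstart x ->
  exists y, bstart y = src e /\
    word (@rep_p R E) (rep_s w1) (e :: q) (bstart x) (delta x) = (\prod_(a <- e :: q) w a) *: delta y.
Proof.
elim: q e => [|f q IH] e.
  move=> _ ex; have {}ex : bstart x = rng e by [].
  exists (bcons e x); have [_ -> _] := bconsP ex; split=> //.
  by rewrite [word _ _ _ _]/= adjop_cmul rep_p_delta eqxx rep_s_delta // big_seq1.
rewrite /is_path [path _ _ _]/= => /andP[/eqP ef pq] le.
have [y [yf yE]] := IH f pq le; exists (bcons e y).
have ye : bstart y = rng e by rewrite ef.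
have [_ -> _] := bconsP ye; split=> //.
have -> : word (@rep_p R E) (rep_s w1) (e :: f :: q) (bstart x) =
  rep_s w1 e ** word (@rep_p R E) (rep_s w1) (f :: q) (bstart x) by [].
by rewrite adjop_cmul yE adjopZ rep_s_delta // scalerA [in RHS]big_cons mulrC.
Qed.

Definition circle (t : R) : R[i] := cos t +i* sin t.

Definition loop_weight (e : edge E) t a : R[i] := if a == e then circle t else 1.

Lemma nrm_loop_weight e t a : nrm (loop_weight e t a) = 1.
Proof.
rewrite /loop_weight; case: ifP => _; last exact: nrm1.
have h : nrm (circle t) ^+ 2 = 1 by rewrite nrm_sqr /= cos2Dsin2.
by apply/eqP; rewrite -(@eqrXn2 _ 2) ?nrm_ge0 // h expr1n.
Qed.

Section TwistedRepresentations.
Variables (e : edge E) (rho : R -> A -> B).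
Hypotheses (rho_hom : forall t, is_star_hom (rho t))
  (rho_p : forall t u, rho t (p u) = rep_p u)
  (rho_s : forall t a, rho t (s a) = rep_s (nrm_loop_weight e t) a).

Lemma rho_le t a : nrm (rho t a) <= nrm a.
Proof.
exact: (star_hom_contractive (@adjop_mul1 _ _) (@adjop_1mul _ _) (rho_hom t)).
Qed.

Lemma rho_cont a t0 (eps : R) : 0 < eps -> exists2 del, 0 < del &
  forall t, `|t0 - t| < del -> nrm (rho t0 a - rho t a) <= eps.
Proof.
apply: (hom_family_continuous (graph_algebra_generated hA) rho_hom rho_le).
move=> {a t0 eps} a [[u _ <-]|[f _ <-]] t0 eps eps0.
  by exists 1 => // t _; rewrite !rho_p subrr nrm0 ltW.
pose N := nrm (rep_s (fun=> @nrm1 R) f) + 1.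
have N0 : 0 < N by rewrite ltr_wpDl ?nrm_ge0.
have eps2 : 0 < eps / 2 / N by rewrite !divr_gt0.
have /cvgrPdist_le /(_ _ eps2) /nbhs_ballP[x /= x0 xP] := @continuous_cos R t0.
have /cvgrPdist_le /(_ _ eps2) /nbhs_ballP[y /= y0 yP] := @continuous_sin R t0.
exists (Num.min x y); first by rewrite lt_min x0.
move=> t; rewrite lt_min => /andP[/xP /= h1 /yP /= h2].
rewrite !rho_s !(rep_s_scale (nrm_loop_weight e _)) -scalerBl nrmZ.
have hw : nrm (loop_weight e t0 f - loop_weight e t f) <= eps / N.
  rewrite /loop_weight; case: ifP => _; last first.
    by rewrite subrr nrm0 ltW // divr_gt0.
  apply: le_trans (nrm_ReIm _) _; rewrite !(cReD, cImD, cReN, cImN) /=.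
  by apply: le_trans (lerD h1 h2) _; rewrite -mulrDl -splitr.
apply: le_trans (ler_wpM2r (nrm_ge0 _) hw) _; rewrite mulrAC ler_pdivrMr //.
by rewrite ler_wpM2l ?(ltW eps0) // lerDl.
Qed.

End TwistedRepresentations.

Lemma no_exit_loop_not_AF (e : edge E) q : is_loop e q -> e \notin q -> no_exit (e :: q) ->
  ~ is_AF A.
Proof.
move=> loop eq noexit; have [pq le] := loop; set v := rng (last e q) in le.
have [xi xiv] := bpath_from v.
have xi_unique x : bstart x = bstart xi -> x = xi.
  move=> xv; apply: (no_exit_path_unique ((cycle_loop e q).2 loop) noexit) => //.
  by exists e; [exact: mem_head | rewrite xv xiv le].
have /choice[rho rhoP] (t : R) := ex_rep_hom (nrm_loop_weight e t).
have rho_hom t : is_star_hom (rho t) by have [] := rhoP t.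
have rho_p t u : rho t (p u) = rep_p u by have [_ h _] := rhoP t; exact: h.
have rho_s t a : rho t (s a) = rep_s (nrm_loop_weight e t) a.
  by have [_ _ h] := rhoP t; exact: h.
pose chi t a := coef xi (rho t a).
apply: (@AF_no_winding R A (p v) (word p s (e :: q) v) chi).
- exact: (ck_projection ck).
- by rewrite -le; exact: (p_word_cons ck).
- exact: (word_p ck).
- by move=> t a b; rewrite /chi (star_homD (rho_hom t)) coefD.
- by move=> t k a; rewrite /chi (star_homZ (rho_hom t)) coefZ.
- move=> t a; exact: le_trans (coef_le xi_unique _) (rho_le rho_hom t a).
- move=> t a b; rewrite /chi !(star_homM (rho_hom t)) rho_p.
  by rewrite -xiv coef_mul.
- by move=> t a; rewrite /chi (star_hom_star (rho_hom t)) coef_star //.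
- move=> t a; rewrite /chi (star_homM (rho_hom t)) (star_hom_star (rho_hom t)).
  exact: (coef_pos xi_unique).
- by move=> t; rewrite /chi rho_p -xiv coefP.
- move=> a t0; apply/cvgrPdist_le => eps eps0.
  have [x x0 xP] := rho_cont rho_hom rho_p rho_s a t0 eps0.
  apply/nbhs_ballP; exists x => // t /= /xP h.
  rewrite -cReN -cReD; apply: le_trans (nrm_Re _) _; rewrite -coefB.
  exact: le_trans (coef_le xi_unique _) h.
- move=> t; rewrite /chi (star_hom_word (rho_hom t) _ _ (rho_p t) (rho_s t)).
  (* The loop carries the basis vector at [xi] to a multiple of one at a path that again starts at
     v, hence at [xi] itself. The multiple is e^(it), as [e] is absent from [q]. *)
  have [y [yv h]] := rep_word_delta (nrm_loop_weight e t) pq (esym xiv).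
  have yxi : y = xi by apply: xi_unique; rewrite yv le xiv.
  rewrite -xiv /coef h yxi big_cons {1}/loop_weight eqxx big_seq big1.
    by rewrite mulr1 [LHS]ell2_scaleE deltaE eqxx mulr1.
  by move=> a aq; rewrite /loop_weight; case: eqP => // ae; rewrite -ae aq in eq.
Qed.

Lemma AF_no_loops : is_AF A -> has_no_loops E.
Proof.
move=> AFA e q /loop_trim[q' [loop eq]].
apply: (no_exit_loop_not_AF loop eq) => //.
exact: (AF_no_exit ck AFA graph_p_neq0 loop).
Qed.

End GraphAlgebra.

Theorem corollary2p13 (R : realType) (E : digraph) (A : cstarAlgType R)
    (p : vertex E -> A) (s : edge E -> A) (hA : is_graph_algebra p s) :
  is_AF A <-> has_no_loops E.
Proof.
split; first exact: (AF_no_loops hA).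
by apply: (no_loops_AF (graph_algebra_family hA)); exact: graph_algebra_generated hA.
Qed.
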